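(* Let $\lambda\in X$. The object $\underline{\mathcal K_\lambda}$ is projective in $\mathbf C$.
   Context: **Alcoves.** $R$ is a finite irreducible root system in a finite dimensional real vector space $V$, with coroots $\alpha^\vee\in V^*$, pairing $\langle\cdot,\cdot\rangle\colon V\times V^*\to\mathbb R$ and a fixed system of positive roots $R^+$. $X=\{\lambda\in V\mid\langle\lambda,\alpha^\vee\rangle\in\mathbb Z\ \forall\alpha\in R\}$, $X^\vee=\{v\in V^*\mid\langle\alpha,v\rangle\in\mathbb Z\ \forall\alpha\in R\}$. For $\alpha\in R^+$, $n\in\mathbb Z$: $H_{\alpha,n}=\{\mu\in V\mid\langle\mu,\alpha^\vee\rangle=n\}$, $H^{+}_{\alpha,n}$ and $H^-_{\alpha,n}$ are the half-spaces $\langle\mu,\alpha^\vee\rangle>n$ and $<n$, and $s_{\alpha,n}(\mu)=\mu-(\langle\mu,\alpha^\vee\rangle-n)\alpha$. Alcoves are the connected components of $V\setminus\bigcup_{\alpha\in R^+,n\in\mathbb Z}H_{\alpha,n}$; $\mathcal A$ is the set of alcoves. The generic Bruhat order $\preceq$ on $\mathcal A$ is the partial order generated by $A\preceq s_{\alpha,n}(A)$ whenever $A\subset H_{\alpha,n}^-$. For $\lambda\in X$ the special section $\mathcal K_\lambda\subset\mathcal A$ is the set of alcoves that contain $\lambda$ in their closure. For $\lambda\in\mathbb ZR$, $t_\lambda$ is translation by $\lambda$; $\mathcal A^\emptyset:=\mathcal A/\mathbb ZR$ and $\pi\colon\mathcal A\to\mathcal A^\emptyset$ is the orbit map. For $\alpha\in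 R^+$ and $A\in\mathcal A$ with $A\subset H_{\alpha,n}^-\cap H_{\alpha,n-1}^+$ put $\alpha\uparrow A:=s_{\alpha,n}(A)$; this is a bijection of $\mathcal A$, and an $\alpha$-string is a set $\{\alpha\uparrow^nA\mid n\in\mathbb Z\}$. **Structure algebra.** $k$ is a field with $\operatorname{char}k\neq2$ such that $\alpha^\vee\notin k\beta^\vee$ in $X^\vee_k:=X^\vee\otimes_{\mathbb Z}k$ for distinct $\alpha,\beta\in R^+$. $S=S(X_k^\vee)$ is the symmetric algebra, graded with $X_k^\vee$ in degree 2. All modules are graded and homomorphisms preserve the grading. For $\mathcal X\subset\mathcal A$, $\mathcal Z(\mathcal X)$ is the graded $S$-algebra of all tuples $(z_A)\in\prod_{A\in\mathcal X}S$ with $z_A\equiv z_{s_{\alpha,n}(A)}\bmod\alpha^\vee$ for all $A\in\mathcal X$, $\alpha\in R^+$, $n\in\mathbb Z$ with $s_{\alpha,n}(A)\in\mathcal X$, and $z_A=z_{t_\lambda(A)}$ for all $A\in\mathcal X$, $\lambda\in\mathbb ZR$ with $t_\lambda(A)\in\mathcal X$. $\mathcal Z:=\mathcal Z(\mathcal A)$. For $\mathcal X'\subset\mathcal X$ there is the projection homomorphism $\mathcal Z(\mathcal X)\to\mathcal Z(\mathcal X')$. $S^\emptyset:=S[(\beta^\vee)^{-1}\mid\beta\in R^+]$, $S^\alpha:=S[(\beta^\vee)^{-1}\mid\beta\in R^+,\beta\ne\alpha]$, $M^\emptyset:=M\otimes_SS^\emptyset$, $M^\alpha:=M\otimes_SS^\alpha$.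 $\mathcal Z\text{-mod}^f$ is the full subcategory of $\mathcal Z$-modules $M$ that are torsion free over $S$ and satisfy $M=\bigcap_{\alpha\in R^+}M^\alpha\subset M^\emptyset$. Since $\mathcal Z^\emptyset=\bigoplus_{x\in\mathcal A^\emptyset}S^\emptyset$ (coordinate at $x$), there is a canonical decomposition $M^\emptyset=\bigoplus_{x\in\mathcal A^\emptyset}M^{\emptyset,x}$; $\operatorname{supp}_{\mathcal Z}M:=\{x\mid M^{\emptyset,x}\neq0\}$. **Sheaves.** $\mathcal A$ is a topological space: $\mathcal J$ is open if $A\in\mathcal J$, $B\preceq A$ imply $B\in\mathcal J$. For a presheaf $\mathscr M$, $\mathscr M^{\mathcal J}$ denotes sections over $\mathcal J$, and $\mathscr M^{\preceq A}$ sections over $\{B\mid B\preceq A\}$. For $\mathcal K$ locally closed, $\mathcal K^-:=\bigcup_{A\in\mathcal K}\{\preceq A\}$, $\mathcal K^-\setminus\mathcal K$ is open, and $\mathscr M_{[\mathcal K]}:=\ker(\mathscr M^{\mathcal K^-}\to\mathscr M^{\mathcal K^-\setminus\mathcal K})$; $\mathscr M_{[A]}:=\mathscr M_{[\{A\}]}$. $\operatorname{supp}_\preceq\mathscr M:=\{A\mid\mathscr M_{[A]}\ne0\}$. $\mathscr M$ is flabby if all restrictions are surjective; it is finitely supported if $\operatorname{supp}_\preceq\mathscr M$ is finite and $\{C\mid\mathscr M^{\preceq C}\neq0\}\subset\bigcup_{i=1}^n\{\succeq A_i\}$ for some $A_1,\dots,A_n\in\mathcal A$. $\mathscr M^\alpha$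 is given by $(\mathscr M^\alpha)^{\mathcal J}=\mathscr M^{\mathcal J}\otimes_SS^\alpha$. The sheaf $\underline{\mathcal K_\lambda}$ of $\mathcal Z$-modules on $\mathcal A$ has sections $\underline{\mathcal K_\lambda}^{\mathcal J}:=\mathcal Z(\mathcal K_\lambda\cap\mathcal J)$ for $\mathcal J$ open, with the projections as restriction homomorphisms. **The category $\mathbf C$.** $\mathbf C$ is the full subcategory of sheaves of $\mathcal Z$-modules $\mathscr M$ on $\mathcal A$ such that: $\mathscr M^{\mathcal J}\in\mathcal Z\text{-mod}^f$ for all open $\mathcal J$; $\mathscr M$ is flabby and finitely supported; (support condition) $\operatorname{supp}_{\mathcal Z}\mathscr M_{[\mathcal K]}\subset\pi(\mathcal K)$ for each locally closed $\mathcal K$; (local extension condition) for each $\alpha\in R^+$, $\mathscr M^\alpha$ is a finite direct sum of sheaves each of which has $\preceq$-support inside a single $\alpha$-string. $\mathbf C$ carries the exact structure whose short exact sequences are those sequences in $\mathbf C$ that are exact as sequences of sheaves of $\mathcal Z$-modules; an object is projective if morphisms from it lift along all epimorphisms of this exact structure (morphisms $\mathscr M\to\mathscr N$ occurring in a short exact sequence $0\to\mathscr L\to\mathscr M\to\mathscr N\to0$ in $\mathbf C$). *)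

(* Defs.v *)
From HB Require Import structures.
From mathcomp Require Import mpoly.
From mathcomp Require Import all_boot all_order all_algebra ring.
From mathcomp Require Import generic_quotient.
From mathcomp Require Import boolp classical_sets functions cardinality reals.
From mathcomp Require Import topology_structure matrix_topology num_topology.
From mathcomp Require Import initial_topology connected.
From Stdlib Require Import Relation_Operators.

Set Implicit Arguments.
Unset Strict Implicit.
Unset Printing Implicit Defensive.

Import numFieldTopology.Exports.
Import GRing.Theory Num.Theory VectorInternalTheory.

Local Open Scope classical_set_scope.
Local Open Scope quotient_scope.
Local Open Scope ring_scope.

Record mult_set (A : comPzRingType) := MultSet {
  mset : set A;
  mset1 : mset 1;
  msetM : forall s t, mset s -> mset t -> mset (s * t) }.

(* [M] is the internal direct sum of the subgroups [gr d], and A_d M_e is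
   contained in M_(d+e). *)
Record is_grading (A : comPzRingType) (grA : int -> set A) (M : lmodType A)
    (gr : int -> set M) : Prop := IsGrading {
  gr0 : forall d, gr d 0;
  grB : forall d x y, gr d x -> gr d y -> gr d (x - y);
  grZ : forall d e a x, grA d a -> gr e x -> gr (d + e) (a *: x);
  gr_span : forall x, exists (s : seq int) (c : int -> M),
    (forall d, gr d (c d)) /\ x = \sum_(d <- s) c d;
  gr_direct : forall (s : seq int) (c : int -> M), uniq s ->
    (forall d, gr d (c d)) -> \sum_(d <- s) c d = 0 ->
    forall d, d \in s -> c d = 0 }.

(* M[D^-1] as fractions m/s, with m/s = m'/s' iff u s' m = u s m' for some u
   in D.  When A is an S-algebra and D is the image of a multiplicative subset
   of S, this is the tensor product over S of M with S[D^-1]. *)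
Section Localization.
Variables (A : comPzRingType) (D : mult_set A).

Definition den := set_type (mset D).
Definition mkden s (hs : mset D s) : den := exist _ s (mem_set hs).
Definition den1 : den := mkden (mset1 D).
Definition denM (s t : den) : den :=
  mkden (msetM (set_mem (valP s)) (set_mem (valP t))).

Lemma val_denM s t : val (denM s t) = val s * val t. Proof. by []. Qed.
Lemma val_den1 : val den1 = 1. Proof. by []. Qed.

Section Def.
Variable M : lmodType A.
Implicit Types (s t u : den) (m : M) (p q : M * den).

Definition frac_eq p q : bool :=
  `[< exists u, (val u * val q.2) *: p.1 = (val u * val p.2) *: q.1 >].

Lemma frac_eq_refl : reflexive frac_eq.
Proof. by move=> p; apply/asboolP; exists den1. Qed.

Lemma frac_eq_sym : symmetric frac_eq.
Proof. by move=> p q; apply/asboolP/asboolP => -[u e]; exists u. Qed.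

Lemma frac_eq_trans : transitive frac_eq.
Proof.
move=> q p r /asboolP[u e] /asboolP[v e']; apply/asboolP.
exists (denM (denM u v) q.2); rewrite !val_denM.
have -> : val u * val v * val q.2 * val r.2
  = val v * val r.2 * (val u * val q.2) by ring.
rewrite -scalerA e scalerA.
have -> : val v * val r.2 * (val u * val p.2)
  = val u * val p.2 * (val v * val r.2) by ring.
by rewrite -scalerA e' scalerA; congr (_ *: _); ring.
Qed.

Canonical frac_equiv := EquivRel frac_eq frac_eq_refl frac_eq_sym frac_eq_trans.

Definition loc := {eq_quot frac_equiv}.
HB.instance Definition _ := Choice.on loc.
HB.instance Definition _ := EqQuotient.on loc.

Definition locfrac m s : loc := \pi_loc (m, s).

Lemma fracP m s m' s' :
  locfrac m s = locfrac m' s' <->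
  exists u : den, (val u * val s') *: m = (val u * val s) *: m'.
Proof.
by split=> [/eqP|h]; [rewrite eqmodE => /asboolP | apply/eqP; rewrite eqmodE; apply/asboolP].
Qed.

Lemma frac_ex (y : loc) : exists m s, y = locfrac m s.
Proof. by case: (repr y) (reprK y) => m s e; exists m, s; rewrite /locfrac e. Qed.

Lemma frac_expand m s t : locfrac m s = locfrac (val t *: m) (denM s t).
Proof.
by apply/fracP; exists den1; rewrite val_denM scalerA; congr (_ *: _); rewrite mulrA.
Qed.

Definition loc_lift (T : Type) (f : M -> den -> T) (y : loc) : T :=
  f (repr y).1 (repr y).2.

Lemma loc_liftE T (f : M -> den -> T) :
  (forall m s m' s', locfrac m s = locfrac m' s' -> f m s = f m' s') ->
  forall m s, loc_lift f (locfrac m s) = f m s.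
Proof.
move=> fP m s; apply: fP; rewrite /locfrac; have := reprK (\pi_loc (m, s)).
by case: (repr _).
Qed.

Definition loc0 : loc := locfrac 0 den1.
Definition locN : loc -> loc := loc_lift (fun m s => locfrac (- m) s).
Definition locD (x : loc) : loc -> loc :=
  loc_lift (fun n t =>
    loc_lift (fun m s => locfrac (val t *: m + val s *: n) (denM s t)) x).
Definition locZ a : loc -> loc := loc_lift (fun m s => locfrac (a *: m) s).

Lemma locNE m s : locN (locfrac m s) = locfrac (- m) s.
Proof.
apply: loc_liftE => {}m {}s m' s' /fracP[u e]; apply/fracP; exists u.
by rewrite !scalerN e.
Qed.

Lemma locZE a m s : locZ a (locfrac m s) = locfrac (a *: m) s.
Proof.
apply: (loc_liftE (f := fun m s => locfrac (a *: m) s)) => {}m {}s m' s'.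
move=> /fracP[u e]; apply/fracP; exists u.
by rewrite !scalerA ![_ * a]mulrC -![(a * _) *: _]scalerA e.
Qed.

Lemma locDE m s n t :
  locD (locfrac m s) (locfrac n t) = locfrac (val t *: m + val s *: n) (denM s t).
Proof.
have aux n' t' m' s' : loc_lift (fun m s => locfrac (val t' *: m + val s *: n') (denM s t'))
    (locfrac m' s') = locfrac (val t' *: m' + val s' *: n') (denM s' t').
  apply: loc_liftE => {m s n t} m s m'' s'' /fracP[u e]; apply/fracP; exists u.
  rewrite !val_denM !scalerDr !scalerA; congr (_ + _ *: _); last by ring.
  have -> : val u * (val s'' * val t') * val t' = val t' * val t' * (val u * val s'')
    by ring.
  by rewrite -scalerA e scalerA; congr (_ *: _); ring.
rewrite /locD loc_liftE ?aux// => {}n {}t n' t' /fracP[u e]; rewrite !aux.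
apply/fracP; exists u; rewrite !val_denM !scalerDr !scalerA; congr (_ *: _ + _); first by ring.
have -> : val u * (val s * val t') * val s = val s * val s * (val u * val t') by ring.
by rewrite -scalerA e scalerA; congr (_ *: _); ring.
Qed.

Lemma frac_eqI m s n t : val t *: m = val s *: n -> locfrac m s = locfrac n t.
Proof. by move=> e; apply/fracP; exists den1; rewrite -!scalerA e. Qed.

Lemma locDA : associative locD.
Proof.
move=> x y z; have [m [s ->]] := frac_ex x; have [n [t ->]] := frac_ex y.
have [p [u ->]] := frac_ex z; rewrite !locDE; apply: frac_eqI.
by rewrite !val_denM !scalerDr !scalerA addrA; congr (_ *: _ + _ *: _ + _ *: _); ring.
Qed.

Lemma locDC : commutative locD.
Proof.
move=> x y; have [m [s ->]] := frac_ex x; have [n [t ->]] := frac_ex y.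
by rewrite !locDE; apply: frac_eqI; rewrite !val_denM addrC [val t * val s]mulrC.
Qed.

Lemma loc0D : left_id loc0 locD.
Proof.
move=> x; have [m [s ->]] := frac_ex x; rewrite locDE; apply: frac_eqI.
by rewrite scaler0 add0r val_denM val_den1 mul1r scale1r.
Qed.

Lemma locND : left_inverse loc0 locN locD.
Proof.
move=> x; have [m [s ->]] := frac_ex x; rewrite locNE locDE; apply: frac_eqI.
by rewrite scalerN addNr !scaler0.
Qed.

HB.instance Definition _ := GRing.isZmodule.Build loc locDA locDC loc0D locND.

Lemma fracD m s n t :
  locfrac m s + locfrac n t = locfrac (val t *: m + val s *: n) (denM s t).
Proof. exact: locDE. Qed.

Lemma locZA a b (x : loc) : locZ a (locZ b x) = locZ (a * b) x.
Proof. by have [m [s ->]] := frac_ex x; rewrite !locZE scalerA. Qed.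

Lemma loc1Z : left_id 1 locZ.
Proof. by move=> x; have [m [s ->]] := frac_ex x; rewrite locZE scale1r. Qed.

Lemma locZDr : right_distributive locZ +%R.
Proof.
move=> a x y; have [m [s ->]] := frac_ex x; have [n [t ->]] := frac_ex y.
rewrite fracD !locZE fracD; congr locfrac.
by rewrite scalerDr !scalerA ![a * _]mulrC.
Qed.

Lemma locZDl x : {morph locZ^~ x : a b / a + b}.
Proof.
move=> a b; have [m [s ->]] := frac_ex x; rewrite !locZE fracD; apply: frac_eqI.
by rewrite -scalerDr -scalerDl scalerA.
Qed.

HB.instance Definition _ :=
  GRing.Zmodule_isLmodule.Build A loc locZA loc1Z locZDr locZDl.

Lemma fracZ a m s : a *: locfrac m s = locfrac (a *: m) s.
Proof. exact: locZE. Qed.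

(* m/s has degree d when s is homogeneous of degree e and m of degree d + e. *)
Definition loc_gr (grA : int -> set A) (gr : int -> set M) (d : int) : set loc :=
  [set y | exists e m s, [/\ grA e (val s), gr (d + e) m & y = locfrac m s]].

End Def.

Section Map.
Variables (M N : lmodType A) (f : {linear M -> N}).

Definition loc_map : loc M -> loc N := loc_lift (fun m s => locfrac (f m) s).

Lemma loc_mapE m s : loc_map (locfrac m s) = locfrac (f m) s.
Proof.
apply: (loc_liftE (f := fun m s => locfrac (f m) s)) => {}m {}s m' s'.
by move=> /fracP[u e]; apply/fracP; exists u; rewrite -!linearZ e.
Qed.

Lemma loc_map_is_linear : linear loc_map.
Proof.
move=> a x y; have [m [s ->]] := frac_ex x; have [n [t ->]] := frac_ex y.
by rewrite fracZ fracD !loc_mapE fracZ fracD (linearD f) !(linearZ_LR f).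
Qed.

HB.instance Definition _ :=
  GRing.isLinear.Build A (loc M) (loc N) _ loc_map loc_map_is_linear.

End Map.
End Localization.

Arguments locfrac {A D M} m s.
Arguments den1 {A D}.
Arguments loc_map {A} D {M N} f y : rename.

Section Kernel.
Variables (A : pzRingType) (M N : lmodType A) (f : {linear M -> N}).

Definition ker_pred : {pred M} := fun x => f x == 0.

Lemma ker_submod : submod_closed ker_pred.
Proof.
split=> [|a x y]; rewrite /ker_pred !unfold_in ?linear0// => /eqP hx /eqP hy.
by rewrite linearP hx hy scaler0 addr0.
Qed.

HB.instance Definition _ := GRing.isSubmodClosed.Build A M ker_pred ker_submod.

Record ker_mod := Kernel { kernel_val : M; _ : kernel_val \in ker_pred }.

HB.instance Definition _ := [isSub for kernel_val].
HB.instance Definition _ := [Choice of ker_mod by <:].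
HB.instance Definition _ := [SubChoice_isSubLmodule of ker_mod by <:].

End Kernel.

Section RootSystems.
Variables (R : realType) (V : vectType R).

(* [coroot a] is meaningful only for [a] in [roots]; it is then determined by
   the axioms, since the roots span. *)
Record root_system := RootSystem {
  roots :> seq V;
  coroot : V -> 'Hom(V, R^o);
  root_neq0 : 0 \notin roots;
  root_span : (<<roots>>)%VS = fullv;
  corootK : forall a, a \in roots -> coroot a a = 2%:R;
  root_refl : forall a b, a \in roots -> b \in roots ->
    b - coroot a b *: a \in roots;
  coroot_int : forall a b, a \in roots -> b \in roots ->
    coroot a b \is a Num.int }.

Definition irreducible_root_system (Phi : root_system) : Prop :=
  roots Phi <> [::] /\
  forall Q : {pred V},
    (exists2 a, a \in roots Phi & a \in Q) ->
    (exists2 a, a \in roots Phi & a \notin Q) ->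
    exists a b, [/\ a \in roots Phi, b \in roots Phi, a \in Q, b \notin Q
                  & coroot Phi a b != 0].

Record positive_system (Phi : root_system) := PositiveSystem {
  pos :> seq V;
  pos_root : forall a, a \in pos -> a \in roots Phi;
  pos_opp : forall a, a \in roots Phi -> (a \in pos) (+) (- a \in pos);
  pos_add : forall a b, a \in pos -> b \in pos -> a + b \in roots Phi ->
    a + b \in pos }.

Definition weight_lattice (Phi : root_system) : set V :=
  [set l | forall a, a \in roots Phi -> coroot Phi a l \is a Num.int].

Definition coweight_lattice (Phi : root_system) : set 'Hom(V, R^o) :=
  [set v | forall a, a \in roots Phi -> v a \is a Num.int].

Definition root_lattice (Phi : root_system) : set V :=
  [set l | inIntSpan (in_tuple (roots Phi)) l].

(* [omega] is a Z-basis of the coweight lattice.  This lattice has full rank in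
   the dual of V, so that independence over Z and over the reals agree. *)
Definition coweight_basis (Phi : root_system) n (omega : n.-tuple 'Hom(V, R^o)) :=
  free omega /\ coweight_lattice Phi = [set v | inIntSpan omega v].

Section Alcoves.
Variables (Phi : root_system) (P : positive_system Phi).
Implicit Types (a : V) (n : int).

(* V with its topology as a finite dimensional real vector space. *)
Definition top_space := initial_topology (v2r : V -> 'rV[R]_(dim V)).

Definition hyperplane a n : set V := [set mu | coroot Phi a mu = n%:~R].
Definition pos_half a n : set V := [set mu | n%:~R < coroot Phi a mu].
Definition neg_half a n : set V := [set mu | coroot Phi a mu < n%:~R].
Definition areflection a n (mu : V) : V := mu - (coroot Phi a mu - n%:~R) *: a.
Definition translation (l mu : V) : V := mu + l.

Definition regular_points : set V :=
  ~` [set mu | exists a n, a \in pos P /\ hyperplane a n mu].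

Definition is_alcove (A : set V) : Prop :=
  exists2 mu, regular_points mu &
    A = @connected_component top_space regular_points mu.

Record alcove := Alcove { alcove_set : set V; alcoveP : is_alcove alcove_set }.
Implicit Types (A B C : alcove).

(* The graphs of s_{a,n}, of t_l and (below) of the map a \uparrow on alcoves. *)
Definition reflects a n A B : Prop :=
  alcove_set B = areflection a n @` alcove_set A.
Definition translates (l : V) A B : Prop :=
  alcove_set B = translation l @` alcove_set A.

Definition bruhat_step A B : Prop := exists a n,
  [/\ a \in pos P, alcove_set A `<=` neg_half a n & reflects a n A B].
Definition bruhat : alcove -> alcove -> Prop := clos_refl_trans alcove bruhat_step.

Definition up a A B : Prop := exists n,
  alcove_set A `<=` neg_half a n `&` pos_half a (n - 1) /\ reflects a n A B.
Fixpoint up_iter a (m : nat) A B : Prop :=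
  if m is m'.+1 then exists2 C, up a A C & up_iter a m' C B else A = B.
Definition alpha_string a A : set alcove :=
  [set B | exists m, up_iter a m A B \/ up_iter a m B A].

(* The point pi(A) of the orbit space, as a subset of the set of alcoves. *)
Definition orbit_map A : set alcove :=
  [set B | exists2 l, root_lattice Phi l & translates l A B].

Definition special_section (l : V) : set alcove :=
  [set A | @closure top_space (alcove_set A) l].

Record opens := Opens {
  open_set : set alcove;
  open_lower : forall A B, open_set A -> bruhat B A -> open_set B }.

Lemma openI_subproof (U W : opens) A B :
  (open_set U `&` open_set W) A -> bruhat B A -> (open_set U `&` open_set W) B.
Proof. by move=> [UA WA] BA; split; apply: open_lower BA. Qed.
Definition openI U W := Opens (@openI_subproof U W).

Lemma lower_subproof (K : set alcove) A B :
  (exists2 C, K C & bruhat A C) -> bruhat B A -> exists2 C, K C & bruhat B C.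
Proof. by move=> [C KC leAC] BA; exists C => //; apply: rt_trans leAC. Qed.
Definition lower K := Opens (@lower_subproof K).

Lemma open_interior_subproof (X : set alcove) A B :
  (forall C, bruhat C A -> X C) -> bruhat B A -> forall C, bruhat C B -> X C.
Proof. by move=> XA BA C CB; apply: XA; apply: rt_trans BA. Qed.
Definition open_interior X := Opens (@open_interior_subproof X).

Lemma open_interior_sub X : open_set (open_interior X) `<=` X.
Proof. by move=> A; apply; apply: rt_refl. Qed.

Definition locally_closed (K : set alcove) : Prop :=
  exists U W : opens, K = open_set U `\` open_set W.

(* The open interior of K^- \ K, which is K^- \ K itself when K is locally
   closed: see [boundaryE]. *)
Definition boundary (K : set alcove) : opens :=
  open_interior (open_set (lower K) `\` K).

Lemma boundary_sub K : open_set (boundary K) `<=` open_set (lower K).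
Proof. by move=> A /open_interior_sub[]. Qed.

Lemma boundaryE K : locally_closed K ->
  open_set (boundary K) = open_set (lower K) `\` K.
Proof.
move=> [U [W KE]]; apply/seteqP; split; first exact: open_interior_sub.
move=> A [[C KC leAC] nKA] B BA; split; first by exists C => //; apply: rt_trans leAC.
move: KC nKA; rewrite KE => -[UC _] nKA -[_ nWB]; apply: nKA; split.
  exact: open_lower leAC.
by move=> WA; apply: nWB; apply: open_lower BA.
Qed.

End Alcoves.
End RootSystems.

Section StructureAlgebra.
Variables (R : realType) (V : vectType R) (Phi : root_system V).
Variable P : positive_system Phi.
Variables (n : nat) (omega : n.-tuple 'Hom(V, R^o)) (k : fieldType).

(* When [omega] is a basis of the coweight lattice, tensoring with k identifies
   this lattice with k^n, and the symmetric algebra with k[X_1, ..., X_n]. *)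
Definition coweight_k (v : 'Hom(V, R^o)) : 'rV[k]_n :=
  \row_i (Num.floor (coord omega i v))%:~R.

Definition symalg := {mpoly k[n]}.

Definition linear_form (u : 'rV[k]_n) : symalg := \sum_i u 0 i *: 'X_i.

Definition coroot_k (a : V) : symalg := linear_form (coweight_k (coroot Phi a)).

(* Linear forms have degree 2. *)
Definition symalg_gr (d : int) : set symalg :=
  [set f | f = 0 \/ exists2 e : nat, d = (2 * e)%N & f \is e.-homog].

Definition gkm : Prop := forall a b, a \in pos P -> b \in pos P -> a <> b ->
  forall c : k, coweight_k (coroot Phi a) <> c *: coweight_k (coroot Phi b).

Section Tuples.
Variable X : set (alcove P).

Definition tuple_cond (z : X -> symalg) : Prop :=
  (forall (A B : X) a m, a \in pos P -> reflects a m (val A) (val B) ->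
     exists q, z A - z B = coroot_k a * q) /\
  (forall (A B : X) l, root_lattice Phi l -> translates l (val A) (val B) ->
     z A = z B).

Definition tuple_pred : {pred X -> symalg} := fun z => `[< tuple_cond z >].

Lemma tuple_subring : subring_closed tuple_pred.
Proof.
split=> [|z w /asboolP[z1 z2] /asboolP[w1 w2]|z w /asboolP[z1 z2] /asboolP[w1 w2]];
  apply/asboolP; split.
- by move=> A B a m aP AB; exists 0; rewrite mulr0; exact: subrr.
- by [].
- move=> A B a m aP AB; have [p ep] := z1 _ _ _ _ aP AB.
  have [q eq] := w1 _ _ _ _ aP AB; exists (p - q).
  rewrite mulrBr -ep -eq (_ : (z - w) A = z A - w A)//.
  by rewrite (_ : (z - w) B = z B - w B)//; ring.
- by move=> A B l hl AB; congr (_ - _); [apply: z2 AB|apply: w2 AB].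
- move=> A B a m aP AB; have [p ep] := z1 _ _ _ _ aP AB.
  have [q eq] := w1 _ _ _ _ aP AB; exists (p * w A + z B * q).
  have -> : coroot_k a * (p * w A + z B * q)
    = coroot_k a * p * w A + z B * (coroot_k a * q) by ring.
  rewrite -ep -eq.
  rewrite (_ : (z * w) A = z A * w A)// (_ : (z * w) B = z B * w B)//.
  by ring.
- by move=> A B l hl AB; congr (_ * _); [apply: z2 AB|apply: w2 AB].
Qed.

HB.instance Definition _ :=
  GRing.isSubringClosed.Build (X -> symalg) tuple_pred tuple_subring.

Record structure_alg := StructureAlg {
  tuple_fun : X -> symalg; _ : tuple_fun \in tuple_pred }.

HB.instance Definition _ := [isSub for tuple_fun].
HB.instance Definition _ := [Choice of structure_alg by <:].
HB.instance Definition _ :=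
  GRing.SubChoice_isSubComPzRing.Build _ _ structure_alg (subringClosedP _).

Lemma tuple_funP (z : structure_alg) : tuple_cond (tuple_fun z).
Proof. by apply/asboolP; case: z. Qed.

Definition structure_alg_gr (d : int) : set structure_alg :=
  [set z | forall A, symalg_gr d (tuple_fun z A)].

End Tuples.

Section Projection.
Variables (X Y : set (alcove P)) (YX : Y `<=` X).

Definition widen (A : Y) : X := exist _ (val A) (mem_set (YX (set_mem (valP A)))).

Lemma projection_subproof (z : structure_alg X) :
  (fun A => tuple_fun z (widen A)) \in @tuple_pred Y.
Proof.
have [z1 z2] := tuple_funP z; apply/asboolP; split=> [A B a m aP AB|A B l hl AB].
  exact: (z1 (widen A) (widen B) _ _ aP AB).
exact: (z2 (widen A) (widen B) _ hl AB).
Qed.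

Definition projection z : structure_alg Y := StructureAlg (projection_subproof z).

Lemma projection_is_zmod_morphism : zmod_morphism projection.
Proof. by move=> z w; apply: val_inj. Qed.

Lemma projection_is_monoid_morphism : monoid_morphism projection.
Proof. by split=> [|z w]; apply: val_inj. Qed.

HB.instance Definition _ := GRing.isZmodMorphism.Build
  (structure_alg X) (structure_alg Y) projection projection_is_zmod_morphism.
HB.instance Definition _ := GRing.isMonoidMorphism.Build
  (structure_alg X) (structure_alg Y) projection projection_is_monoid_morphism.

End Projection.

Definition Zalg := structure_alg setT.
HB.instance Definition _ := GRing.ComPzRing.on Zalg.

Definition Zalg_gr : int -> set Zalg := @structure_alg_gr setT.

Section Action.
Variable X : set (alcove P).

Definition Zscale (z : Zalg) (w : structure_alg X) : structure_alg X :=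
  projection (@subsetT _ X) z * w.

Lemma ZscaleA z1 z2 w : Zscale z1 (Zscale z2 w) = Zscale (z1 * z2) w.
Proof. by rewrite /Zscale mulrA rmorphM. Qed.
Lemma Zscale1 : left_id 1 Zscale.
Proof. by move=> w; rewrite /Zscale rmorph1 mul1r. Qed.
Lemma ZscaleDr : right_distributive Zscale +%R.
Proof. by move=> z w1 w2; rewrite /Zscale mulrDr. Qed.
Lemma ZscaleDl w : {morph Zscale^~ w : z1 z2 / z1 + z2}.
Proof. by move=> z1 z2; rewrite /Zscale rmorphD mulrDl. Qed.

HB.instance Definition _ := GRing.Zmodule_isLmodule.Build Zalg (structure_alg X)
  ZscaleA Zscale1 ZscaleDr ZscaleDl.

End Action.

Section ProjectionLinear.
Variables (X Y : set (alcove P)) (YX : Y `<=` X).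

Lemma projection_is_scalable : scalable (projection YX).
Proof.
move=> z w; apply: val_inj; apply: funext => A /=; congr (tuple_fun z _ * _).
exact: val_inj.
Qed.

HB.instance Definition _ := GRing.isScalable.Build
  Zalg (structure_alg X) (structure_alg Y) _ (projection YX) projection_is_scalable.

End ProjectionLinear.

Definition coordinate (z : Zalg) (A : alcove P) : symalg :=
  tuple_fun z (exist _ A (mem_set I)).

Lemma scalar_subproof (f : symalg) : (fun=> f) \in @tuple_pred setT.
Proof. by apply/asboolP; split=> // *; exists 0; rewrite mulr0 subrr. Qed.
Definition Zscalar (f : symalg) : Zalg := StructureAlg (scalar_subproof f).

Definition coroot_products (Q : pred V) : set Zalg :=
  [set z | exists2 l : seq V, (forall a, a \in l -> a \in pos P /\ Q a) &
             z = Zscalar (\prod_(a <- l) coroot_k a)].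

Lemma coroot_products1 Q : coroot_products Q 1.
Proof. by exists [::] => //; rewrite big_nil; apply: val_inj. Qed.

Lemma coroot_productsM Q s t :
  coroot_products Q s -> coroot_products Q t -> coroot_products Q (s * t).
Proof.
move=> [l hl ->] [l' hl' ->]; exists (l ++ l').
  by move=> a; rewrite mem_cat => /orP[/hl|/hl'].
by rewrite big_cat; apply: val_inj.
Qed.

Definition coroot_mset Q := MultSet (@coroot_products1 Q) (@coroot_productsM Q).

Definition loc_all : lmodType Zalg -> lmodType Zalg := loc (coroot_mset predT).
Definition loc_but (a : V) : lmodType Zalg -> lmodType Zalg :=
  loc (coroot_mset (predC1 a)).

Section Modules.
Variable M : lmodType Zalg.

Definition torsion_free : Prop := forall (f : symalg) (m : M),
  f <> 0 -> Zscalar f *: m = 0 -> m = 0.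

(* The elements m/s of M^\emptyset with s invertible in S^a. *)
Definition in_loc_but (a : V) : set (loc_all M) :=
  [set y | exists m s, coroot_products (predC1 a) (val s) /\ y = locfrac m s].

Definition Zmod_f : Prop := torsion_free /\
  forall y : loc_all M,
    (forall a, a \in pos P -> in_loc_but a y) -> exists m, y = locfrac m den1.

(* M^{\emptyset,x} = e_x M^\emptyset, where e_x = z/s is the element of
   Z^\emptyset with coordinate 1 at x and 0 elsewhere; s acts bijectively on
   M^\emptyset, and y = (z/s) y' is written s y = z y'. *)
Definition loc_component (x : set (alcove P)) : set (loc_all M) :=
  [set y | exists (z s : Zalg) (y' : loc_all M),
    [/\ coroot_products predT s,
        forall A, coordinate z A = if `[< orbit_map A = x >] then coordinate s A else 0
      & s *: y = z *: y']].

Definition supp_Z : set (set (alcove P)) :=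
  [set x | (exists A, x = orbit_map A) /\ exists2 y, loc_component x y & y <> 0].

End Modules.

(* Presheaves of Z-modules, whose sections carry families of subsets [gr];
   that these are gradings is part of [graded] below. *)
Record presheaf := Presheaf {
  sec : opens P -> lmodType Zalg;
  gr : forall U, int -> set (sec U);
  res : forall U W, open_set W `<=` open_set U -> {linear sec U -> sec W};
  res_gr : forall U W (h : open_set W `<=` open_set U) d x,
    gr d x -> gr d (res h x);
  res_id : forall U (h : open_set U `<=` open_set U) x, res h x = x;
  res_comp : forall U W T (h : open_set W `<=` open_set U)
    (h' : open_set T `<=` open_set W) (h'' : open_set T `<=` open_set U) x,
    res h' (res h x) = res h'' x }.

Arguments res p {U W} h.
Arguments gr {p U} d.

Record presheaf_hom (M N : presheaf) := Hom {
  hom_fun : forall U, {linear sec M U -> sec N U};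
  hom_gr : forall U d x, gr d x -> gr d (hom_fun U x);
  hom_res : forall U W (h : open_set W `<=` open_set U) x,
    hom_fun W (res M h x) = res N h (hom_fun U x) }.

Definition graded (M : presheaf) : Prop :=
  forall U, is_grading Zalg_gr (@gr M U).

(* Gluing is stated for homogeneous sections: this is the sheaf condition in
   the category of graded modules, whose products are formed degreewise. *)
Definition is_sheaf (M : presheaf) : Prop :=
  forall (I : Type) (U : I -> opens P) (W : opens P)
    (UW : forall i, open_set (U i) `<=` open_set W),
    open_set W `<=` \bigcup_i open_set (U i) ->
  forall (d : int) (s : forall i, sec M (U i)), (forall i, gr d (s i)) ->
    (forall i j, res M (W := openI (U i) (U j)) (@subIsetl _ _ _) (s i) =
                 res M (W := openI (U i) (U j)) (@subIsetr _ _ _) (s j)) ->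
  exists! t : sec M W, gr d t /\ forall i, res M (UW i) t = s i.

Definition graded_sheaf (M : presheaf) : Prop := graded M /\ is_sheaf M.

Definition flabby (M : presheaf) : Prop :=
  forall U W (h : open_set W `<=` open_set U) (y : sec M W),
    exists x, res M h x = y.

Definition sec_at (M : presheaf) (K : set (alcove P)) : lmodType Zalg :=
  ker_mod (res M (@boundary_sub _ _ _ P K)).

Definition bruhat_supp (M : presheaf) : set (alcove P) :=
  [set A | exists x : sec_at M [set A], x <> 0].

Definition finitely_supported (M : presheaf) : Prop :=
  finite_set (bruhat_supp M) /\
  exists2 F : set (alcove P), finite_set F &
    [set C | exists x : sec M (lower [set C]), x <> 0] `<=`
    [set C | exists2 A, F A & bruhat A C].

Definition support_condition (M : presheaf) : Prop :=
  forall K, locally_closed K -> supp_Z (sec_at M K) `<=` (@orbit_map _ _ _ P) @` K.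

Section LocalizedPresheaf.
Variables (a : V) (M : presheaf).

Definition locp_sec (U : opens P) : lmodType Zalg := loc_but a (sec M U).
Definition locp_gr U (d : int) : set (locp_sec U) :=
  loc_gr Zalg_gr (@gr M U) d.
Definition locp_res U W (h : open_set W `<=` open_set U) :
  {linear locp_sec U -> locp_sec W} := loc_map (coroot_mset (predC1 a)) (res M h).

Lemma locp_res_gr U W (h : open_set W `<=` open_set U) d x :
  locp_gr d x -> locp_gr d (locp_res h x).
Proof.
move=> [e [m [s [hs hm ->]]]]; exists e, (res M h m), s; split=> //.
  exact: res_gr.
exact: loc_mapE.
Qed.

Lemma locp_res_id U (h : open_set U `<=` open_set U) x : locp_res h x = x.
Proof.
by have [m [s ->]] := frac_ex x; rewrite [LHS]loc_mapE res_id.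
Qed.

Lemma locp_res_comp U W T (h : open_set W `<=` open_set U)
    (h' : open_set T `<=` open_set W) (h'' : open_set T `<=` open_set U) x :
  locp_res h' (locp_res h x) = locp_res h'' x.
Proof.
have [m [s ->]] := frac_ex x; rewrite [in LHS]/locp_res /= !loc_mapE.
by congr locfrac; apply: res_comp.
Qed.

Definition loc_presheaf := Presheaf locp_res_gr locp_res_id locp_res_comp.

End LocalizedPresheaf.

Definition is_direct_sum (I : finType) (N : I -> presheaf) (M : presheaf)
    (iota : forall i, presheaf_hom (N i) M) : Prop :=
  forall U (y : sec M U), exists! x : forall i, sec (N i) U,
    y = \sum_i hom_fun (iota i) U (x i).

Definition local_extension_condition (M : presheaf) : Prop :=
  forall a, a \in pos P ->
  exists (r : nat) (N : 'I_r -> presheaf) (iota : forall i, presheaf_hom (N i) (loc_presheaf a M)),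
    (forall i, graded_sheaf (N i) /\ exists A, bruhat_supp (N i) `<=` alpha_string a A) /\
    is_direct_sum iota.

Definition in_C (M : presheaf) : Prop :=
  [/\ graded_sheaf M,
      forall U, Zmod_f (sec M U),
      flabby M /\ finitely_supported M,
      support_condition M
    & local_extension_condition M].

(* 0 -> L -> M -> N -> 0 is exact as a sequence of sheaves: images are taken in
   the category of sheaves, i.e. locally. *)
Definition locally_in_image (M N : presheaf) (g : presheaf_hom M N) U (y : sec N U) : Prop :=
  forall A, open_set U A -> exists (W : opens P) (h : open_set W `<=` open_set U),
    open_set W A /\ exists x, hom_fun g W x = res N h y.

Definition short_exact (L M N : presheaf) (f : presheaf_hom L M) (g : presheaf_hom M N) : Prop :=
  [/\ forall U x, hom_fun f U x = 0 -> x = 0,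
      forall U x, hom_fun g U x = 0 <-> locally_in_image f x
    & forall U y, @locally_in_image M N g U y].

Definition projective_in_C (K : presheaf) : Prop :=
  in_C K /\
  forall (L M N : presheaf) (f : presheaf_hom L M) (g : presheaf_hom M N),
    in_C L -> in_C M -> in_C N -> short_exact f g ->
  forall h : presheaf_hom K N, exists h' : presheaf_hom K M,
    forall U x, hom_fun g U (hom_fun h' U x) = hom_fun h U x.

Section SpecialSectionSheaf.
Variable l : V.

Definition special_sec (U : opens P) : lmodType Zalg :=
  structure_alg (special_section l `&` open_set U).
Definition special_gr U (d : int) : set (special_sec U) := @structure_alg_gr _ d.
Definition special_res U W (h : open_set W `<=` open_set U) :
  {linear special_sec U -> special_sec W} := projection (setIS (C := special_section l) h).

Lemma special_res_gr U W (h : open_set W `<=` open_set U) d x :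
  special_gr d x -> special_gr d (special_res h x).
Proof. by move=> hx A; apply: hx. Qed.

Lemma special_res_id U (h : open_set U `<=` open_set U) x : special_res h x = x.
Proof.
apply: val_inj; apply: funext => A /=; congr (tuple_fun x _); exact: val_inj.
Qed.

Lemma special_res_comp U W T (h : open_set W `<=` open_set U)
    (h' : open_set T `<=` open_set W) (h'' : open_set T `<=` open_set U) x :
  special_res h' (special_res h x) = special_res h'' x.
Proof.
apply: val_inj; apply: funext => A /=; congr (tuple_fun x _); exact: val_inj.
Qed.

Definition special_section_sheaf :=
  Presheaf special_res_gr special_res_id special_res_comp.

End SpecialSectionSheaf.
End StructureAlgebra.

(* Main.v *)
(* Let K be the special section sheaf at lambda.  The finite Weyl group W acts
   simply transitively on the alcoves with lambda in their closure, so that the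
   sections of K are structure algebras of subsets of the moment graph of W.
   Starting from the class of a point, divided differences produce a family of
   Schubert classes that is triangular for the length; expanding in it extends
   every section of K over an open set, so K is flabby.

   A tuple on the special section extends to an element of Z by periodicity, so
   each K(U) is generated over Z by 1.  If A' <= B with A' in the special section,
   then B = A + g with A in the special section, g a sum of positive roots and
   A <= B: a weight of lambda + ZR in the closure of B is unique (nonzero
   minuscule weights are not in ZR) and moves up along the chain.  Hence, for M in
   C and a global section m of M vanishing on the largest open set away that
   misses the special section, the support condition puts the support of m|U in
   pi(U \ away) = pi(U n K_lambda), and z |-> z m|U is a homomorphism K -> M.  So
   homomorphisms K -> M are such sections m of degree 0, and these lift along an
   epimorphism because its kernel is flabby (Zorn's lemma, starting from the zero
   lift on away). *)

From HB Require Import structures.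
From mathcomp Require Import mpoly.
From mathcomp Require Import all_boot all_order all_algebra ring lra zify.
From mathcomp Require Import boolp classical_sets cardinality reals.
From mathcomp Require Import topology_structure matrix_topology num_topology.
From mathcomp Require Import initial_topology connected subspace_topology pseudometric_structure.
From mathcomp Require normed_module.
From Stdlib Require Import Relation_Operators Operators_Properties.
Require Import Defs.

Set Implicit Arguments.
Unset Strict Implicit.
Unset Printing Implicit Defensive.

Import numFieldTopology.Exports.
Import Order.TTheory GRing.Theory Num.Theory VectorInternalTheory.
Local Open Scope classical_set_scope.
Local Open Scope ring_scope.

(** * Roots and reflections *)

Section Reflections.
Variables (R : realType) (V : vectType R) (Phi : root_system V).
Implicit Types (a b c x y : V).

(** Flabbiness is one of several conditions on K. For the local extension condition at a root a, the
    special section splits into pairs exchanged by the reflection in the hyperplane of a through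
    lambda. A tuple on one pair, multiplied by the product of the other positive coroots and
    extended by zero, satisfies every congruence; where these coroots are invertible, dividing by
    the product again makes the pair a direct summand. [gkm] makes the positive coroots pairwise
    coprime, which lets divisibility by several of them combine and gives S as the intersection of
    the S^a; it also forces the root system to be reduced. Characteristic different from 2 keeps the
    coroots nonzero in S. The delicate point of the lifting is that z m|U must not depend on the
    element of Z chosen to extend z. Vanishing of m on [away] ensures this: without it the support
    of m|U could contain any orbit meeting U, even that of a special alcove outside U, where the
    extension of z is arbitrary. The sheaf axiom glues homogeneous families only, so lifts, kernels
    and separation are treated through homogeneous components. *)

Definition cpair a x : R := coroot Phi a x.

Lemma pairD a x y : cpair a (x + y) = cpair a x + cpair a y.
Proof. by rewrite /cpair linearD. Qed.
Lemma pairB a x y : cpair a (x - y) = cpair a x - cpair a y.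
Proof. by rewrite /cpair linearB. Qed.
Lemma pairN a x : cpair a (- x) = - cpair a x.
Proof. by rewrite /cpair linearN. Qed.
Lemma pairZ a t x : cpair a (t *: x) = t * cpair a x.
Proof. by rewrite /cpair linearZ. Qed.
Lemma pair_sum a I (r : seq I) (F : I -> V) :
  cpair a (\sum_(i <- r) F i) = \sum_(i <- r) cpair a (F i).
Proof. by rewrite /cpair linear_sum. Qed.

Definition refl_fun a x : V := x - cpair a x *: a.

Lemma refl_fun_linear a : linear (refl_fun a).
Proof.
by move=> t x y; rewrite /refl_fun pairD pairZ scalerDl scalerBr scalerA opprD addrACA.
Qed.
HB.instance Definition _ a :=
  GRing.isLinear.Build R V V _ (refl_fun a) (refl_fun_linear a).

Definition srefl a : 'End(V) := linfun (refl_fun a).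

Lemma reflE a x : srefl a x = x - cpair a x *: a.
Proof. exact: lfunE. Qed.

Lemma pairK a : a \in roots Phi -> cpair a a = 2.
Proof. exact: corootK. Qed.

Lemma refl_root a b : a \in roots Phi -> b \in roots Phi -> srefl a b \in roots Phi.
Proof. by move=> aR bR; rewrite reflE; apply: root_refl. Qed.

Lemma refl_self a : a \in roots Phi -> srefl a a = - a.
Proof. by move=> aR; rewrite reflE pairK// scaler_nat mulr2n opprD addrA subrr sub0r. Qed.

Lemma reflK a : a \in roots Phi -> involutive (srefl a).
Proof.
move=> aR x; rewrite [in RHS](_ : x = x - cpair a x *: a + cpair a x *: a); last by rewrite subrK.
by rewrite [X in srefl a X]reflE linearB linearZ /= refl_self// scalerN opprK reflE.
Qed.

Lemma oppr_root a : a \in roots Phi -> - a \in roots Phi.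
Proof. by move=> aR; rewrite -refl_self// refl_root. Qed.

Lemma root_n0 a : a \in roots Phi -> a != 0.
Proof. by apply: contraTneq => ->; apply: root_neq0. Qed.

Lemma pair_int a b : a \in roots Phi -> b \in roots Phi -> cpair a b \is a Num.int.
Proof. exact: coroot_int. Qed.

(* The sum over the roots of f(b) b, for f in the dual: the map V* -> V
   defined by the form (f, g) = sum f(b) g(b), which is invariant under every
   reflection preserving the roots. *)
Definition dual_sum (f : V -> R) : V := \sum_(b <- undup (roots Phi)) f b *: b.

Lemma eq_on_roots (f g : 'Hom(V, R^o)) :
  (forall b, b \in roots Phi -> f b = g b) -> f = g.
Proof.
move=> fg; apply/lfunP => x.
have : x \in <<roots Phi>>%VS by rewrite root_span memvf.
move=> /(@coord_span _ _ _ (in_tuple (roots Phi))) ->; rewrite !linear_sum /=.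
by apply: eq_bigr => i _; rewrite !linearZ /= fg// mem_nth.
Qed.

Lemma dual_sum_inj (f g : 'Hom(V, R^o)) : dual_sum f = dual_sum g -> f = g.
Proof.
move=> e; apply: eq_on_roots => b bR.
have h : \sum_(b <- undup (roots Phi)) ((f - g) b) ^+ 2 = 0 :> R.
  transitivity ((f - g) (dual_sum (f - g)) : R).
    rewrite /dual_sum linear_sum /=; apply: eq_bigr => c _.
    by rewrite linearZ /= expr2.
  suff -> : dual_sum (f - g) = 0 by rewrite linear0.
  have -> : dual_sum (f - g) = dual_sum f - dual_sum g; last by rewrite e subrr.
  rewrite /dual_sum -sumrB; apply: eq_bigr => c _.
  by rewrite -scalerBl !lfun_simp.
move/eqP: h; rewrite psumr_eq0; last by move=> *; apply: sqr_ge0.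
move/allP/(_ b); rewrite mem_undup => /(_ bR) /=.
by rewrite sqrf_eq0 !lfun_simp subr_eq0 => /eqP.
Qed.

Lemma dual_sum_surj x : exists f : 'Hom(V, R^o), x = dual_sum f.
Proof.
pose D (f : 'Hom(V, R^o)) := dual_sum f.
have Dlin : linear D.
  move=> t f g; rewrite /D /dual_sum scaler_sumr -big_split /=; apply: eq_bigr => c _.
  by rewrite scalerA -scalerDl !lfun_simp.
pose Dl := linfun (HB.pack D (GRing.isLinear.Build R 'Hom(V, R^o) V _ D Dlin) : {linear _ -> _}).
have De f : Dl f = D f by rewrite lfunE.
have : (limg Dl = fullv)%VS.
  apply/eqP; rewrite eqEdim subvf /= limg_dim_eq ?dimvf//.
    by rewrite /dim /= muln1.
  apply/eqP; rewrite capfv -subv0; apply/subvP => f.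
  rewrite memv_ker memv0 De => /eqP D0; apply/eqP; apply: dual_sum_inj.
  rewrite -/(D f) D0 /dual_sum big1// => b _; by rewrite lfunE scale0r.
by move=> e; have := memvf x; rewrite -e => /memv_imgP[f _ ->]; exists f; rewrite De.
Qed.

Lemma perm_map_stable (T : eqType) (r : seq T) (g : T -> T) :
  uniq r -> {in r &, injective g} -> (forall b : T, b \in r -> g b \in r) ->
  perm_eq (map g r) r.
Proof.
move=> ur gI gr.
have um : uniq (map g r) by rewrite map_inj_in_uniq.
apply: uniq_perm => //; suff [_ e] : size (map g r) = size r /\ map g r =i r by [].
have sr : {subset map g r <= r} by move=> _ /mapP[b br ->]; apply: gr.
by have [|? ?] := uniq_min_size um sr; rewrite ?size_map.
Qed.

Lemma dualZ (f : 'Hom(V, R^o)) t x : f (t *: x) = t * (f x : R) :> R.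
Proof. by rewrite linearZ. Qed.
Lemma dualB (f : 'Hom(V, R^o)) x y : f (x - y) = (f x : R) - (f y : R) :> R.
Proof. by rewrite linearB. Qed.

(** With r x = x - f(x) a, the sum of g(b) r(b) over the roots is computed twice: by expanding r(b),
    and by reindexing along r, which permutes the roots. *)
Lemma reflection_dual_sum a (f g : 'Hom(V, R^o)) : f a = 2%:R ->
  (forall b, b \in roots Phi -> b - f b *: a \in roots Phi) ->
  f (dual_sum g) *: a = g a *: dual_sum f.
Proof.
move=> fa fR; pose r b := b - (f b : R) *: a.
have rK : involutive r.
  move=> b; rewrite /r dualB dualZ (fa : (f a : R) = 2).
  by rewrite mulr_natr mulr2n opprD addrA subrr sub0r scaleNr opprK subrK.
have e1 : \sum_(b <- undup (roots Phi)) (g b : R) *: r b = dual_sum g - (f (dual_sum g) : R) *: a.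
  rewrite /dual_sum linear_sum /= scaler_suml -sumrB; apply: eq_bigr => b _.
  by rewrite scalerBr scalerA dualZ.
have e2 : \sum_(b <- undup (roots Phi)) (g b : R) *: r b = dual_sum g - (g a : R) *: dual_sum f.
  have pe : perm_eq (map r (undup (roots Phi))) (undup (roots Phi)).
    apply: perm_map_stable (undup_uniq _) _ _ => [b c _ _|b]; first exact: (can_inj rK).
    by rewrite !mem_undup => /fR.
  rewrite -(perm_big _ pe) big_map /dual_sum scaler_sumr -sumrB; apply: eq_bigr => b _.
  by rewrite rK /r dualB dualZ scalerBl scalerA mulrC.
by move: e1; rewrite e2 => /addrI/oppr_inj.
Qed.

(** By [reflection_dual_sum] with g = a^v, the dual sums of f and of a^v are both multiples of [a];
    applying [f] to the second identity shows that the factors agree. *)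
Lemma coroot_uniq a (f : 'Hom(V, R^o)) : a \in roots Phi -> f a = 2%:R ->
  (forall b, b \in roots Phi -> b - f b *: a \in roots Phi) -> f = coroot Phi a.
Proof.
move=> aR fa fR; apply: dual_sum_inj.
have cR b : b \in roots Phi -> b - coroot Phi a b *: a \in roots Phi by exact: root_refl.
have ca : coroot Phi a a = 2%:R by apply: corootK.
have n2 : (2%:R : R) != 0 by rewrite pnatr_eq0.
have e1 := reflection_dual_sum (coroot Phi a) fa fR.
have e2 := reflection_dual_sum (coroot Phi a) ca cR.
rewrite ca in e1 e2; apply: (scalerI n2); rewrite -e1 -e2; congr (_ *: _).
have : f (2%:R *: dual_sum (coroot Phi a)) = f ((coroot Phi a (dual_sum (coroot Phi a)) : R) *: a).
  by rewrite -e2.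
by rewrite !linearZ /= fa [RHS]mulrC => /(mulfI n2).
Qed.

(** The composite of a^v with s_b has the properties that determine the coroot of s_b a. *)
Lemma pair_refl b a x : a \in roots Phi -> b \in roots Phi ->
  cpair (srefl b a) (srefl b x) = cpair a x.
Proof.
move=> aR bR.
suff e : (coroot Phi a \o srefl b)%VF = coroot Phi (srefl b a).
  by rewrite /cpair -e lfunE /= reflK.
apply: coroot_uniq; first exact: refl_root.
  by rewrite lfunE /= reflK// corootK.
move=> c cR; rewrite lfunE /=.
have -> : c - coroot Phi a (srefl b c) *: srefl b a = srefl b (srefl a (srefl b c)).
  by rewrite (reflE a) (linearB (srefl b)) (linearZ_LR (srefl b)) /= reflK.
by do 3![apply: refl_root => //].
Qed.

Lemma pairNl a x : a \in roots Phi -> cpair (- a) x = - cpair a x.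
Proof.
move=> aR; rewrite -{1}refl_self// -[x in LHS](reflK aR) pair_refl// reflE.
by rewrite pairB pairZ pairK//; ring.
Qed.

(** The canonical W-invariant form, invariant because reflections permute the coroots. [undup] is
    there because [roots] may list a root twice. *)
Definition rform x y : R := \sum_(a <- undup (roots Phi)) cpair a x * cpair a y.

Lemma formC x y : rform x y = rform y x.
Proof. by apply: eq_bigr => a _; rewrite mulrC. Qed.
Lemma formDr x y z : rform x (y + z) = rform x y + rform x z.
Proof. by rewrite -big_split /=; apply: eq_bigr => a _; rewrite pairD mulrDr. Qed.
Lemma formZr x t y : rform x (t *: y) = t * rform x y.
Proof. by rewrite mulr_sumr; apply: eq_bigr => a _; rewrite pairZ mulrCA. Qed.
Lemma formNr x y : rform x (- y) = - rform x y.
Proof. by rewrite -scaleN1r formZr mulN1r. Qed.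
Lemma formBr x y z : rform x (y - z) = rform x y - rform x z.
Proof. by rewrite formDr formNr. Qed.
Lemma form0r x : rform x 0 = 0.
Proof. by rewrite -(scale0r 0) formZr mul0r. Qed.
Lemma form_sumr x I (r : seq I) (F : I -> V) :
  rform x (\sum_(i <- r) F i) = \sum_(i <- r) rform x (F i).
Proof. by elim/big_ind2: _ => [|u s v t <- <-|//]; rewrite ?form0r ?formDr. Qed.
Lemma formDl x y z : rform (y + z) x = rform y x + rform z x.
Proof. by rewrite formC formDr !(formC x). Qed.
Lemma formZl x t y : rform (t *: y) x = t * rform y x.
Proof. by rewrite formC formZr formC. Qed.

Lemma form_ge0 x : 0 <= rform x x.
Proof. by apply: sumr_ge0 => a _; rewrite -expr2 sqr_ge0. Qed.

(** Write x = [dual_sum f]. Then [reflection_dual_sum] gives f(a) [dual_sum] (a^v) = 0 for each root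
    a, and a^v is nonzero, so f vanishes on the roots. *)
Lemma pair_eq0 x : (forall a, a \in roots Phi -> cpair a x = 0) -> x = 0.
Proof.
move=> x0; have [f xf] := dual_sum_surj x.
suff f0 : f = 0 by rewrite xf f0 /dual_sum big1// => b _; rewrite lfunE scale0r.
apply: eq_on_roots => a aR; rewrite lfunE /=.
have cR b : b \in roots Phi -> b - coroot Phi a b *: a \in roots Phi by exact: root_refl.
have := reflection_dual_sum f (corootK aR) cR.
rewrite -xf (_ : coroot Phi a x = 0) ?scale0r; last exact: x0.
move=> /esym/eqP; rewrite scaler_eq0 => /orP[/eqP//|/eqP d0].
have : dual_sum (coroot Phi a) = dual_sum (0 : 'Hom(V, R^o)).
  by rewrite d0 /dual_sum big1// => b _; rewrite lfunE scale0r.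
move=> /dual_sum_inj c0; have := pairK aR.
by rewrite /cpair c0 lfunE /= => /eqP; rewrite eq_sym pnatr_eq0.
Qed.

Lemma form_eq0 x : rform x x = 0 -> x = 0.
Proof.
move=> /eqP; rewrite psumr_eq0; last by move=> a _; rewrite -expr2 sqr_ge0.
move=> /allP h; apply: pair_eq0 => a aR; have := h a.
by rewrite mem_undup => /(_ aR) /=; rewrite mulf_eq0 orbb => /eqP.
Qed.

Lemma form_gt0 x : x != 0 -> 0 < rform x x.
Proof. by move=> x0; rewrite lt_def form_ge0 andbT; apply: contra x0 => /eqP/form_eq0->. Qed.

Lemma form_refl b x y : b \in roots Phi -> rform (srefl b x) (srefl b y) = rform x y.
Proof.
move=> bR; rewrite /rform.
have pe : perm_eq (map (srefl b) (undup (roots Phi))) (undup (roots Phi)).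
  apply: perm_map_stable (undup_uniq _) _ _ => [u v _ _|u]; first exact: (can_inj (reflK bR)).
  by rewrite !mem_undup; apply: refl_root.
rewrite -(perm_big _ pe) big_map big_seq [RHS]big_seq; apply: eq_bigr => a.
by rewrite mem_undup => aR; rewrite !pair_refl.
Qed.

Lemma form_root b y : b \in roots Phi -> 2 * rform b y = rform b b * cpair b y.
Proof.
move=> bR; have := form_refl b y bR; rewrite refl_self// reflE formC formNr formC.
by rewrite formBr formZr; lra.
Qed.

Lemma form_root_gt0 b : b \in roots Phi -> 0 < rform b b.
Proof. by move=> bR; rewrite form_gt0// root_n0. Qed.

Lemma pair_gt0 b y : b \in roots Phi -> (0 < cpair b y) = (0 < rform b y).
Proof.
move=> bR; have := form_root y bR; have h := form_root_gt0 bR.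
by move=> e; rewrite -(pmulr_rgt0 _ h) -e pmulr_rgt0.
Qed.

Lemma pair_lt0 b y : b \in roots Phi -> (cpair b y < 0) = (rform b y < 0).
Proof. by move=> bR; rewrite -oppr_gt0 -pairN pair_gt0// formNr oppr_gt0. Qed.

(** If one of the two Cartan integers is -1, the sum is a reflection of a or b. Otherwise both are
    at most -2, which forces (a + b, a + b) <= 0. *)
Lemma root_sum a b : a \in roots Phi -> b \in roots Phi -> cpair b a < 0 -> a + b != 0 ->
  a + b \in roots Phi.
Proof.
move=> aR bR ab0 abN0.
have ba0 : cpair a b < 0 by rewrite pair_lt0// formC -pair_lt0.
have int_lt (x : R) : x \is a Num.int -> x < 0 -> x != -1 -> x <= -2.
  move=> /intrP[m ->]; rewrite (ltrz0 R) -(rmorphN1 (intmul 1)) eqr_int -[-2]/(-(2%:~R)) -rmorphN ler_int.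
  by move=> *; lia.
have [e|n1] := eqVneq (cpair b a) (-1).
  by have := refl_root bR aR; rewrite reflE e scaleN1r opprK.
have [e|n1'] := eqVneq (cpair a b) (-1).
  by have := refl_root aR bR; rewrite reflE e scaleN1r opprK addrC.
have h1 := int_lt _ (pair_int bR aR) ab0 n1.
have h2 := int_lt _ (pair_int aR bR) ba0 n1'.
have := form_root b aR; have := form_root a bR.
have := form_root_gt0 aR; have := form_root_gt0 bR => pb pa e1 e2.
have := form_gt0 abN0; rewrite formDr !formDl => h.
by exfalso; rewrite (formC b a) in h e1; nra.
Qed.
End Reflections.

(** * Positive roots, heights and simple roots *)

Section Positive.
Variables (R : realType) (V : vectType R) (Phi : root_system V).
Variable P : positive_system Phi.
Implicit Types (a b c x y : V).
Local Notation pair := (cpair Phi).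
Local Notation refl := (srefl Phi).
Local Notation form := (rform Phi).

Lemma pos_opp_notin a : a \in pos P -> - a \notin pos P.
Proof. by move=> aP; have := pos_opp P (pos_root aP); rewrite aP. Qed.

Lemma notin_pos a : a \in roots Phi -> a \notin pos P -> - a \in pos P.
Proof. by move=> aR /negPf aP; have := pos_opp P aR; rewrite aP. Qed.

(** Let b be the first term. As (b, b) > 0 and the total is zero, some c has (b, c) < 0; then b + c
    is a positive root, and merging the two terms shortens the sum. *)
Lemma no_zero_sum (s : seq V) : (forall a, a \in s -> a \in pos P) ->
  \sum_(a <- s) a = 0 -> s = [::].
Proof.
have [m] := ubnP (size s); elim: m s => // m IH [//|b s] /= ltm sP s0.
have bP : b \in pos P by apply: sP; rewrite mem_head.
have [c cs cb] : exists2 c, c \in s & form b c < 0.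
  apply: contrapT => h; have : 0 < form b (\sum_(a <- b :: s) a).
    rewrite big_cons formDr form_sumr ltr_wpDr ?form_root_gt0 ?(pos_root bP)//.
    rewrite big_seq sumr_ge0// => c cs; rewrite leNgt; apply/negP => cb.
    by apply: h; exists c.
  by rewrite s0 form0r ltxx.
have cP : c \in pos P by apply: sP; rewrite inE cs orbT.
have bcP : c + b \in pos P.
  apply: pos_add => //; apply: root_sum; rewrite ?(pos_root bP) ?(pos_root cP)//.
    by rewrite pair_lt0 ?(pos_root bP).
  apply/negP; rewrite addr_eq0 => /eqP cE.
  by have := pos_opp_notin bP; rewrite -cE cP.
suff : c + b :: rem c s = [::] by [].
apply: IH; first by rewrite /= size_rem//; case: (s) cs ltm.
  by move=> a; rewrite inE => /orP[/eqP->//|/mem_rem as_]; apply: sP; rewrite inE as_ orbT.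
by rewrite -[RHS]s0 !big_cons (perm_big _ (perm_to_rem cs)) big_cons [RHS]addrA [b + c]addrC.
Qed.

(** Otherwise - (a + m b), a and m copies of b are positive roots with sum zero. *)
Lemma pos_addn a b m : a \in pos P -> b \in pos P -> a + b *+ m \in roots Phi ->
  a + b *+ m \in pos P.
Proof.
move=> aP bP abR; apply: contraT => /(notin_pos abR) h.
suff : [:: - (a + b *+ m), a & nseq m b] = [::] by [].
apply: no_zero_sum => [x|].
  by rewrite !inE => /or3P[/eqP->|/eqP->|/nseqP[->]].
by rewrite !big_cons big_nseq iter_addr_0 addNr.
Qed.

Lemma pair_pos_int a b : a \in pos P -> b \in pos P -> exists m : int, pair a b = m%:~R.
Proof. by move=> aP bP; apply/intrP; apply: pair_int; apply: (@pos_root _ _ _ P). Qed.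

Lemma pos_refl a b : a \in pos P -> b \in pos P -> pair b a <= 0 -> refl b a \in pos P.
Proof.
move=> aP bP; have : refl b a \in roots Phi by rewrite refl_root ?(pos_root aP) ?(pos_root bP).
rewrite reflE; have [m ->] := pair_pos_int bP aP; case: m => [[|m]|m].
- by rewrite scale0r subr0.
- by rewrite -pmulrn lern0.
- by rewrite NegzE mulrNz scaleNr opprK -pmulrn scaler_nat => abR _; apply: pos_addn.
Qed.

(** Twice the usual half sum; the factor is harmless, since only signs of pairings are read off from
    it and [small_rho] rescales it. *)
Definition rho : V := \sum_(a <- undup (pos P)) a.

(* With N the set of positive roots made negative by s_b, one has
   rho - s_b rho = 2 sum N, and [b] pairs positively with every element of N. *)
Lemma pair_rho b : b \in pos P -> 0 < pair b rho.
Proof.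
move=> bP; have bR := pos_root bP; pose Q := undup (pos P).
pose N := [seq a <- Q | refl b a \notin pos P].
pose N' := [seq a <- Q | refl b a \in pos P].
have rhoE : rho = \sum_(a <- N') a + \sum_(a <- N) a.
  by rewrite /rho (bigID (fun a => refl b a \in pos P)) /= !big_filter.
have N'E : refl b (\sum_(a <- N') a) = \sum_(a <- N') a.
  rewrite linear_sum /=; rewrite -(big_map (refl b) predT id); apply: perm_big.
  apply: perm_map_stable; first by rewrite filter_uniq ?undup_uniq.
    by move=> u v _ _; apply: (can_inj (reflK bR)).
  by move=> a; rewrite !mem_filter !mem_undup reflK// => /andP[-> ->].
have NE : refl b (\sum_(a <- N) a) = - \sum_(a <- N) a.
  apply/eqP; rewrite -eqr_oppLR linear_sum -sumrN /=; apply/eqP.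
  rewrite -(big_map (fun a => - refl b a) predT id); apply: perm_big.
  apply: perm_map_stable; first by rewrite filter_uniq ?undup_uniq.
    by move=> u v _ _ /oppr_inj; apply: (can_inj (reflK bR)).
  move=> a; rewrite !mem_filter !mem_undup linearN /= reflK// => /andP[h aP].
  by rewrite pos_opp_notin// notin_pos// refl_root// (pos_root aP).
have : pair b (rho - refl b rho) = 2 * \sum_(a <- N) pair b a.
  rewrite rhoE linearD /= N'E NE opprD opprK addrACA subrr add0r pairD pair_sum.
  by rewrite mulr_natl mulr2n.
rewrite reflE opprB addrC subrK pairZ pairK// mulrC => /mulfI.
rewrite pnatr_eq0 => /(_ isT) ->.
have Npos a : a \in N -> 0 < pair b a.
  rewrite mem_filter mem_undup => /andP[h aP]; rewrite ltNge.
  by apply: contra h => ?; apply: pos_refl.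
have bN : b \in N.
  by rewrite mem_filter mem_undup bP refl_self// pos_opp_notin.
rewrite (perm_big _ (perm_to_rem bN)) big_cons ltr_pwDl ?Npos//.
by rewrite big_seq sumr_ge0// => a /mem_rem/Npos/ltW.
Qed.

(** A real substitute for the height in terms of simple roots: it is linear, and a root is positive
    exactly when its value is. *)
Definition ht x : R := form rho x.

Lemma htE : (forall x y, ht (x + y) = ht x + ht y) * (forall t x, ht (t *: x) = t * ht x)
  * (forall x y, ht (x - y) = ht x - ht y) * (forall x, ht (- x) = - ht x) * (ht 0 = 0).
Proof. by do !split; move=> *; rewrite /ht ?formDr ?formZr ?formBr ?formNr ?form0r. Qed.

Lemma ht_gt0 a : a \in pos P -> 0 < ht a.
Proof. by move=> aP; rewrite /ht formC -pair_gt0 ?pair_rho// (pos_root aP). Qed.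

Lemma pos_ht a : a \in roots Phi -> (a \in pos P) = (0 < ht a).
Proof.
move=> aR; apply/idP/idP; first exact: ht_gt0.
by apply: contraTT => /(notin_pos aR)/ht_gt0; rewrite htE oppr_gt0 -leNgt => /ltW.
Qed.

Lemma notin_pos_ht a : a \in roots Phi -> (a \notin pos P) = (ht a < 0).
Proof.
move=> aR; apply/idP/idP; first by move/(notin_pos aR)/ht_gt0; rewrite htE oppr_gt0.
by rewrite pos_ht// -leNgt => /ltW.
Qed.

Definition simple a : Prop := a \in pos P /\
  forall b c, b \in pos P -> c \in pos P -> a <> b + c.

(** Heights are real numbers, so the induction runs on the number of positive roots of smaller
    height. *)
Lemma ht_ind (Q : V -> Prop) :
  (forall a, a \in pos P -> (forall b, b \in pos P -> ht b < ht a -> Q b) -> Q a) ->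
  forall a, a \in pos P -> Q a.
Proof.
move=> step a; pose m a := size [seq b <- undup (pos P) | ht b < ht a].
have [k] := ubnP (m a); elim: k a => // k IH a lt_k aP.
apply: step => // b bP ba; apply: IH => //; apply: leq_trans (_ : m a <= k)%N => //.
pose s := [seq c <- undup (pos P) | ht c < ht a].
apply: (@uniq_leq_size _ (b :: [seq c <- undup (pos P) | ht c < ht b]) s).
  by rewrite /= mem_filter ltxx filter_uniq// undup_uniq.
move=> c; rewrite inE !mem_filter !mem_undup => /orP[/eqP->|/andP[cb cP]].
  by rewrite ba bP.
by rewrite cP (lt_trans cb).
Qed.

Lemma simple_sum a : a \in pos P ->
  exists2 s : seq V, (forall b, b \in s -> simple b) & a = \sum_(b <- s) b.
Proof.
move: a; apply: ht_ind => a aP IH.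
have [sa|nsa] := pselect (simple a).
  by exists [:: a]; [move=> b; rewrite inE => /eqP->|rewrite big_seq1].
have [b [c [bP cP aE]]] : exists b c, [/\ b \in pos P, c \in pos P & a = b + c].
  apply: contrapT => h; apply: nsa; split=> // b c bP cP aE; apply: h; by exists b, c.
have hb := ht_gt0 bP; have hc := ht_gt0 cP.
have [|s sS bE] := IH b bP; first by rewrite aE htE ltrDl.
have [|t tS cE] := IH c cP; first by rewrite aE htE ltrDr.
exists (s ++ t); last by rewrite big_cat -bE -cE.
by move=> d; rewrite mem_cat => /orP[/sS|/tS].
Qed.

Lemma simple_pos a : simple a -> a \in pos P. Proof. by case. Qed.
Lemma simple_root a : simple a -> a \in roots Phi. Proof. by move/simple_pos/pos_root. Qed.

Hypothesis reduced : forall a b m, a \in pos P -> b \in pos P -> b = a *+ m -> b = a.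

(* The root string from [b] towards [- a] is unbroken; it cannot cross from the
   positive to the negative roots, since [a] would be a sum of positive roots. *)
Lemma refl_simple a b : simple a -> b \in pos P -> b != a -> refl a b \in pos P.
Proof.
move=> sa bP ba; have [aP indec] := sa; have aR := pos_root aP; have bR := pos_root bP.
have [m mE] := pair_pos_int aP bP.
case: m mE => [m|m] mE; last by apply: pos_refl; rewrite // mE lerz0.
suff h j : (j <= m)%N -> b - a *+ j \in pos P.
  by rewrite reflE mE -pmulrn scaler_nat h.
have neq i : b - a *+ i != a.
  apply: contra ba; rewrite subr_eq -mulrS => /eqP bE.
  by rewrite [X in X == _](reduced aP bP bE).
elim/ltn_ind: j => -[|j] IH jm; first by rewrite mulr0n subr0.
have jP : b - a *+ j \in pos P by apply: IH => //; apply: ltnW.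
have eS : b - a *+ j.+1 = (b - a *+ j) - a by rewrite mulrSr opprD addrA.
have jR : b - a *+ j.+1 \in roots Phi.
  (* Before the middle of the string, b - j a pairs positively with a and [root_sum] applies with -
     a. Past it, b - (j+1) a is the image under s_a of b - (m-j-1) a, which was reached earlier. *)
  have [lt2|ge2] := ltnP j.*2 m.
    rewrite eS; apply: root_sum; rewrite ?oppr_root ?(pos_root jP)//.
      rewrite pairNl// pairB mE -scaler_nat pairZ pairK// oppr_lt0 subr_gt0.
      by rewrite -natrM ltr_nat muln2.
    by rewrite subr_eq0.
  have lj : (m - j.+1 < j.+1)%N by lia.
  have lj' : (m - j.+1 <= m)%N by lia.
  have := refl_root aR (pos_root (IH _ lj lj')).
  rewrite reflE pairB mE -scaler_nat pairZ pairK// -natrM -natrB; last by lia.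
  by rewrite !scaler_nat -addrA -opprD -mulrnDr (_ : (_ + _ = j.+1)%N)//; lia.
apply: contraT => /(notin_pos jR); rewrite eS opprB => cP.
by case: (indec (b - a *+ j) (a - (b - a *+ j))) => //; rewrite subrKC.
Qed.

Lemma simple_pair_gt0 a : a \in pos P -> exists2 b, simple b & 0 < pair b a.
Proof.
move=> aP; have [s sS aE] := simple_sum aP; apply: contrapT => h.
have := form_root_gt0 (pos_root aP); rewrite {2}aE form_sumr ltNge.
rewrite big_seq -oppr_ge0 -sumrN sumr_ge0// => b /sS sb; rewrite oppr_ge0 leNgt.
by apply/negP => ab; apply: h; exists b => //; rewrite pair_gt0 ?simple_root// formC.
Qed.
End Positive.

(** * The Weyl group *)

Section WeylGroup.
Variables (R : realType) (V : vectType R) (Phi : root_system V).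
Variable P : positive_system Phi.
Implicit Types (a b c x y : V) (v w : 'End(V)) (s : seq V).
Local Notation pair := (cpair Phi).
Local Notation refl := (srefl Phi).
Local Notation ht := (ht P).
Local Notation simple := (simple P).

Lemma lfE : (forall v w x, (v \o w)%VF x = v (w x)) * (forall x, (\1%VF : 'End(V)) x = x).
Proof. by split=> *; rewrite ?comp_lfunE ?id_lfunE. Qed.

Definition weyl_word s : 'End(V) := foldr (fun a w => (refl a \o w)%VF) \1%VF s.

Lemma weyl_word_cons a s x : weyl_word (a :: s) x = refl a (weyl_word s x).
Proof. by rewrite lfE. Qed.

Lemma weyl_word_cat s t x : weyl_word (s ++ t) x = weyl_word s (weyl_word t x).
Proof. by elim: s => [|a s IH]; rewrite /= !lfE// IH. Qed.

Definition weyl w : Prop := exists2 s, {subset s <= roots Phi} & w = weyl_word s.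

Lemma weyl1 : weyl \1%VF. Proof. by exists [::]. Qed.

Lemma weyl_refl a : a \in roots Phi -> weyl (refl a).
Proof.
move=> aR; exists [:: a]; first by move=> b; rewrite inE => /eqP->.
by rewrite /= comp_lfun1r.
Qed.

Lemma weyl_comp v w : weyl v -> weyl w -> weyl (v \o w)%VF.
Proof.
move=> [s sR ->] [t tR ->]; exists (s ++ t).
  by move=> a; rewrite mem_cat => /orP[/sR|/tR].
by apply/lfunP => x; rewrite weyl_word_cat lfE.
Qed.

Lemma weyl_rect (Q : 'End(V) -> Prop) : Q \1%VF ->
  (forall a w, a \in roots Phi -> weyl w -> Q w -> Q (refl a \o w)%VF) ->
  forall w, weyl w -> Q w.
Proof.
move=> Q1 QS w [s sR ->]; elim: s sR => //= a s IH sR.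
have sR' : {subset s <= roots Phi} by move=> b bs; apply: sR; rewrite inE bs orbT.
by apply: QS; [apply: sR; rewrite mem_head|exists s|apply: IH].
Qed.

Lemma weyl_inv w : weyl w -> exists v, [/\ weyl v, cancel w v & cancel v w].
Proof.
move: w; apply: weyl_rect => [|a w aR _ [v [vW wK vK]]].
  by exists \1%VF; split=> [|x|x]; rewrite ?lfE//; apply: weyl1.
exists (v \o refl a)%VF; split=> [|x|x]; first exact: weyl_comp (weyl_refl aR).
  by rewrite !lfE reflK.
by rewrite !lfE vK reflK.
Qed.

Lemma weyl_inj w : weyl w -> injective w.
Proof. by move=> /weyl_inv[v [_ wK _]]; apply: can_inj wK. Qed.

Lemma weyl_root w a : weyl w -> a \in roots Phi -> w a \in roots Phi.
Proof.
move=> wW aR; move: w wW; apply: weyl_rect => [|b w bR _ IH]; rewrite lfE//.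
exact: refl_root.
Qed.

Lemma pair_weyl w a x : weyl w -> a \in roots Phi -> pair (w a) (w x) = pair a x.
Proof.
move=> wW aR; move: w wW; apply: weyl_rect => [|b w bR wW IH]; rewrite !lfE//.
by rewrite pair_refl// weyl_root.
Qed.

Lemma weyl_conj w a x : weyl w -> a \in roots Phi -> refl (w a) (w x) = w (refl a x).
Proof. by move=> wW aR; rewrite !reflE pair_weyl// linearB /= (linearZ_LR w). Qed.

(** The roots span, so an element is determined by the self-map of the roots that it induces. For
    each self-map one element inducing it is chosen, the identity being the default when there is
    none. *)
Lemma weyl_finite : exists ws : seq 'End(V), uniq ws /\ forall w, (w \in ws) <-> weyl w.
Proof.
pose T := seq_sub (roots Phi).
pose agree (p : {ffun T -> T}) w := weyl w /\ forall t : T, w (val t) = val (p t).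
pose ws := undup [seq xget \1%VF [set w | agree p w] | p <- enum {: {ffun T -> T}}].
exists ws; split; first exact: undup_uniq.
move=> w; rewrite mem_undup; split.
  by move=> /mapP[p _ ->]; case: xgetP => [v _ []|]//; move=> *; apply: weyl1.
move=> wW; apply/mapP; pose p := [ffun t : T => SeqSub (weyl_root wW (valP t))].
have pw : agree p w by split=> // t; rewrite ffunE.
exists p; first by rewrite mem_enum.
have [_ e] := xgetPex \1%VF (ex_intro _ w pw).
have [_ e'] := pw.
move: e; set v := xget _ _ => e.
have h b : b \in roots Phi -> w b = v b.
  by move=> bR; have := e (SeqSub bR); rewrite -e' /=.
apply/lfunP => x.
have : x \in <<roots Phi>>%VS by rewrite root_span memvf.
move=> /(@coord_span _ _ _ (in_tuple (roots Phi))) ->; rewrite !linear_sum /=.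
by apply: eq_bigr => i _; rewrite !linearZ /= h// mem_nth.
Qed.

(* The number of positive roots minus the usual length: the identity is the
   largest element, as the dominant alcove is in the special section. *)
Definition wlen w : nat := count (fun c => w c \in pos P) (undup (pos P)).

(** The map sending c to s_a c if that is positive, and to c otherwise, injects the positive roots
    kept positive by w s_a into those kept positive by w, and misses a. *)
Lemma wlen_refl w a : weyl w -> a \in pos P -> w a \in pos P ->
  (wlen (w \o refl a)%VF < wlen w)%N.
Proof.
move=> wW aP waP; have aR := pos_root aP; rewrite /wlen -!size_filter.
pose g c := if refl a c \in pos P then refl a c else c.
set A := [seq _ <- _ | _]; set B := [seq _ <- _ | _].
have aA : a \notin map g A.
  apply/mapP => -[c]; rewrite mem_filter mem_undup /g => /andP[h cP].
  case: ifP => [_ /(congr1 (refl a))|_ aE].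
    by rewrite reflK// refl_self// => e; move: (pos_opp_notin aP); rewrite e cP.
  by move: h; rewrite -aE lfE refl_self// linearN (negPf (pos_opp_notin waP)).
have uA : uniq (a :: map g A).
  rewrite /= aA map_inj_in_uniq ?filter_uniq ?undup_uniq// => c d.
  rewrite !mem_filter !mem_undup /g => /andP[_ cP] /andP[_ dP].
  case: ifP => hc; case: ifP => hd; first exact: (can_inj (reflK aR)).
  - by move=> e; move: hd; rewrite -e reflK// cP.
  - by move=> e; move: hc; rewrite e reflK// dP.
  - by [].
have := @uniq_leq_size _ _ B uA; rewrite /= size_map; apply.
move=> c; rewrite inE => /orP[/eqP->|/mapP[d]].
  by rewrite mem_filter mem_undup waP aP.
rewrite !mem_filter !mem_undup lfE /g => /andP[h dP] ->.
case: ifP => h'; first by rewrite h h'.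
rewrite dP andbT; have dR := pos_root dP.
have da : 0 < pair a d.
  by rewrite ltNge; apply: contraFN h' => ?; apply: pos_refl.
rewrite pos_ht ?weyl_root//; have -> : w d = w (refl a d) + pair a d *: w a.
  by rewrite -linearZ -linearD reflE subrK.
by rewrite htE htE addr_gt0 ?mulr_gt0 ?ht_gt0.
Qed.

Hypothesis reduced : forall a b m, a \in pos P -> b \in pos P -> b = a *+ m -> b = a.

Lemma perm_refl_simple a : simple a ->
  perm_eq (map (refl a) (rem a (undup (pos P)))) (rem a (undup (pos P))).
Proof.
move=> sa; have aR := simple_root sa; apply: perm_map_stable; first by rewrite rem_uniq ?undup_uniq.
  by move=> c d _ _; apply: (can_inj (reflK aR)).
move=> c; rewrite !mem_rem_uniq ?undup_uniq// !inE !mem_undup => /andP[ca cP].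
rewrite (refl_simple reduced)// andbT; apply/eqP => /(congr1 (refl a)).
rewrite reflK// refl_self// => e; move: cP; rewrite e.
by rewrite (negPf (pos_opp_notin (simple_pos sa))).
Qed.

(** As s_a permutes the positive roots other than a, only the contribution of [a] to the count
    changes. *)
Lemma wlen_simple w a : weyl w -> simple a ->
  (wlen (w \o refl a)%VF + (w a \in pos P) = wlen w + (w a \notin pos P))%N.
Proof.
move=> wW sa; have aR := simple_root sa; have aP := simple_pos sa.
have aQ : a \in undup (pos P) by rewrite mem_undup.
rewrite /wlen !(permP (perm_to_rem aQ)) /= lfE refl_self// linearN /=.
have -> : (- w a \in pos P) = (w a \notin pos P).
  have := pos_opp P (weyl_root wW aR).
  by case: (w a \in _); case: (- w a \in _).
rewrite [LHS]addnAC [RHS]addnAC [X in (X + _)%N = _]addnC; congr (_ + _)%N.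
rewrite -(permP (perm_refl_simple sa) (fun c => w c \in pos P)) count_map.
by apply: eq_count => c /=; rewrite lfE.
Qed.

Lemma weyl_neg_simple w a : weyl w -> a \in pos P -> w a \notin pos P ->
  exists2 b, simple b & w b \notin pos P.
Proof.
move=> wW aP waP; apply: contrapT => h.
have [s sS aE] := simple_sum aP.
move: waP; rewrite notin_pos_ht ?weyl_root ?(pos_root aP)// ltNge => /negP; apply.
rewrite aE linear_sum /ht form_sumr /= big_seq sumr_ge0// => b /sS sb.
apply: ltW; apply: ht_gt0; apply: contraT => wb.
by exfalso; apply: h; exists b.
Qed.

(** Induction on the height: if a positive root a is not simple, some simple b has <a, b^v> > 0.
    Then s_b a is positive of smaller height, and s_a is the conjugate by s_b of its reflection. *)
Lemma refl_word a : a \in roots Phi ->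
  exists2 s, (forall b, b \in s -> simple b) & refl a = weyl_word s.
Proof.
wlog: a / a \in pos P.
  move=> h aR; have [|/(notin_pos aR) aP] := boolP (a \in pos P); first by move=> ?; apply: h.
  have [|s sS e] := h _ aP; first by rewrite oppr_root.
  exists s => //; rewrite -e; apply/lfunP => x.
  by rewrite !reflE pairNl// scaleNr scalerN opprK.
move=> + _; move: a; apply: (ht_ind (P := P)) => a aP IH.
have [sa|nsa] := pselect (simple a).
  exists [:: a]; first by move=> b; rewrite inE => /eqP->.
  by rewrite /= comp_lfun1r.
have [b sb ba] := simple_pair_gt0 aP; have bP := simple_pos sb; have bR := pos_root bP.
have raP : refl b a \in pos P.
  by apply: (refl_simple reduced) => //; apply/eqP => aE; apply: nsa; rewrite aE.
have [|s sS e] := IH _ raP.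
  by rewrite reflE !htE ltrBlDr ltrDl mulr_gt0// ht_gt0.
exists (b :: s ++ [:: b]).
  by move=> c; rewrite inE mem_cat mem_seq1 => /or3P[/eqP->|/sS|/eqP->].
apply/lfunP => x; rewrite weyl_word_cons weyl_word_cat -e weyl_word_cons /= !lfE.
by rewrite (weyl_conj _ (weyl_refl bR)) ?reflK// (pos_root aP).
Qed.

Lemma weyl_simple_word w : weyl w ->
  exists2 s, (forall b, b \in s -> simple b) & w = weyl_word s.
Proof.
move: w; apply: weyl_rect => [|a w aR _ [t tS ->]]; first by exists [::].
have [s sS ->] := refl_word aR; exists (s ++ t).
  by move=> b; rewrite mem_cat => /orP[/sS|/tS].
by apply/lfunP => x; rewrite lfE weyl_word_cat.
Qed.

Lemma simple_word_weyl s : (forall b, b \in s -> simple b) -> weyl (weyl_word s).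
Proof. by move=> sS; exists s => // b /sS/simple_root. Qed.

(** Applying the letters from the right, [c] turns negative at some letter b; the only positive root
    made negative by s_b is b. *)
Lemma simple_word_exchange s c : (forall b, b \in s -> simple b) ->
  c \in pos P -> weyl_word s c \notin pos P ->
  exists t b u, s = t ++ b :: u /\ weyl_word u c = b.
Proof.
elim: s => [|b u IH] sS cP; first by rewrite /= lfE cP.
have uS b' : b' \in u -> simple b' by move=> bu; apply: sS; rewrite inE bu orbT.
have sb : simple b by apply: sS; rewrite mem_head.
have [ucP|ucP] := boolP (weyl_word u c \in pos P); last first.
  by have [t [b' [u' [-> e]]]] := IH uS cP ucP; exists (b :: t), b', u'.
have [e|ne] := eqVneq (weyl_word u c) b; first by exists [::], b, u.
by rewrite weyl_word_cons (refl_simple reduced).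
Qed.

(* Deletion: a word of simple reflections that preserves the positive roots is
   not reduced, and dropping two of its letters does not change it. *)
Lemma weyl_eq1 w : weyl w -> (forall a, a \in pos P -> w a \in pos P) -> w = \1%VF.
Proof.
move=> /weyl_simple_word[s]; have [m] := ubnP (size s); elim: m s w => // m IH s w.
case/lastP: s => [_ _ ->//|s a] lt_s sS -> wP.
have sa : simple a by apply: sS; rewrite mem_rcons mem_head.
have sS' b : b \in s -> simple b by move=> bs; apply: sS; rewrite mem_rcons inE bs orbT.
have aP := simple_pos sa; have aR := simple_root sa.
have saP : weyl_word s a \notin pos P.
  have := wP a aP; rewrite -cats1 weyl_word_cat weyl_word_cons /= !lfE refl_self// linearN.
  by move=> /pos_opp_notin; rewrite opprK.
have [t [b [u [sE uaE]]]] := simple_word_exchange sS' aP saP.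
have uS c : c \in u -> simple c by move=> cu; apply: sS'; rewrite sE mem_cat inE cu !orbT.
have tS c : c \in t -> simple c by move=> ct; apply: sS'; rewrite sE mem_cat ct.
(* From u a = b follows u s_a = s_b u, so the letters b and a cancel. *)
have eqw : weyl_word (rcons s a) = weyl_word (t ++ u).
  apply/lfunP => x; rewrite -cats1 sE !weyl_word_cat !weyl_word_cons /= !lfE.
  by rewrite -{1}uaE (weyl_conj _ (simple_word_weyl uS))// reflK.
rewrite eqw; apply: (IH (t ++ u)) => //.
- by move: lt_s; rewrite size_rcons sE !size_cat /=; lia.
- by move=> c; rewrite mem_cat => /orP[/tS|/uS].
- by rewrite -eqw.
Qed.
End WeylGroup.

(** * Divisibility by coroots *)

Section LinearForms.
Variables (n : nat) (k : fieldType).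
Implicit Types (u v : 'rV[k]_n) (p q d : symalg n k).

Definition divides d p : Prop := exists q, p = d * q.

Lemma divides0 d : divides d 0. Proof. by exists 0; rewrite mulr0. Qed.
Lemma dividesD d p q : divides d p -> divides d q -> divides d (p + q).
Proof. by move=> [a ->] [b ->]; exists (a + b); rewrite mulrDr. Qed.
Lemma dividesN d p : divides d p -> divides d (- p).
Proof. by move=> [a ->]; exists (- a); rewrite mulrN. Qed.
Lemma dividesB d p q : divides d p -> divides d q -> divides d (p - q).
Proof. by move=> dp /dividesN; apply: dividesD. Qed.
Lemma divides_mull d p q : divides d q -> divides d (p * q).
Proof. by move=> [a ->]; exists (p * a); rewrite mulrCA. Qed.
Lemma divides_mulr d p q : divides d p -> divides d (p * q).
Proof. by move=> [a ->]; exists (a * q); rewrite mulrA. Qed.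
Lemma dividesNl d p : divides d p -> divides (- d) p.
Proof. by move=> [a ->]; exists (- a); rewrite mulrNN. Qed.

Lemma linear_formD u v : linear_form (u + v) = linear_form u + linear_form v.
Proof.
by rewrite /linear_form -big_split /=; apply: eq_bigr => i _; rewrite mxE scalerDl.
Qed.

Lemma linear_formZ c u : linear_form (c *: u) = c *: linear_form u.
Proof. by rewrite /linear_form scaler_sumr; apply: eq_bigr => i _; rewrite mxE scalerA. Qed.

Lemma mcoeff_linear_form u i : (linear_form u)@_U_(i) = u 0 i.
Proof.
rewrite /linear_form linear_sum /= (bigD1 i)//= big1 ?addr0 => [|j /negPf ji].
  by rewrite mcoeffZ mcoeffXU eqxx mulr1.
by rewrite mcoeffZ mcoeffXU ji mulr0.
Qed.

Lemma linear_form_inj : injective (@linear_form n k).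
Proof.
by move=> u v e; apply/rowP => i; rewrite -!mcoeff_linear_form e.
Qed.

Lemma linear_form0 : linear_form (0 : 'rV[k]_n) = 0.
Proof. by rewrite -(scale0r 0) linear_formZ scale0r. Qed.

Lemma linear_form_eq0 u : linear_form u = 0 -> u = 0.
Proof. by rewrite -linear_form0 => /linear_form_inj. Qed.

Section Elimination.
Variables (u : 'rV[k]_n) (i0 : 'I_n).
Hypothesis ui0 : u 0 i0 != 0.

(* Substitution solving [linear_form u = 0] for the variable of index [i0];
   its kernel is the ideal generated by [linear_form u]. *)
Definition elimv : n.-tuple (symalg n k) :=
  [tuple 'X_i - ((i == i0)%:R / u 0 i0) *: linear_form u | i < n].
Definition elim p : symalg n k := comp_mpoly elimv p.

Lemma elimX i : elim 'X_i = 'X_i - ((i == i0)%:R / u 0 i0) *: linear_form u.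
Proof. by rewrite /elim comp_mpolyXU -tnth_nth tnth_mktuple. Qed.

Lemma elim_form v : elim (linear_form v) = linear_form v - (v 0 i0 / u 0 i0) *: linear_form u.
Proof.
rewrite {1}/linear_form /elim linear_sum /=.
under eq_bigr do rewrite linearZ /= -/(elim _) elimX scalerBr.
rewrite sumrB; congr (_ - _); rewrite (bigD1 i0)//= big1 => [|i /negPf ii0].
  by rewrite eqxx addr0 scalerA mul1r.
by rewrite ii0 mul0r scale0r scaler0.
Qed.

Lemma elim_self : elim (linear_form u) = 0.
Proof. by rewrite elim_form divff// scale1r subrr. Qed.

(** The substitution is a ring homomorphism that moves each variable by a multiple of
    [linear_form u], and this congruence is compatible with sums and products. *)
Lemma divides_elim p : divides (linear_form u) (p - elim p).
Proof.
have hX i : divides (linear_form u) ('X_i - elim 'X_i).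
  by rewrite elimX subKr; exists (((i == i0)%:R / u 0 i0)%:MP); rewrite -mul_mpolyC mulrC.
have hM q r : divides (linear_form u) (q - elim q) -> divides (linear_form u) (r - elim r) ->
    divides (linear_form u) (q * r - elim (q * r)).
  move=> hq hr; have -> : q * r - elim (q * r) = q * (r - elim r) + elim r * (q - elim q).
    by rewrite /elim rmorphM /=; ring.
  by apply: dividesD; apply: divides_mull.
have -> : p - elim p = \sum_(m <- msupp p) (p@_m *: 'X_[m] - elim (p@_m *: 'X_[m])).
  by rewrite sumrB -mpolyE; congr (_ - _); rewrite {1}[p]mpolyE /elim linear_sum.
elim/big_ind: _ => [|? ?|m _]; [exact: divides0|exact: dividesD|].
rewrite {1}/elim linearZ -scalerBr /= -mul_mpolyC; apply: divides_mull; rewrite -/(elim _) mpolyXE_id.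
have h1 : divides (linear_form u) (1 - elim 1).
  by rewrite /elim comp_mpoly1 subrr; apply: divides0.
elim/big_ind: _ => [|q r|i _]; [exact: h1|exact: hM|].
by elim: (m i) => [|e IH]; rewrite ?expr0 // exprS; apply: hM.
Qed.
End Elimination.

(** The substitution kills [linear_form u] and takes values in a domain; the image of
    [linear_form v] is nonzero because v is not a multiple of u. *)
Lemma linear_form_prime u v p : u != 0 -> (forall c, v <> c *: u) ->
  divides (linear_form u) (linear_form v * p) -> divides (linear_form u) p.
Proof.
move=> u0 vu [q e]; have [i ui] : exists i, u 0 i != 0.
  apply: contrapT => h; move/eqP: u0; apply; apply/rowP => i; rewrite mxE.
  by apply: contrapT => /eqP ui; apply: h; exists i.
have : elim u i (linear_form v) * elim u i p = 0.
  by rewrite /elim -rmorphM e rmorphM /= -/(elim u i _) elim_self// mul0r.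
move=> /eqP; rewrite mulf_eq0 => /orP[/eqP|/eqP p0]; last first.
  by have := divides_elim u i p; rewrite p0 subr0.
rewrite elim_form// => /subr0_eq; rewrite -linear_formZ => /linear_form_inj.
by move/vu.
Qed.
End LinearForms.

(** * Coroots as coprime linear forms over k *)

Section CorootPolynomials.
Variables (R : realType) (V : vectType R) (Phi : root_system V).
Variables (P : positive_system Phi) (n : nat) (omega : n.-tuple 'Hom(V, R^o)).
Variable (k : fieldType).
Hypothesis omegaP : coweight_basis Phi omega.
Hypothesis char2 : 2%N \notin [pchar k].
Hypothesis gkmP : gkm P omega k.
Implicit Types (a b x y : V) (v w : 'Hom(V, R^o)).
Local Notation pair := (cpair Phi).
Local Notation refl := (srefl Phi).
Local Notation cr := (coroot_k Phi omega k).

Lemma coweight_span v : coweight_lattice Phi v -> exists z : 'I_n -> int,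
  v = \sum_(j < n) omega`_j *~ z j /\
  forall i, coord omega i v = (z i)%:~R /\ coweight_k omega k v 0 i = (z i)%:~R.
Proof.
have [om_free ->] := omegaP; move=> [z ->]; exists z; split=> // i.
have e : coord omega i (\sum_(j < n) omega`_j *~ z j) = (z i)%:~R.
  rewrite linear_sum /= (bigD1 i)//= big1 ?addr0 => [|j /negPf ji].
    by rewrite -scaler_int linearZ /= coord_free// eqxx; apply: mulr1.
  by rewrite -scaler_int linearZ /= coord_free// ji; apply: mulr0.
by split=> //; rewrite mxE e intrKfloor.
Qed.

Lemma coweight_coord v : coweight_lattice Phi v ->
  forall i, exists2 m : int, coord omega i v = m%:~R & coweight_k omega k v 0 i = m%:~R.
Proof. by move=> /coweight_span[z [_ h]] i; exists (z i); case: (h i). Qed.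

Lemma coroot_coweight a : a \in roots Phi -> coweight_lattice Phi (coroot Phi a).
Proof. by move=> aR b bR; apply: coroot_int. Qed.

(** [coweight_k] takes floors of real coordinates, so it is additive only where these are integers,
    as they are for coroots. There an integral relation passes to k. *)
Lemma coroot_kB (m : int) a b c :
  a \in roots Phi -> b \in roots Phi -> c \in roots Phi ->
  coroot Phi a = coroot Phi b - (m%:~R : R) *: coroot Phi c -> cr a = cr b - m%:~R *: cr c.
Proof.
move=> aR bR cR aE; rewrite /coroot_k -scaleN1r scalerA mulrC -linear_formZ -linear_formD.
congr linear_form; apply/rowP => i; rewrite !mxE.
have [x ax] := coweight_coord (coroot_coweight aR) i.
have [y bx] := coweight_coord (coroot_coweight bR) i.
have [z cx] := coweight_coord (coroot_coweight cR) i.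
rewrite !mxE => -> -> ->; rewrite mulrN1 mulNr -rmorphM -rmorphB; congr (_%:~R).
apply/eqP; rewrite -(eqr_int R) -ax aE linearB linearZ /= bx cx.
by rewrite rmorphB rmorphM.
Qed.

Lemma coroot_refl a b : a \in roots Phi -> b \in roots Phi ->
  coroot Phi (refl b a) = coroot Phi a - pair a b *: coroot Phi b.
Proof.
move=> aR bR; apply/lfunP => x; rewrite -[LHS]/(pair _ _) -[x in LHS](reflK bR).
rewrite pair_refl// reflE pairB pairZ !lfun_simp.
by rewrite -[coroot Phi b x]/(pair b x) -[coroot Phi a x]/(pair a x) mulrC.
Qed.

Lemma coroot_k_refl a b : a \in roots Phi -> b \in roots Phi ->
  exists2 m : int, pair a b = m%:~R & cr (refl b a) = cr a - m%:~R *: cr b.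
Proof.
move=> aR bR; have /intrP[m e] := pair_int aR bR; exists m => //.
by apply: coroot_kB; rewrite ?refl_root// coroot_refl// e.
Qed.

Lemma coroot_kN a : a \in roots Phi -> cr (- a) = - cr a.
Proof.
move=> aR; have [m + e] := coroot_k_refl aR aR.
rewrite pairK// => /esym/eqP; rewrite (eqr_int _ m 2) => /eqP mE.
rewrite -(refl_self aR) e mE (_ : 2%:~R = 1 + 1 :> k)//.
by rewrite scalerDl scale1r opprD addrA subrr sub0r.
Qed.

(** In the basis [omega], <a, a^v> = 2 is an integral combination of the coordinates of a^v; if
    these all vanished in k, then 2 = 0 in k. *)
Lemma coweight_k_coroot_neq0 a : a \in roots Phi -> coweight_k omega k (coroot Phi a) != 0.
Proof.
move=> aR; apply: contra char2 => /eqP c0.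
have [z [aE zE]] := coweight_span (coroot_coweight aR).
have omL i : exists m : int, (omega`_i : 'Hom(V, R^o)) a = m%:~R :> R.
  apply/intrP; suff : coweight_lattice Phi omega`_i by apply.
  have [_ ->] := omegaP; have [lt_in|ge_in] := ltnP i n; last first.
    rewrite nth_default ?size_tuple//; exists [ffun=> 0].
    by rewrite big1// => j _; rewrite ffunE mulr0z.
  exists [ffun j => (j == Ordinal lt_in)%:Z]; rewrite (bigD1 (Ordinal lt_in))//= big1.
    by rewrite ffunE eqxx addr0.
  by move=> j /negPf h; rewrite ffunE h mulr0z.
pose m (i : nat) := projT1 (cid (omL i)).
have mE i : (omega`_i : 'Hom(V, R^o)) a = (m i)%:~R :> R by rewrite /m; case: cid.
have e2 : 2 = \sum_(j < n) z j * m j.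
  apply/eqP; rewrite -(eqr_int R) -[2%:~R](pairK aR) /cpair aE sum_lfunE rmorph_sum /=.
  apply/eqP; apply: eq_bigr => j _; rewrite -scaler_int !lfun_simp mE rmorphM /=.
  by [].
rewrite inE /=; have : (2%:~R : k) = 0; last by move=> /eqP.
rewrite e2 rmorph_sum big1//= => j _; rewrite rmorphM /=.
by have [_ <-] := zE j; rewrite c0 mxE mul0r.
Qed.

Lemma coroot_k_neq0 a : a \in roots Phi -> cr a != 0.
Proof.
move=> aR; apply: contra (coweight_k_coroot_neq0 aR).
by move=> /eqP/linear_form_eq0->.
Qed.

(* A [root_system] may be non-reduced; [gkm] excludes this. *)
Lemma pos_reduced a b m : a \in pos P -> b \in pos P -> b = a *+ m -> b = a.
Proof.
move=> aP bP; rewrite -scaler_nat => bE.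
have [//|ba] := eqVneq b a; exfalso.
have aR := pos_root aP; have bR := pos_root bP.
have m0 : (m%:R : R) != 0.
  by apply: contraTneq (root_n0 bR) => m0; rewrite bE m0 scale0r eqxx.
(* Since b = m a, the coroots satisfy a^v = m b^v; this is written in the shape that [coroot_kB]
   expects, and its image in k contradicts [gkm]. *)
have e : coroot Phi a = coroot Phi b - ((1 - m%:Z)%:~R : R) *: coroot Phi b.
  apply/lfunP => x; rewrite !lfun_simp rmorphB /=.
  rewrite -[coroot Phi a x]/(pair a x) -[coroot Phi b x]/(pair b x) -[_ *: _]/(_ * _).
  have := form_root x aR; have := form_root x bR.
  rewrite bE !formZl formZr -bE => e1 e2; have faa := form_root_gt0 aR.
  have /mulfI : m%:R * rform Phi a a != 0 by rewrite mulf_neq0// gt_eqF.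
  by apply; rewrite -mulrA -e2 mulrCA e1; ring.
have z1 := coroot_kB aR bR bR e.
apply: (gkmP aP bP _ (c := m%:R)); first by apply/eqP; rewrite eq_sym.
apply: linear_form_inj; rewrite linear_formZ; apply: (etrans z1).
by rewrite rmorphB /= scalerBl scale1r subKr.
Qed.

Lemma coroot_k_indep a b c : a \in roots Phi -> b \in roots Phi -> b != a -> b != - a ->
  cr b <> c *: cr a.
Proof.
move=> aR bR ba bNa.
wlog aP : a c aR ba bNa / a \in pos P.
  move=> h; have [|/(notin_pos aR) aP] := boolP (a \in pos P); first exact: h.
  have := h (- a) (- c); rewrite opprK coroot_kN// scalerN scaleNr opprK; apply=> //.
  exact: oppr_root.
wlog bP : b c bR ba bNa / b \in pos P.
  move=> h; have [|/(notin_pos bR) bP] := boolP (b \in pos P); first exact: h.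
  move=> e; apply: (h (- b) (- c)) => //; rewrite ?oppr_root ?eqr_opp ?eqr_oppLR//.
  by rewrite coroot_kN// scaleNr e.
move=> e; apply: (gkmP bP aP _ (c := c)); first exact/eqP.
by apply: linear_form_inj; rewrite linear_formZ.
Qed.

Lemma coroot_k_prime a b p : a \in roots Phi -> b \in roots Phi -> b != a -> b != - a ->
  divides (cr a) (cr b * p) -> divides (cr a) p.
Proof.
move=> aR bR ba bNa; apply: linear_form_prime; first exact: coweight_k_coroot_neq0.
by move=> c e; apply: (coroot_k_indep (c := c) aR bR ba bNa); rewrite /coroot_k e linear_formZ.
Qed.

Lemma coroot_k_pos_prime a b p : a \in pos P -> b \in pos P -> b != a ->
  divides (cr a) (cr b * p) -> divides (cr a) p.
Proof.
move=> aP bP ba; apply: coroot_k_prime; rewrite ?(pos_root aP) ?(pos_root bP)//.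
by apply: contraTneq bP => ->; rewrite pos_opp_notin.
Qed.

Lemma coroot_k_prod_prime a (s : seq V) p : a \in pos P ->
  (forall b, b \in s -> b \in pos P /\ b != a) ->
  divides (cr a) (\prod_(b <- s) cr b * p) -> divides (cr a) p.
Proof.
move=> aP; elim: s p => [|b s IH] p sP; first by rewrite big_nil mul1r.
have [bP ba] : b \in pos P /\ b != a by apply: sP; rewrite mem_head.
rewrite big_cons -mulrA => /(coroot_k_pos_prime aP bP ba); apply: IH => c cs.
by apply: sP; rewrite inE cs orbT.
Qed.

Lemma coroot_k_prod_divides (s : seq V) p : uniq s -> {subset s <= pos P} ->
  (forall b, b \in s -> divides (cr b) p) -> divides (\prod_(b <- s) cr b) p.
Proof.
elim: s => [|b s IH] /=; first by move=> *; exists p; rewrite big_nil mul1r.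
move=> /andP[bs us] sP sd.
have bP : b \in pos P by apply: sP; rewrite mem_head.
have sP' c : c \in s -> c \in pos P /\ c != b.
  move=> cs; split; first by apply: sP; rewrite inE cs orbT.
  by apply: contraNneq bs => <-.
have [q qE] : divides (\prod_(b <- s) cr b) p.
  by apply: IH => // c cs; [have [] := sP' c cs|apply: sd; rewrite inE cs orbT].
have : divides (cr b) (\prod_(b <- s) cr b * q) by rewrite -qE; apply: sd; rewrite mem_head.
move=> /(coroot_k_prod_prime bP sP')[r rE]; exists r.
by rewrite big_cons qE rE mulrCA mulrA.
Qed.

Lemma coroot_k_prod_neq0 (s : seq V) : {subset s <= pos P} -> \prod_(b <- s) cr b != 0.
Proof.
move=> sP; rewrite prodf_seq_neq0; apply/allP => b bs /=.
by rewrite coroot_k_neq0// (pos_root (sP _ bs)).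
Qed.

Lemma coroot_k_homog a : cr a \is 1.-homog.
Proof.
rewrite /coroot_k /linear_form rpred_sum// => i _; apply: rpredZ.
by rewrite dhomogX /= mdeg1.
Qed.
End CorootPolynomials.

(** * Schubert classes *)

Section SchubertClasses.
Variables (R : realType) (V : vectType R) (Phi : root_system V).
Variables (P : positive_system Phi) (n : nat) (omega : n.-tuple 'Hom(V, R^o)).
Variable (k : fieldType).
Hypothesis omegaP : coweight_basis Phi omega.
Hypothesis char2 : 2%N \notin [pchar k].
Hypothesis gkmP : gkm P omega k.
Implicit Types (a b d : V) (v w : 'End(V)) (z : 'End(V) -> symalg n k).
Local Notation refl := (srefl Phi).
Local Notation cr := (coroot_k Phi omega k).
Local Notation weyl := (weyl Phi).
Local Notation wlen := (wlen P).
Local Notation Q := (undup (pos P)).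

(* Since s_(w a) w = w s_a, this is the congruence along the reflections acting
   from the left. *)
Definition weyl_gkm z : Prop := forall w a, weyl w -> a \in roots Phi ->
  divides (cr (w a)) (z w - z (w \o refl a)%VF).

Lemma weyl_comp_refl w a : weyl w -> a \in roots Phi -> weyl (w \o refl a)%VF.
Proof. by move=> wW aR; apply: weyl_comp wW (weyl_refl aR). Qed.

Lemma comp_reflK w a : a \in roots Phi -> ((w \o refl a) \o refl a)%VF = w.
Proof. by move=> aR; apply/lfunP => x; rewrite !lfE reflK. Qed.

Lemma refl_opp a : a \in roots Phi -> refl (- a) = refl a.
Proof. by move=> aR; apply/lfunP => x; rewrite !reflE pairNl// scaleNr scalerN opprK. Qed.

Lemma comp_refl_swap w a d : a \in roots Phi -> d \in roots Phi ->
  ((w \o refl d) \o refl a)%VF = ((w \o refl a) \o refl (refl a d))%VF.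
Proof.
move=> aR dR; apply/lfunP => x; rewrite !lfE; congr (w _).
by rewrite -[x in RHS](reflK aR) (weyl_conj _ (weyl_refl aR))// reflK.
Qed.

Lemma weyl_eq_opp w a b : weyl w -> w b = - w a -> b = - a.
Proof. by move=> wW; rewrite -linearN => /(weyl_inj wW). Qed.

(* The divided difference operator (z - z . s_a) / (w a)^v, for the action of W
   by right multiplication. *)
Lemma divided_difference a z : a \in roots Phi -> weyl_gkm z ->
  exists y, weyl_gkm y /\
    forall w, weyl w -> z w - z (w \o refl a)%VF = cr (w a) * y w.
Proof.
move=> aR zP.
have /choice[y yE] : forall w, exists q,
    weyl w -> z w - z (w \o refl a)%VF = cr (w a) * q.
  move=> w; have [wW|nW] := pselect (weyl w); last by exists 0.
  by have [q e] := zP w a wW aR; exists q.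
exists y; split=> // w d wW dR.
have waR : w a \in roots Phi by apply: weyl_root.
have wdR : w d \in roots Phi by apply: weyl_root.
have wdW := weyl_comp_refl wW dR; have waW := weyl_comp_refl wW aR.
(* For d = a or - a both values of y agree: numerator and denominator change sign together when w is
   replaced by w s_a. *)
have [da|dna] := pselect (d = a \/ d = - a).
  have -> : refl d = refl a by case: da => ->; rewrite ?refl_opp.
  have := yE _ waW; rewrite comp_reflK// lfE refl_self// linearN coroot_kN//.
  rewrite mulNr -opprB => /eqP; rewrite eqr_opp yE// => /eqP/(mulfI (coroot_k_neq0 omegaP char2 waR)).
  by move=> ->; rewrite subrr; apply: divides0.
have vaE : (w \o refl d)%VF a = refl (w d) (w a) by rewrite lfE weyl_conj.
have [m _ crE] := coroot_k_refl k omegaP waR wdR.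
have vaR : refl (w d) (w a) \in roots Phi by apply: refl_root.
(* For d different from a and - a, the coroots of w a and of s_(w d) w a are both prime to (w d)^v,
   so the congruence may be checked after multiplying by them. The denominators then disappear, and
   the two coroots differ by a multiple of (w d)^v. *)
apply: (coroot_k_prime omegaP char2 gkmP (b := refl (w d) (w a))) => //.
- apply/eqP => /(congr1 (refl (w d))); rewrite reflK// refl_self//.
  by move=> /(weyl_eq_opp wW) e; apply: dna; right; rewrite e opprK.
- apply/eqP => /(congr1 (refl (w d))); rewrite reflK// linearN /= refl_self// opprK.
  by move=> /(weyl_inj wW) e; apply: dna; left.
apply: (coroot_k_prime omegaP char2 gkmP (b := w a)) => //.
- by apply/eqP => /(weyl_inj wW) e; apply: dna; left.
- by apply/eqP => /(weyl_eq_opp wW) e; apply: dna; right; rewrite e opprK.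
have e1 := yE w wW; have := yE _ wdW; rewrite vaE comp_refl_swap//.
set v := (w \o refl d)%VF; set w' := (w \o refl a)%VF in e1 *; set v' := (w' \o _)%VF => e2.
have -> : cr (w a) * (cr (refl (w d) (w a)) * (y w - y v)) =
   cr (w a) * ((z w - z v) - (z w' - z v')) - cr (w d) * (m%:~R *: (z w - z w')).
  rewrite mulrBr mulrBr mulrCA -e1 -e2 crE -!mul_mpolyC; ring.
apply: dividesB; last by exists (m%:~R *: (z w - z w')).
apply: divides_mull; apply: dividesB; first exact: zP.
have := zP w' (refl a d) waW (refl_root aR dR).
by rewrite lfE reflK.
Qed.

Lemma weyl_gkmD z1 z2 : weyl_gkm z1 -> weyl_gkm z2 -> weyl_gkm (fun w => z1 w + z2 w).
Proof.
move=> h1 h2 w a wW aR; rewrite opprD addrACA.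
by apply: dividesD; [apply: h1|apply: h2].
Qed.

Lemma wlen_comp_refl w a : weyl w -> simple P a -> (wlen (w \o refl a)%VF <= (wlen w).+1)%N.
Proof.
move=> wW sa; have := wlen_simple (@pos_reduced _ _ _ _ _ _ _ omegaP gkmP) wW sa.
by case: (w a \in pos P) => /=; lia.
Qed.

(** The factors are the directions in which w has a neighbour of smaller [wlen], namely w s_d. *)
Definition inversion_product w : symalg n k := \prod_(d <- Q | w d \in pos P) cr (w d).

(** If w is not the identity, some simple a has w a negative; then w s_a has larger [wlen], and the
    divided difference by a of its class is the class of w. For v other than w with [wlen] at most
    that of w, both v and v s_a differ from w s_a and have [wlen] at most its own, whence the
    vanishing. On the diagonal, the entry at w s_a has the factor (- w a)^v, which the division
    removes. *)
Lemma schubert_class w : weyl w -> exists x, [/\ weyl_gkm x,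
  forall v, weyl v -> v <> w -> (wlen v <= wlen w)%N -> x v = 0
  & x w = inversion_product w].
Proof.
have red := @pos_reduced _ _ _ _ _ _ _ omegaP gkmP.
have [m] := ubnP (size Q - wlen w)%N; elim: m w => // m IH w lt_m wW.
have [/allP wP|/allPn[c]] := boolP (all (fun c => w c \in pos P) Q).
  have w1 : w = \1%VF by apply: (weyl_eq1 red wW) => a aP; apply: wP; rewrite mem_undup.
  (* The class of a point: p is divisible by every coroot, so p at the identity and 0 elsewhere
     satisfies all congruences. *)
  pose p : symalg n k := \prod_(d <- Q) cr d.
  have pd a : a \in roots Phi -> divides (cr a) p.
    have h b : b \in pos P -> divides (cr b) p.
      move=> bP; rewrite /p (perm_big _ (perm_to_rem (_ : b \in Q))) ?mem_undup//.
      by rewrite big_cons; exists (\prod_(d <- rem b Q) cr d).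
    move=> aR; have [/h//|/(notin_pos aR)/h] := boolP (a \in pos P).
    by rewrite coroot_kN// => /dividesNl; rewrite opprK.
  exists (fun v => if v == \1%VF then p else 0); split.
  - move=> v a vW aR; have vaR := weyl_root vW aR.
    by case: ifP => _; case: ifP => _; rewrite ?subrr ?subr0 ?sub0r;
      try (apply: dividesN); try exact: pd; apply: divides0.
  - by move=> v vW /eqP vw _; rewrite w1 in vw; rewrite (negPf vw).
  - rewrite w1 eqxx /inversion_product /p big_seq [RHS]big_seq_cond.
    by apply: eq_big => [d|d _]; rewrite lfE// mem_undup andbb.
rewrite mem_undup => cP wcP; have [a sa waP] := weyl_neg_simple wW cP wcP.
have aP := simple_pos sa; have aR := pos_root aP.
pose y := (w \o refl a)%VF; have yW : weyl y by apply: weyl_comp_refl.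
have ylen : wlen y = (wlen w).+1.
  by have := wlen_simple red wW sa; rewrite (negPf waP) /= addn0 addn1.
have lt_w : (wlen y <= size Q)%N by apply: count_size.
have [|x [xP x0 xy]] := IH y _ yW; first by lia.
have [e [eP eE]] := divided_difference aR xP; exists e.
have crn0 v : weyl v -> cr (v a) != 0.
  by move=> vW; rewrite (coroot_k_neq0 omegaP char2)// weyl_root.
split=> //.
- move=> v vW vw lt_v; apply: (mulfI (crn0 v vW)).
  rewrite mulr0 -eE// !x0 ?subrr//; first exact: weyl_comp_refl.
  + by move=> /(congr1 (fun u => (u \o refl a)%VF)); rewrite !comp_reflK.
  + by rewrite ylen; apply: leq_trans (wlen_comp_refl vW sa) _.
  + by move=> vE; move: lt_v; rewrite vE ylen ltnn.
  + by rewrite ylen; apply: leqW.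
- apply: (mulfI (crn0 w wW)); rewrite -eE// (x0 w)//; last 2 first.
  + by move=> wE; have := ylen; rewrite -wE; lia.
  + by rewrite ylen.
  rewrite sub0r -/y xy /inversion_product.
  have aQ : a \in Q by rewrite mem_undup.
  rewrite !(perm_big _ (perm_to_rem aQ)) !big_cons /= (negPf waP).
  have yaE : y a = - w a by rewrite lfE refl_self// linearN.
  rewrite yaE notin_pos ?weyl_root// coroot_kN ?weyl_root// mulNr opprK; congr (_ * _).
  rewrite -[RHS](perm_big _ (perm_refl_simple red sa)) big_map.
  by apply: eq_big => [d|d _]; rewrite lfE.
Qed.

(* The classes of [schubert_class] are triangular for [wlen], and the congruences
   at w make a tuple vanishing below w divisible by the diagonal entry. *)
Lemma weyl_gkm_extend (J : 'End(V) -> Prop) z :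
  (forall w d, weyl w -> d \in pos P -> w d \in pos P -> J w -> J (w \o refl d)%VF) ->
  (forall w d, weyl w -> d \in pos P -> w d \in pos P -> J w ->
     divides (cr (w d)) (z w - z (w \o refl d)%VF)) ->
  exists z', weyl_gkm z' /\ forall w, weyl w -> J w -> z' w = z w.
Proof.
move=> Jlow zJ.
suff [z' [z'P zE]] : exists z', weyl_gkm z' /\
    forall w, weyl w -> J w -> (wlen w < (size Q).+1)%N -> z' w = z w.
  by exists z'; split=> // w wW Jw; apply: zE => //; rewrite ltnS count_size.
elim: (size Q).+1 => [|m [z' [z'P zE]]].
  by exists (fun=> 0); split=> // w a _ _; rewrite subrr; apply: divides0.
have [ws [uws wsE]] := weyl_finite Phi.
have /choice[xi xiP] : forall w, exists x, weyl w -> [/\ weyl_gkm x,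
  forall v, weyl v -> v <> w -> (wlen v <= wlen w)%N -> x v = 0 & x w = inversion_product w].
  move=> w; have [wW|nW] := pselect (weyl w); last by exists (fun=> 0).
  by have [x xP] := schubert_class wW; exists x.
have /choice[c cP] : forall w, exists c, weyl w -> J w -> wlen w = m ->
    z w - z' w = inversion_product w * c.
  move=> w; have [[wW [Jw wm]]|h] := pselect (weyl w /\ J w /\ wlen w = m); last first.
    by exists 0 => wW Jw wm; exfalso; apply: h.
  suff [c e] : divides (inversion_product w) (z w - z' w) by exists c.
  rewrite /inversion_product -big_filter -(big_map w predT cr).
  apply: (coroot_k_prod_divides omegaP char2 gkmP).
  - by rewrite (map_inj_uniq (weyl_inj wW)) filter_uniq ?undup_uniq.
  - by move=> _ /mapP[d + ->]; rewrite mem_filter => /andP[].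
  move=> _ /mapP[d + ->]; rewrite mem_filter mem_undup => /andP[wdP dP].
  (* The element w s_d lies in J and has smaller [wlen], so z and z' already agree there. *)
  have -> : z w - z' w = (z w - z (w \o refl d)%VF) - (z' w - z' (w \o refl d)%VF).
    rewrite (zE (w \o refl d)%VF); first by ring.
    - exact: weyl_comp_refl (pos_root dP).
    - exact: Jlow.
    - by rewrite -wm wlen_refl.
  by apply: dividesB; [apply: zJ|apply: z'P => //; apply: pos_root dP].
pose s := [seq w <- ws | `[< J w /\ wlen w = m >]].
have sP w : w \in s -> [/\ weyl w, J w & wlen w = m].
  by rewrite mem_filter => /andP[/asboolP[? ?] /wsE].
exists (fun v => z' v + \sum_(w <- s) c w * xi w v); split.
  apply: weyl_gkmD => //; move=> v a vW aR.
  rewrite !big_seq -sumrB; elim/big_ind: _ => [|p q|w /sP[wW _ _]]; first exact: divides0.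
    exact: dividesD.
  by have [xP _ _] := xiP w wW; rewrite -mulrBr; apply: divides_mull; apply: xP.
move=> v vW Jv; rewrite ltnS => le_v.
have vanish w : w \in s -> w != v -> c w * xi w v = 0.
  move=> /sP[wW Jw wm] wv; have [_ x0 _] := xiP w wW.
  by rewrite x0 ?mulr0 ?wm//; apply/eqP; rewrite eq_sym.
have [lt_v|ge_v] := ltnP (wlen v) m.
  rewrite big_seq big1 ?addr0 ?zE// => w ws'; apply: vanish => //.
  by apply: contraTneq lt_v => <-; have [_ _ ->] := sP w ws'; rewrite ltnn.
have vm : wlen v = m by apply/eqP; rewrite eqn_leq le_v.
have vs : v \in s by rewrite mem_filter; apply/andP; split; [apply/asboolP|apply/wsE].
rewrite (bigD1_seq v)//= ?filter_uniq// big_seq_cond big1 ?addr0; last first.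
  by move=> w /andP[]; apply: vanish.
have [_ _ ->] := xiP v vW.
by rewrite mulrC -cP// addrC subrK.
Qed.
End SchubertClasses.

(** * Alcoves *)

Section VectorTopology.
Variables (R : realType) (V : vectType R).
Local Notation W := (top_space V).

Lemma open_pos_half (f : 'Hom(V, R^o)) (c : R) : open ([set x | c < f x] : set W).
Proof.
have fE (v : 'rV[R]_(dim V)) : f (r2v v) = \sum_i v 0 i * (f (r2v (delta_mx 0 i)) : R) :> R.
  rewrite {1}[v]row_sum_delta !linear_sum /=; apply: eq_bigr => i _.
  by rewrite !linearZ.
exists [set v : 'rV[R]_(dim V) | c < f (r2v v)]; last first.
  by apply/seteqP; split=> x /=; rewrite v2rK.
rewrite openE => v /= cv; pose S := \sum_i `|f (r2v (delta_mx 0 i)) : R|.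
have S0 : 0 <= S by apply: sumr_ge0.
(* Changing each coordinate by less than d lowers f by at most d S, which is less than f(v) - c; the
   1 keeps the denominator positive. *)
pose d := ((f (r2v v) : R) - c) / (1 + S).
have d0 : 0 < d by rewrite divr_gt0 ?subr_gt0// ltr_wpDr.
exists (fun i j => ball (v i j) d); first by move=> i j; apply: nbhsx_ballx.
move=> w /= vw.
have h : (f (r2v v) : R) - f (r2v w) <= d * S.
  rewrite !fE -sumrB mulr_sumr; apply: ler_sum => i _; rewrite -mulrBl.
  have /ltW h : `|v 0 i - w 0 i| < d := vw 0 i.
  by apply: le_trans (ler_norm _) _; rewrite normrM ler_wpM2r.
have : d * (1 + S) = (f (r2v v) : R) - c by rewrite divfK// gt_eqF// ltr_wpDr.
by move: d0; nra.
Qed.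

Lemma closure_half (f : 'Hom(V, R^o)) (c : R) (A : set V) x :
  @closure W A x -> (forall y, A y -> c <= f y) -> c <= f x.
Proof.
move=> clx Ac; rewrite leNgt; apply/negP => fx.
have := clx [set y | - c < (- f)%R y]; case.
  apply: open_nbhs_nbhs; split; first exact: open_pos_half.
  by rewrite /= lfun_simp ltrN2.
by move=> y [/Ac h] /=; rewrite lfun_simp ltrN2 ltNge h.
Qed.

Definition line (x y : V) (t : R) : V := x + t *: (y - x).

Lemma line_nbhs (x y : V) (t : R) (U : set V) :
  @nbhs _ W (line x y t : W) U -> \forall s \near t, U (line x y s).
Proof.
rewrite nbhsE => -[_ [[U' oU' <-] /= Ut] UU]; move: oU' Ut; rewrite openE => /[apply].
move=> -[B hB BU].
have : \forall s \near t, forall i j, B i j (v2r (line x y s) i j).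
  apply: (@filter_forall _ _ (fun i s => forall j, B i j (v2r (line x y s) i j)) (nbhs t)) => i.
  apply: (@filter_forall _ _ (fun j s => B i j (v2r (line x y s) i j)) (nbhs t)) => j.
  have /nbhs_ballP[e e0 he] := hB i j; have b0 : 0 < 1 + `|v2r (y - x) i j| by rewrite ltr_wpDr.
  apply/nbhs_ballP; exists (e / (1 + `|v2r (y - x) i j|)); first by rewrite /= divr_gt0.
  move=> s ts; apply: he.
  have h : `|t - s| < e / (1 + `|v2r (y - x) i j|) := ts.
  suff : `|v2r (line x y t) i j - v2r (line x y s) i j| < e by [].
  rewrite /line [v2r (x + t *: _)]linearD [v2r (x + s *: _)]linearD !linearZ /= !mxE.
  rewrite opprD addrACA subrr add0r -mulrBl normrM.
  apply: le_lt_trans (_ : `|t - s| * (1 + `|v2r (y - x) i j|) < e).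
    by rewrite ler_wpM2l// lerDr.
  by rewrite -ltr_pdivlMr.
apply: filterS => s h; apply: UU; exact: BU.
Qed.

Lemma closure_line (x y : V) (A : set V) :
  (forall t, 0 < t -> t <= 1 -> A (line x y t)) -> @closure W A x.
Proof.
move=> hA B nB; have x0 : x = line x y 0 by rewrite /line scale0r addr0.
have /nbhs_ballP[e /= e0 he] : \forall s \near (0 : R), B (line x y s).
  by apply: line_nbhs; rewrite -x0.
have t0 : 0 < Num.min (e / 2) 1 by rewrite lt_min ltr01 divr_gt0.
exists (line x y (Num.min (e / 2) 1)); split; first by apply: hA => //; rewrite ge_min lexx orbT.
apply: he; suff : `|0 - Num.min (e / 2) 1| < e by [].
rewrite sub0r normrN gtr0_norm// gt_min; apply/orP; left.
by rewrite ltr_pdivrMr// ltr_pMr// ltr1n.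
Qed.

Lemma convex_connected (x : V) (A : set V) : A x ->
  (forall y, A y -> forall t, 0 <= t -> t <= 1 -> A (line x y t)) -> @connected W A.
Proof.
move=> Ax Aconv.
have -> : A = \bigcup_(y in A) [set line x y t | t in `[0, 1]].
  apply/seteqP; split=> [y Ay|z [y Ay [t /=]]].
    exists y => //; exists 1; first by rewrite /= in_itv /= ler01 lexx.
    by rewrite /line scale1r subrKC.
  by rewrite in_itv /= => /andP[t0 t1] <-; apply: Aconv.
apply: (@bigcup_connected W).
  exists x => y Ay; exists 0; first by rewrite /= in_itv /= lexx ler01.
  by rewrite /line scale0r addr0.
move=> y _; apply: (@connected_continuous_connected R W).
  exact: normed_module.segment_connected.
by apply: continuous_subspaceT => t U; apply: line_nbhs.
Qed.
End VectorTopology.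

(** * Alcoves as cells cut out by inequalities *)

Section AlcoveCells.
Variables (R : realType) (V : vectType R) (Phi : root_system V).
Variable P : positive_system Phi.
Implicit Types (a b l x y z : V) (A B C : alcove P) (m : int).
Local Notation pair := (cpair Phi).
Local Notation refl := (srefl Phi).
Local Notation W := (top_space V).

Definition regular x : Prop := forall a m, a \in roots Phi -> pair a x != m%:~R.

Lemma regularP x : regular_points P x <-> regular x.
Proof.
split=> [h a m aR|h [a [m [aP e]]]]; last first.
  by move: (h a m (pos_root aP)); rewrite [pair a x]e eqxx.
apply/eqP => e; apply: h; have [aP|/(notin_pos aR) aP] := boolP (a \in pos P).
  by exists a, m.
exists (- a), (- m); split=> //; rewrite /hyperplane /= -[LHS]/(pair _ _) pairNl// e.
by rewrite rmorphN.
Qed.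

(** Quantifying over a and - a covers both strict inequalities; between regular points this says
    that no hyperplane separates them. *)
Definition same_cell x y : Prop :=
  forall a m, a \in roots Phi -> (m%:~R < pair a x) = (m%:~R < pair a y).

Lemma same_cell_sym x y : same_cell x y -> same_cell y x.
Proof. by move=> h a m aR; rewrite h. Qed.
Lemma same_cell_trans x y z : same_cell x y -> same_cell y z -> same_cell x z.
Proof. by move=> h h' a m aR; rewrite h// h'. Qed.

Lemma same_cell_lt x y a m : same_cell x y -> a \in roots Phi ->
  (pair a x < m%:~R) = (pair a y < m%:~R).
Proof.
move=> xy aR; have := xy (- a) (- m) (oppr_root aR).
by rewrite !pairNl// rmorphN !ltrN2.
Qed.

Lemma same_cell_regular x y : regular x -> same_cell x y -> regular y.
Proof.
move=> rx xy a m aR; rewrite neq_lt -(same_cell_lt m xy aR) -xy// -neq_lt.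
exact: rx.
Qed.

Lemma pair_line a x y t : pair a (line x y t) = pair a x + t * (pair a y - pair a x).
Proof. by rewrite /line pairD pairZ pairB. Qed.

(** Each half-space is open and closed within the regular points, so a connected set of them crosses
    no hyperplane. Conversely the cell contains the segments from x to its points, hence is
    connected. *)
Lemma component_cell x : regular x ->
  @connected_component W (regular_points P) x = [set y | same_cell x y].
Proof.
move=> rx; apply/seteqP; split=> [y [B [/= Bx Breg conB] By] a m aR|].
  have BE : B `&` [set z | m%:~R < pair a z] = B `&` ~` [set z | (- m)%:~R < pair (- a) z].
    apply/seteqP; split=> z [Bz /= h]; split=> //=.
      by rewrite pairNl// rmorphN ltrN2; apply/negP; rewrite -leNgt ltW.
    move/negP: h; rewrite pairNl// rmorphN ltrN2 -leNgt le_eqVlt => /orP[/eqP e|//].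
    have /regularP/(_ a m aR) := Breg _ Bz.
    by rewrite -e eqxx.
  have oa c j : open ([set z | j%:~R < pair c z] : set W) by apply: open_pos_half.
  have dich z : B z -> m%:~R < pair a z -> B `<=` [set z | m%:~R < pair a z].
    move=> Bz az; have := conB (B `&` [set z | m%:~R < pair a z]).
    move=> /(_ (ex_intro _ z (conj Bz az))) h.
    have <- : B `&` [set z | m%:~R < pair a z] = B.
      apply: h; first by exists [set z | m%:~R < pair a z].
      rewrite BE; exists (~` [set z | (- m)%:~R < pair (- a) z]) => //.
      exact: (open_closedC (oa (- a) (- m))).
    by move=> u [].
  by apply/idP/idP => h; [apply: (dich x)|apply: (dich y)].
apply: (@connected_component_max W) => //=.
  by move=> y xy; apply/regularP; apply: same_cell_regular xy.
apply: (convex_connected (x := x)) => // y /= xy t t0 t1 a m aR.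
rewrite pair_line; have := xy a m aR.
have t1' : 0 <= 1 - t by rewrite subr_ge0.
have [h /esym h'|h /esym/negbT] := ltP (m%:~R) (pair a x); last first.
  rewrite -leNgt => h'; apply/esym/negbTE; rewrite -leNgt.
  have : 0 <= t * (m%:~R - pair a y) by rewrite mulr_ge0 ?subr_ge0.
  have : 0 <= (1 - t) * (m%:~R - pair a x) by rewrite mulr_ge0 ?subr_ge0.
  by nra.
apply/esym; have [->|tn0] := eqVneq t 0; first by rewrite mul0r addr0.
have : 0 < t * (pair a y - m%:~R) by rewrite mulr_gt0 ?subr_gt0// lt_def tn0.
have : 0 <= (1 - t) * (pair a x - m%:~R) by rewrite mulr_ge0 ?subr_ge0// ltW.
by nra.
Qed.

Lemma cell_alcove x : regular x -> exists A, alcove_set A x.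
Proof.
move=> rx; have h : is_alcove P [set y | same_cell x y].
  by exists x; [apply/regularP|rewrite component_cell].
by exists (Alcove h).
Qed.

Lemma alcove_pt A : exists x, alcove_set A x.
Proof.
have [x /regularP rx AE] := alcoveP A; exists x; rewrite AE component_cell//.
Qed.

Lemma alcoveE A x : alcove_set A x -> regular x /\ alcove_set A = [set y | same_cell x y].
Proof.
have [y /regularP ry ->] := alcoveP A; rewrite component_cell// => /= yx; split.
  exact: same_cell_regular yx.
apply/seteqP; split=> z /=; last exact: same_cell_trans.
by apply: same_cell_trans; apply: same_cell_sym.
Qed.

Lemma alcove_set_inj A B : alcove_set A = alcove_set B -> A = B.
Proof. by case: A B => [A hA] [B hB] /= e; subst B; congr Alcove; apply: Prop_irrelevance. Qed.

Lemma alcove_eq A B x : alcove_set A x -> alcove_set B x -> A = B.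
Proof. by move=> /alcoveE[_ AE] /alcoveE[_ BE]; apply: alcove_set_inj; rewrite AE BE. Qed.

Lemma areflectionE a m x : areflection Phi a m x = refl a x + m%:~R *: a.
Proof. by rewrite /areflection reflE -[coroot _ _ _]/(pair a x) scalerBl opprB addrA addrAC. Qed.

Lemma areflectionK a m : a \in roots Phi -> involutive (areflection Phi a m).
Proof.
move=> aR x; rewrite !areflectionE linearD /= reflK// linearZ /= refl_self//.
by rewrite scalerN addrNK.
Qed.

Lemma pair_areflection a b m x : a \in roots Phi -> b \in roots Phi ->
  exists2 j : int, forall x, pair b (areflection Phi a m x) = pair (refl a b) x + j%:~R &
    pair b a * m%:~R = j%:~R.
Proof.
move=> aR bR; have /intrP[j jE] := pair_int bR aR; exists (j * m); last by rewrite jE rmorphM.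
move=> y; rewrite areflectionE pairD pairZ jE -{1}[b](reflK aR) pair_refl ?refl_root//.
by rewrite mulrC rmorphM.
Qed.

Lemma same_cell_areflection a m x y : a \in roots Phi -> same_cell x y ->
  same_cell (areflection Phi a m x) (areflection Phi a m y).
Proof.
move=> aR xy b j bR; have [i iE _] := pair_areflection m x aR bR.
by rewrite !iE -!ltrBlDr -rmorphB xy// refl_root.
Qed.

Lemma regular_areflection a m x : a \in roots Phi -> regular x ->
  regular (areflection Phi a m x).
Proof.
move=> aR rx b j bR; have [i iE _] := pair_areflection m x aR bR.
by rewrite iE eq_sym -subr_eq -rmorphB eq_sym rx// refl_root.
Qed.

Lemma reflectsP a m A B x : a \in roots Phi -> alcove_set A x ->
  reflects a m A B <-> alcove_set B (areflection Phi a m x).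
Proof.
move=> aR Ax; split=> [->|Bx]; first by exists x.
have [_ AE] := alcoveE Ax; have [_ BE] := alcoveE Bx.
rewrite /reflects BE AE; apply/seteqP; split=> y /=.
  move=> h; exists (areflection Phi a m y); last exact: areflectionK.
  by rewrite -[x](areflectionK m aR); apply: same_cell_areflection.
by move=> [z xz <-]; apply: same_cell_areflection.
Qed.

Lemma weight_pair l a : weight_lattice Phi l -> a \in roots Phi ->
  exists m : int, pair a l = m%:~R.
Proof. by move=> lL aR; apply/intrP; apply: lL. Qed.

Lemma same_cell_translate l x y : weight_lattice Phi l -> same_cell x y ->
  same_cell (x + l) (y + l).
Proof.
move=> lL xy b j bR; have [i iE] := weight_pair lL bR.
by rewrite !pairD iE -!ltrBlDr -rmorphB xy.
Qed.

Lemma regular_translate l x : weight_lattice Phi l -> regular x -> regular (x + l).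
Proof.
move=> lL rx b j bR; have [i iE] := weight_pair lL bR.
by rewrite pairD iE eq_sym -subr_eq -rmorphB eq_sym rx.
Qed.

Lemma weightN l : weight_lattice Phi l -> weight_lattice Phi (- l).
Proof. by move=> lL a aR; rewrite linearN rpredN; apply: lL. Qed.

Lemma weightD l l' : weight_lattice Phi l -> weight_lattice Phi l' -> weight_lattice Phi (l + l').
Proof. by move=> lL lL' a aR; rewrite linearD rpredD//; [apply: lL|apply: lL']. Qed.

Lemma translatesP l A B x : weight_lattice Phi l -> alcove_set A x ->
  translates l A B <-> alcove_set B (x + l).
Proof.
move=> lL Ax; split=> [->|Bx]; first by exists x.
have [_ AE] := alcoveE Ax; have [_ BE] := alcoveE Bx.
rewrite /translates BE AE; apply/seteqP; split=> y /=.
  move=> h; exists (y - l); last by rewrite /translation subrK.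
  by rewrite -[x](addrK l); apply: same_cell_translate => //; apply: weightN.
by move=> [z xz <-]; apply: same_cell_translate.
Qed.

Lemma intr_addr1 (c : int) : (c + 1)%:~R = c%:~R + 1 :> R.
Proof. by rewrite rmorphD. Qed.

(** The pairings of l are integers. If some <x - l, a^v> were at least 1, a closed half-space
    containing A would miss l. Conversely the bounds for a and - a say that only hyperplanes through
    l can separate x from l, so the segment from l to x, without l, lies in A. *)
Lemma special_sectionP l A x : weight_lattice Phi l -> alcove_set A x ->
  special_section l A <-> forall a, a \in roots Phi -> pair a (x - l) < 1.
Proof.
move=> lL Ax; have [rx AE] := alcoveE Ax; split=> [cl a aR|h].
  have [c cE] := weight_pair lL aR.
  rewrite pairB ltrBlDr cE addrC -intr_addr1 ltNge; apply/negP => ge.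
  have : (c + 1)%:~R <= pair a l.
    apply: (closure_half cl) => y; rewrite AE => /= xy; apply: ltW.
    by rewrite -[coroot _ _ _]/(pair a y) -xy// lt_neqAle ge eq_sym rx.
  by rewrite cE ler_int; lia.
apply: (closure_line (y := x)) => t t0 t1; rewrite AE => /= a m aR.
have [c cE] := weight_pair lL aR.
have h1 := h a aR; have := h _ (oppr_root aR); rewrite pairNl// => h2.
have hn : pair a x != c%:~R by apply: rx.
rewrite pair_line; rewrite pairB cE in h1 h2; rewrite cE.
have [lt_mc|ge_mc] := ltP m c.
  have {}lt_mc : m%:~R + 1 <= c%:~R :> R.
    by rewrite -intr_addr1 ler_int; lia.
  have -> : m%:~R < pair a x by lra.
  by apply/esym; nra.
have [->|ne] := eqVneq m c.
  rewrite ltrDl pmulr_rgt0// subr_gt0.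
  by apply/idP/idP.
have {}ge_mc : c%:~R + 1 <= m%:~R :> R.
  by rewrite -intr_addr1 ler_int; lia.
by transitivity false; [|apply/esym]; apply/negbTE; rewrite -leNgt; nra.
Qed.
End AlcoveCells.

(** * The root lattice *)

Section RootLattice.
Variables (R : realType) (V : vectType R) (Phi : root_system V).
Implicit Types (a b l : V) (s : seq V).
Local Notation pair := (cpair Phi).
Local Notation refl := (srefl Phi).

Lemma root_latticeP l : root_lattice Phi l <->
  exists2 s, {subset s <= roots Phi} & l = \sum_(a <- s) a.
Proof.
split=> [[z ->]|[s sR ->]].
  elim/big_rec: _ => [|i x _ [s sR ->]]; first by exists [::] => //; rewrite big_nil.
  have iR : (in_tuple (roots Phi))`_i \in roots Phi by rewrite mem_nth.
  case: (z i) => m.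
    exists (nseq m (in_tuple (roots Phi))`_i ++ s).
      by move=> b; rewrite mem_cat => /orP[/nseqP[->]//|/sR].
    by rewrite big_cat big_nseq iter_addr_0.
  exists (nseq m.+1 (- (in_tuple (roots Phi))`_i) ++ s).
    by move=> b; rewrite mem_cat => /orP[/nseqP[->]|/sR]//; rewrite oppr_root.
  by rewrite big_cat big_nseq iter_addr_0 NegzE mulrNz -pmulrn mulNrn.
elim: s sR => [|a s IH] sR.
  by rewrite big_nil; exists [ffun=> 0]; rewrite big1// => i _; rewrite ffunE mulr0z.
have [|z zE] := IH; first by move=> b bs; apply: sR; rewrite inE bs orbT.
have aR : a \in roots Phi by apply: sR; rewrite mem_head.
have ia : (index a (roots Phi) < size (roots Phi))%N by rewrite index_mem.
exists [ffun i => z i + (i == Ordinal ia)%:Z]; rewrite big_cons zE.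
under [RHS]eq_bigr do rewrite ffunE mulrzDr.
rewrite big_split /= addrC; congr (_ + _).
rewrite (bigD1 (Ordinal ia))//= big1 ?addr0 => [|i /negPf ne].
  by rewrite eqxx nth_index.
by rewrite ne mulr0z.
Qed.

Lemma root_latticeD l l' : root_lattice Phi l -> root_lattice Phi l' -> root_lattice Phi (l + l').
Proof.
move=> /root_latticeP[s sR ->] /root_latticeP[t tR ->]; apply/root_latticeP.
exists (s ++ t); last by rewrite big_cat.
by move=> b; rewrite mem_cat => /orP[/sR|/tR].
Qed.

Lemma root_latticeN l : root_lattice Phi l -> root_lattice Phi (- l).
Proof.
move=> /root_latticeP[s sR ->]; apply/root_latticeP; exists (map -%R s).
  by move=> _ /mapP[b /sR bR ->]; apply: oppr_root.
by rewrite big_map sumrN.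
Qed.

Lemma root_lattice0 : root_lattice Phi 0.
Proof. by apply/root_latticeP; exists [::] => //; rewrite big_nil. Qed.

Lemma root_lattice_root a : a \in roots Phi -> root_lattice Phi a.
Proof.
by move=> aR; apply/root_latticeP; exists [:: a]; rewrite ?big_seq1// => b; rewrite inE => /eqP->.
Qed.

Lemma root_latticeMz l (m : int) : root_lattice Phi l -> root_lattice Phi (m%:~R *: l).
Proof.
move=> lL; have h j : root_lattice Phi (j%:R *: l).
  elim: j => [|j IH]; first by rewrite scale0r; apply: root_lattice0.
  by rewrite mulrS scalerDl scale1r; apply: root_latticeD.
by case: m => m; [exact: h|rewrite NegzE rmorphN scaleNr; apply: root_latticeN; apply: h].
Qed.

Lemma root_lattice_weight l : root_lattice Phi l -> weight_lattice Phi l.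
Proof.
move=> /root_latticeP[s sR ->] a aR; rewrite linear_sum big_seq rpred_sum// => b /sR bR.
exact: coroot_int.
Qed.

(* A minuscule weight in the root lattice vanishes: write it as a shortest sum
   of roots; some summand pairs to 1 with it, and reflecting removes it. *)
Lemma minuscule_root_lattice l : root_lattice Phi l ->
  (forall a, a \in roots Phi -> pair a l <= 1) -> l = 0.
Proof.
move=> /root_latticeP[s sR ->]; have [m] := ubnP (size s).
elim: m s sR => // m IH s sR lt_s l1; set x := \sum_(a <- s) a in l1 *.
have [//|x0] := eqVneq x 0.
have [b bs bx] : exists2 b, b \in s & 0 < rform Phi b x.
  apply: contrapT => h; have := form_gt0 Phi x0; rewrite {1}/x formC form_sumr ltNge => /negP; apply.
  rewrite big_seq -oppr_ge0 -sumrN sumr_ge0// => c cs; rewrite oppr_ge0 leNgt.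
  by apply/negP => cx; apply: h; exists c; rewrite // formC.
have bR := sR _ bs; have /intrP[i iE] : pair b x \is a Num.int.
  by apply: (root_lattice_weight _ bR); apply/root_latticeP; exists s.
have bx1 : pair b x = 1.
  have := l1 b bR; move: bx; rewrite -pair_gt0// iE ltr0z -[X in _ <= X]/(1%:~R) ler_int => h1 h2.
  by have -> : i = 1 by lia.
have rx : refl b x = \sum_(a <- rem b s) a.
  by rewrite reflE bx1 scale1r /x (perm_big _ (perm_to_rem bs)) big_cons addrAC subrr add0r.
have := IH (rem b s); rewrite -rx => h; rewrite -[x](reflK bR) h ?linear0//.
- by move=> a /mem_rem/sR.
- by rewrite size_rem//; case: (s) bs lt_s.
- by move=> a aR; rewrite -[a](reflK bR) pair_refl ?refl_root//; apply: l1; apply: refl_root.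
Qed.
End RootLattice.

(** * Alcoves around a weight *)

Section SpecialAlcoves.
Variables (R : realType) (V : vectType R) (Phi : root_system V).
Variable P : positive_system Phi.
Implicit Types (a b l x y z : V) (A B C : alcove P) (m : int) (v w : 'End(V)) (s : seq V).
Local Notation pair := (cpair Phi).
Local Notation refl := (srefl Phi).
Local Notation weyl := (weyl Phi).

(** The two bounds make every pairing of l' with a coroot an integer less than 2, so l' is
    minuscule. *)
Lemma special_translate_eq0 l l' A : weight_lattice Phi l -> root_lattice Phi l' ->
  special_section l A -> special_section (l + l') A -> l' = 0.
Proof.
move=> lL lR' Al Al'; have [x Ax] := alcove_pt A; have lL' := root_lattice_weight lR'.
move: Al => /(special_sectionP lL Ax) h; move: Al' => /(special_sectionP (weightD lL lL') Ax) h'.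
apply: (minuscule_root_lattice lR') => a aR; have [i iE] := weight_pair lL' aR.
have := h a aR; have := h' _ (oppr_root aR); rewrite pairNl// !pairB !pairD iE => h1 h2.
suff : (i < 2)%R by rewrite lerz1; lia.
by rewrite -(ltr_int R) -[2%:~R]/(2%:R); lra.
Qed.

Lemma areflection_weight l a m i : pair a l = i%:~R ->
  areflection Phi a m l = l + (m - i)%:~R *: a.
Proof. by move=> iE; rewrite areflectionE reflE iE rmorphB scalerBl addrA addrAC. Qed.

Lemma special_areflection l a m A x : weight_lattice Phi l -> a \in roots Phi ->
  alcove_set A x -> special_section l A ->
  forall B, alcove_set B (areflection Phi a m x) -> special_section (areflection Phi a m l) B.
Proof.
move=> lL aR Ax /(special_sectionP lL Ax) h B Bx.
have [i iE] := weight_pair lL aR.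
have sL : weight_lattice Phi (areflection Phi a m l).
  rewrite (areflection_weight m iE).
  by apply: weightD => //; apply: root_lattice_weight; apply: root_latticeMz; apply: root_lattice_root.
apply/(special_sectionP sL Bx) => b bR.
rewrite !areflectionE opprD addrACA subrr addr0 -linearB -[b](reflK aR) pair_refl ?refl_root//.
by apply: h; apply: refl_root.
Qed.

(** B has both l and s_(a,m) l in its closure; they differ by a multiple of a, hence coincide. *)
Lemma reflects_special l a m A B : weight_lattice Phi l -> a \in roots Phi ->
  special_section l A -> special_section l B -> reflects a m A B -> pair a l = m%:~R.
Proof.
move=> lL aR Al Bl; have [x Ax] := alcove_pt A => /(reflectsP _ _ aR Ax) Bx.
have Bl' := special_areflection lL aR Ax Al Bx.
have [i iE] := weight_pair lL aR.
move: Bl'; rewrite (areflection_weight m iE) => Bl'.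
have := special_translate_eq0 lL (root_latticeMz _ (root_lattice_root aR)) Bl Bl'.
move=> /eqP; rewrite scaler_eq0 (negPf (root_n0 aR)) orbF intr_eq0 subr_eq0.
by move=> /eqP ->.
Qed.

(* [rho], scaled into the fundamental alcove at the origin. *)
Definition small_rho : V := (1 + \sum_(a <- undup (pos P)) pair a (rho P))^-1 *: rho P.
Local Notation rho0 := small_rho.

Lemma small_rho_bound a : a \in pos P -> 0 < pair a rho0 < 1.
Proof.
move=> aP; rewrite pairZ; have h : forall b, b \in pos P -> 0 < pair b (rho P) by apply: pair_rho.
have aQ : a \in undup (pos P) by rewrite mem_undup.
have S0 : 0 <= \sum_(b <- rem a (undup (pos P))) pair b (rho P).
  by rewrite big_seq sumr_ge0// => b /mem_rem; rewrite mem_undup => /h/ltW.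
rewrite (perm_big _ (perm_to_rem aQ)) big_cons; have ha := h _ aP.
set S := \sum_(b <- _) _ in S0 *; have S1 : 0 < 1 + (pair a (rho P) + S) by lra.
by rewrite mulr_gt0 ?invr_gt0//= mulrC ltr_pdivrMr// mul1r; lra.
Qed.

Lemma pos_small_rho a : a \in roots Phi -> (a \in pos P) = (0 < pair a rho0).
Proof.
move=> aR; apply/idP/idP; first by move=> /small_rho_bound/andP[].
apply: contraTT => /(notin_pos aR)/small_rho_bound; rewrite pairNl// => /andP[h _].
by rewrite -leNgt; lra.
Qed.

Lemma weyl_root_inv w a : weyl w -> a \in roots Phi ->
  exists2 b, b \in roots Phi & a = w b.
Proof.
by move=> wW aR; have [v [vW wK vK]] := weyl_inv wW; exists (v a); rewrite ?vK ?weyl_root.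
Qed.

Lemma weyl_rho_bound w a : weyl w -> a \in roots Phi ->
  `|pair a (w rho0)| < 1 /\ pair a (w rho0) != 0.
Proof.
move=> wW aR; have [b bR ->] := weyl_root_inv wW aR; rewrite pair_weyl//.
have [/small_rho_bound/andP[h h']|] := boolP (b \in pos P).
  by rewrite gtr0_norm// gt_eqF.
move=> /(notin_pos bR)/small_rho_bound/andP[]; rewrite pairNl// => h h'.
by rewrite ltr0_norm ?lt_eqF// -oppr_gt0.
Qed.

Section AtWeight.
Variable l : V.
Hypothesis lL : weight_lattice Phi l.

Lemma weyl_rho_regular w : weyl w -> regular Phi (l + w rho0).
Proof.
move=> wW a m aR; have [i iE] := weight_pair lL aR; have [h1 h2] := weyl_rho_bound wW aR.
rewrite pairD iE; apply/eqP => e.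
have e' : pair a (w rho0) = (m - i)%:~R by rewrite rmorphB /= -e addrAC subrr add0r.
move: h1 h2; rewrite e' -intr_norm intr_eq0 ltrz1; lia.
Qed.

Lemma weyl_alcove_ex w : exists A, weyl w -> alcove_set A (l + w rho0).
Proof.
have [A0 _] := cell_alcove P (weyl_rho_regular (weyl1 Phi)).
have [wW|nW] := pselect (weyl w); last by exists A0.
by have [A Ax] := cell_alcove P (weyl_rho_regular wW); exists A.
Qed.

(** The translate by l of the image under w of the dominant alcove at the origin; an arbitrary
    alcove if w is not in the Weyl group. *)
Definition weyl_alcove w : alcove P := projT1 (cid (weyl_alcove_ex w)).

Lemma weyl_alcove_pt w : weyl w -> alcove_set (weyl_alcove w) (l + w rho0).
Proof. by rewrite /weyl_alcove; case: cid. Qed.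

Lemma weyl_alcove_special w : weyl w -> special_section l (weyl_alcove w).
Proof.
move=> wW; apply/(special_sectionP lL (weyl_alcove_pt wW)) => a aR.
rewrite addrAC subrr add0r; have [+ _] := weyl_rho_bound wW aR.
by rewrite ltr_norml => /andP[].
Qed.

Lemma weyl_alcove_refl w a : weyl w -> a \in roots Phi -> forall m, pair a l = m%:~R ->
  reflects a m (weyl_alcove w) (weyl_alcove (refl a \o w)%VF).
Proof.
move=> wW aR m mE; apply/(reflectsP _ _ aR (weyl_alcove_pt wW)).
have := weyl_alcove_pt (weyl_comp (weyl_refl aR) wW).
rewrite areflectionE linearD /= lfE [refl a l]reflE mE.
by rewrite addrAC subrK.
Qed.
End AtWeight.
End SpecialAlcoves.

(** * The special section and the generic Bruhat order *)

Section SpecialSections.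
Variables (R : realType) (V : vectType R) (Phi : root_system V).
Variable P : positive_system Phi.
Hypothesis reduced : forall a b m, a \in pos P -> b \in pos P -> b = a *+ m -> b = a.
Implicit Types (a b x y z : V) (A B C : alcove P) (m : int) (v w : 'End(V)) (s : seq V).
Local Notation pair := (cpair Phi).
Local Notation refl := (srefl Phi).
Local Notation weyl := (weyl Phi).
Local Notation rho0 := (small_rho P).

Section AtWeight.
Variable l : V.
Hypothesis lL : weight_lattice Phi l.
Local Notation walc := (weyl_alcove P lL).

(** Every root has the same sign at v [rho0] and at w [rho0], so w^-1 v preserves the positive roots
    and [weyl_eq1] applies. *)
Lemma weyl_alcove_inj v w : weyl v -> weyl w -> walc v = walc w -> v = w.
Proof.
move=> vW wW e; have [u [uW wK uK]] := weyl_inv wW.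
have [_ AE] := alcoveE (weyl_alcove_pt P lL vW).
have : alcove_set (walc v) (l + w rho0) by rewrite e; apply: weyl_alcove_pt.
rewrite AE => /= vw.
have sg a : a \in roots Phi -> (0 < pair a (v rho0)) = (0 < pair a (w rho0)).
  move=> aR; have [i iE] := weight_pair lL aR.
  by have := vw a i aR; rewrite !pairD iE !ltrDl.
have : (u \o v)%VF = \1%VF.
  apply: (weyl_eq1 reduced (weyl_comp uW vW)) => a aP; have aR := pos_root aP.
  rewrite lfE pos_small_rho ?weyl_root//.
  rewrite -(pair_weyl _ wW) ?weyl_root// uK -sg ?weyl_root// pair_weyl//.
  by rewrite -pos_small_rho.
move=> e1; apply/lfunP => x; rewrite -[v x]uK.
by have := congr1 (fun f : 'End(V) => f x) e1; rewrite !lfE => ->.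
Qed.

Lemma seq_argmax (T : eqType) (f : T -> R) (r : seq T) t : t \in r ->
  exists2 t0, t0 \in r & forall t', t' \in r -> f t' <= f t0.
Proof.
elim: r t => // t1 r IH t _; case: r IH => [_|t2 r IH].
  by exists t1; [exact: mem_head|move=> t'; rewrite inE => /eqP->].
have [t0 t0r t0P] := IH t2 (mem_head _ _).
have [le01|/ltW le10] := leP (f t0) (f t1).
  exists t1; first exact: mem_head.
  by move=> t'; rewrite inE => /orP[/eqP->//|/t0P h]; apply: le_trans le01.
exists t0; first by rewrite inE t0r orbT.
by move=> t'; rewrite inE => /orP[/eqP->|/t0P].
Qed.

(** Choose u in the Weyl group maximizing the height of u (x - l). By maximality u (x - l) is
    dominant, and w is the inverse of u. *)
Lemma weyl_alcove_surj A : special_section l A -> exists2 w, weyl w & A = walc w.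
Proof.
have [x Ax] := alcove_pt A => /(special_sectionP lL Ax) h; have [rx _] := alcoveE Ax.
have [ws [_ wsE]] := weyl_finite Phi.
have [u /wsE uW umax] := seq_argmax (fun w : 'End(V) => ht P (w (x - l))) ((wsE _).2 (weyl1 Phi)).
have upos b : b \in pos P -> 0 < pair b (u (x - l)).
  move=> bP; have bR := pos_root bP; rewrite lt_def; apply/andP; split.
    have [c cR ->] := weyl_root_inv uW bR; rewrite pair_weyl// pairB.
    have [i ->] := weight_pair lL cR; rewrite subr_eq0; exact: rx.
  have := umax _ ((wsE _).2 (weyl_comp (weyl_refl bR) uW)).
  rewrite lfE reflE !htE lerBlDr lerDl pmulr_lge0 ?ht_gt0//.
have [w [wW uK wK]] := weyl_inv uW; exists w => //.
have sg a : a \in roots Phi -> (0 < pair a (x - l)) = (0 < pair a (w rho0)).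
  move=> aR; rewrite -!(pair_weyl _ uW aR) wK; have uaR := weyl_root uW aR.
  rewrite -pos_small_rho//; have [/upos//|/(notin_pos uaR)/upos] := boolP (u a \in pos P).
  by rewrite pairNl// oppr_gt0 => /lt_gtF.
apply: (alcove_eq (x := l + w rho0)); last exact: weyl_alcove_pt.
have [_ ->] := alcoveE Ax; move=> a m aR /=.
have [i iE] := weight_pair lL aR; have := sg a aR; have [hr hr0] := weyl_rho_bound P wW aR.
have := h a aR; have := h _ (oppr_root aR); rewrite pairNl// pairB pairD iE => h1 h2 e.
have hx : pair a x != i%:~R by apply: rx.
move: hr; rewrite ltr_norml => /andP[hr1 hr2].
have [lt_mi|ge_mi] := ltP m i.
  have lt_mi' : m%:~R + 1 <= i%:~R :> R by rewrite -intr_addr1 ler_int; lia.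
  by transitivity true; [|apply/esym]; lra.
have [->|ne] := eqVneq m i; first by rewrite ltrDl -e subr_gt0.
have ge_mi' : i%:~R + 1 <= m%:~R :> R by rewrite -intr_addr1 ler_int; lia.
by transitivity false; [|apply/esym]; apply/negbTE; rewrite -leNgt; lra.
Qed.

Lemma special_section_finite : exists As : seq 'End(V), uniq As /\
  (forall w, w \in As -> weyl w) /\
  forall A, special_section l A <-> exists2 w, w \in As & A = walc w.
Proof.
have [ws [uws wsE]] := weyl_finite Phi; exists ws; split=> //; split=> [w /wsE//|A].
split=> [/weyl_alcove_surj[w wW ->]|[w /wsE wW ->]]; first by exists w => //; apply/wsE.
exact: weyl_alcove_special.
Qed.

Lemma bruhat_weyl_alcove w d : weyl w -> d \in pos P -> w d \in pos P ->
  bruhat (walc (w \o refl d)%VF) (walc w).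
Proof.
move=> wW dP wdP; have dR := pos_root dP; have wdR := pos_root wdP.
have uW := weyl_comp wW (weyl_refl dR); have [i iE] := weight_pair lL wdR.
apply: rt_step; exists (w d), i; split=> //.
  have [_ ->] := alcoveE (weyl_alcove_pt P lL uW) => y /= h.
  rewrite /neg_half /= -[coroot _ _ _]/(pair (w d) y) -(same_cell_lt _ h)// pairD iE lfE.
  rewrite pair_weyl// reflE pairB [pair d (_ *: d)]pairZ pairK//.
  by have /andP[h0 _] := small_rho_bound dP; lra.
have := weyl_alcove_refl P lL uW wdR iE; congr reflects; congr weyl_alcove.
by apply/lfunP => x; rewrite !lfE weyl_conj// reflK.
Qed.

Lemma special_bruhat_total A a m B : a \in pos P -> reflects a m A B ->
  bruhat A B \/ bruhat B A.
Proof.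
move=> aP; have aR := pos_root aP; have [x Ax] := alcove_pt A; have [rx AE] := alcoveE Ax.
move=> AB; have := AB => /(reflectsP m B aR Ax) Bx; have [_ BE] := alcoveE Bx.
have : pair a x != m%:~R by apply: rx.
rewrite neq_lt => /orP[lt_x|gt_x]; [left|right]; apply: rt_step; exists a, m; split=> //.
- by rewrite AE => y /= h; rewrite /neg_half /= -[coroot _ _ _]/(pair a y) -(same_cell_lt _ h).
- rewrite BE => y /= h; rewrite /neg_half /= -[coroot _ _ _]/(pair a y) -(same_cell_lt _ h)//.
  by rewrite areflectionE reflE pairD pairB !pairZ pairK//; lra.
- by apply/(reflectsP _ _ aR Bx); rewrite areflectionK.
Qed.

Lemma weyl_len_up w a : weyl w -> a \in pos P -> pair a (w rho0) < 0 ->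
  (wlen P w < wlen P (refl a \o w)%VF)%N.
Proof.
move=> wW aP aw; have aR := pos_root aP.
have [b bR bE] := weyl_root_inv wW (oppr_root aR).
have bP : b \in pos P.
  by rewrite pos_small_rho// -(pair_weyl _ wW)// -bE pairNl// oppr_gt0.
have uW := weyl_comp (weyl_refl aR) wW.
have ub : (refl a \o w)%VF b \in pos P by rewrite lfE -bE linearN /= refl_self// opprK.
have := wlen_refl uW bP ub; congr (wlen P _ < _)%N.
apply/lfunP => x; rewrite !lfE -weyl_conj// -bE.
by rewrite (refl_opp aR) reflK.
Qed.

(* Along a chain upwards from an alcove of the special section at [l], the
   special point moves by sums of positive roots. *)
Lemma bruhat_special A B : special_section l A -> bruhat A B ->
  exists2 s, {subset s <= pos P} & special_section (l + \sum_(a <- s) a) B /\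
    (s = [::] -> A = B \/ exists v w, [/\ weyl v, weyl w, A = walc v, B = walc w
       & (wlen P v < wlen P w)%N]).
Proof.
move=> Al AB; elim: {B AB}(clos_rt_rtn1 _ _ _ _ AB) => [|B C BC _ [s sP [Bs hs]]].
  by exists [::] => //; rewrite big_nil addr0; split=> // _; left.
move: BC => [a [m [aP Bneg BC]]]; have aR := pos_root aP.
set l' := l + _ in Bs.
have l'L : weight_lattice Phi l'.
  apply: weightD => //; apply: root_lattice_weight; apply/root_latticeP.
  by exists s => // b /sP/pos_root.
have [x Bx] := alcove_pt B; have [i iE] := weight_pair l'L aR.
have Cx : alcove_set C (areflection Phi a m x) by apply/(reflectsP _ _ aR Bx).
(* The special point l' is in the closure of B, which lies below the hyperplane. The step therefore
   adds m - i >= 0 copies of a to l'; when m = i it is a reflection through l' and raises [wlen]. *)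
have le_im : i <= m.
  rewrite -(ler_int R) -iE -lerN2 -[X in _ <= X]/(- coroot Phi a l').
  suff : - m%:~R <= (- coroot Phi a) l' by rewrite lfun_simp.
  apply: (closure_half Bs) => y /Bneg; rewrite /neg_half /= lfun_simp lerN2.
  exact: ltW.
have [j jE] : exists j : nat, m - i = j by exists `|m - i|%N; lia.
have := special_areflection l'L aR Bx Bs Cx.
rewrite (areflection_weight m iE) jE -pmulrn scaler_nat => Cs.
exists (s ++ nseq j a); first by move=> b; rewrite mem_cat => /orP[/sP|/nseqP[->]].
rewrite big_cat big_nseq iter_addr_0 addrA; split=> //.
move=> e; have s0 : s = [::] by move: e; case: (s).
have j0 : j = 0%N by move: e; rewrite s0; case: (j).
have l'E : l' = l by rewrite /l' s0 big_nil addr0.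
rewrite l'E in Bs iE; have mE : m = i by lia.
right; have [w wW BE] := weyl_alcove_surj Bs.
have CE : C = walc (refl a \o w)%VF.
  have := weyl_alcove_refl P lL wW aR iE; rewrite -BE -mE => /(reflectsP _ _ aR Bx) Cx'.
  exact: alcove_eq Cx Cx'.
have neg : pair a (w rho0) < 0.
  have : pair a (l + w rho0) < m%:~R by apply: Bneg; rewrite BE; apply: weyl_alcove_pt.
  by rewrite pairD iE mE gtrDl.
have lt_w := weyl_len_up wW aP neg; have uW := weyl_comp (weyl_refl aR) wW.
have [->|[v [w' [vW w'W AE BE' lt_v]]]] := hs s0.
  by exists w, (refl a \o w)%VF.
exists v, (refl a \o w)%VF; split=> //; apply: ltn_trans lt_w.
by rewrite BE in BE'; rewrite (weyl_alcove_inj wW w'W BE').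
Qed.

Lemma special_bruhat A B : special_section l A -> special_section l B -> bruhat A B ->
  A = B \/ exists v w, [/\ weyl v, weyl w, A = walc v, B = walc w & (wlen P v < wlen P w)%N].
Proof.
move=> Al Bl AB; have [s sP [Bs hs]] := bruhat_special Al AB; apply: hs.
apply: (no_zero_sum (P := P)) => //; apply: (special_translate_eq0 lL _ Bl Bs).
by apply/root_latticeP; exists s => // b /sP/pos_root.
Qed.
End AtWeight.

Section AtWeight2.
Variable l : V.
Hypothesis lL : weight_lattice Phi l.
Local Notation walc := (weyl_alcove P lL).

(** Going up to B and back to A moves the special point by a sum of positive roots, which is zero
    because A touches both ends. Hence B is special at l as well, and [wlen] would increase strictly
    around the loop. *)
Lemma special_bruhat_anti A B : special_section l A -> bruhat A B -> bruhat B A -> A = B.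
Proof.
move=> Al AB BA; have [s sP [Bs _]] := bruhat_special lL Al AB.
have sL : root_lattice Phi (\sum_(a <- s) a).
  by apply/root_latticeP; exists s => // b /sP/pos_root.
have [t tP [At _]] := bruhat_special (weightD lL (root_lattice_weight sL)) Bs BA.
have s0 : s = [::].
  suff : s ++ t = [::] by case: (s).
  apply: (no_zero_sum (P := P)); first by move=> b; rewrite mem_cat => /orP[/sP|/tP].
  rewrite big_cat; rewrite -addrA in At; apply: (special_translate_eq0 lL _ Al At).
  apply: root_latticeD => //.
  by apply/root_latticeP; exists t => // b /tP/pos_root.
rewrite s0 big_nil addr0 in Bs.
have [//|[v [w [vW wW AE BE lt_vw]]]] := special_bruhat lL Al Bs AB.
have [//|[v' [w' [vW' wW' BE' AE' lt_vw']]]] := special_bruhat lL Bs Al BA.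
move: lt_vw'; rewrite -(weyl_alcove_inj wW vW' (etrans (esym BE) BE')).
by rewrite -(weyl_alcove_inj vW wW' (etrans (esym AE) AE')) ltnNge ltnW.
Qed.

(** Reflecting successively in the next two hyperplanes above A in direction a goes up twice, and
    the composite is translation by a. *)
Lemma bruhat_translate_pos a A B x : a \in pos P -> alcove_set A x -> alcove_set B (x + a) ->
  bruhat A B.
Proof.
move=> aP Ax Bx; have aR := pos_root aP; have [rx AE] := alcoveE Ax.
pose m := Num.floor (pair a x).
have h1 : m%:~R < pair a x by rewrite lt_neqAle eq_sym rx//= real_floor_le ?num_real.
have h2 : pair a x < (m + 1)%:~R by rewrite real_floorD1_gt ?num_real.
have rs := regular_areflection (m + 1) aR rx.
have [C Cx] := cell_alcove P rs; have [_ CE] := alcoveE Cx.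
apply: (@rt_trans _ _ _ C); apply: rt_step.
  exists a, (m + 1); split=> //; last by apply/(reflectsP _ _ aR Ax).
  by rewrite AE => y /= h; rewrite /neg_half /= -[coroot _ _ _]/(pair a y) -(same_cell_lt _ h).
exists a, (m + 1 + 1); split=> //.
  rewrite CE => y /= h; rewrite /neg_half /= -[coroot _ _ _]/(pair a y) -(same_cell_lt _ h)//.
  rewrite areflectionE reflE pairD pairB !pairZ pairK// intr_addr1.
  by rewrite intr_addr1 in h2 *; lra.
apply/(reflectsP _ _ aR Cx); rewrite !areflectionE linearD /= reflK// linearZ /= refl_self//.
by rewrite [(m + 1 + 1)%:~R]intr_addr1 scalerDl scale1r scalerN addrA addrNK.
Qed.

Lemma bruhat_translate s A B x : {subset s <= pos P} -> alcove_set A x ->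
  alcove_set B (x + \sum_(a <- s) a) -> bruhat A B.
Proof.
elim: s A x => [|a s IH] A x sP Ax; rewrite ?big_nil ?addr0 ?big_cons => Bx.
  by rewrite (alcove_eq Ax Bx); apply: rt_refl.
have aP : a \in pos P by apply: sP; rewrite mem_head.
have aL := root_lattice_weight (root_lattice_root (pos_root aP)).
have [C Cx] := cell_alcove P (regular_translate aL (alcoveE Ax).1).
apply: (@rt_trans _ _ _ C); first exact: bruhat_translate_pos aP Ax Cx.
by apply: (IH _ (x + a)) => //; rewrite -?addrA// => b bs; apply: sP; rewrite inE bs orbT.
Qed.

Lemma special_bruhat_orbit A B : special_section l A -> bruhat A B ->
  exists C l', [/\ special_section l C, root_lattice Phi l', translates l' C B & bruhat C B].
Proof.
move=> Al AB; have [s sP [Bs _]] := bruhat_special lL Al AB.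
have sL : root_lattice Phi (\sum_(a <- s) a).
  by apply/root_latticeP; exists s => // b /sP/pos_root.
have sW := root_lattice_weight sL.
have [x Bx] := alcove_pt B; have [rx _] := alcoveE Bx.
have [C Cx] := cell_alcove P (regular_translate (weightN sW) rx).
have CB : alcove_set B (x - \sum_(a <- s) a + \sum_(a <- s) a) by rewrite subrK.
exists C, (\sum_(a <- s) a); split=> //.
- apply/(special_sectionP lL Cx) => a aR.
  have := iffLR (special_sectionP (weightD lL sW) Bx) Bs a aR.
  by rewrite opprD addrA addrAC.
- exact/(translatesP _ sW Cx).
- exact: bruhat_translate Cx CB.
Qed.
End AtWeight2.
End SpecialSections.

(** * The sections of the special section sheaf *)

Section SymalgGrading.
Variables (n : nat) (k : fieldType).
Implicit Types (f g : symalg n k) (d e : int).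

Lemma symalg_gr0 d : symalg_gr d (0 : symalg n k). Proof. by left. Qed.

Definition symalg_comp d f : symalg n k :=
  if d is Posz m then if odd m then 0 else pihomog mdeg m./2 f else 0.

Lemma symalg_comp_gr d f : symalg_gr d (symalg_comp d f).
Proof.
rewrite /symalg_comp; case: d => [m|m]; last by left.
case: ifP => [_|/negbT om]; first by left.
right; exists m./2; last exact: pihomogP.
by rewrite mul2n -[in LHS](odd_double_half m) (negPf om).
Qed.

Lemma symalg_grE d f : symalg_gr d f <-> symalg_comp d f = f.
Proof.
split=> [[->|[e -> fe]]|<-]; first by rewrite /symalg_comp; case: d => // m; rewrite pihomog0 if_same.
  by rewrite /symalg_comp mul2n odd_double doubleK pihomog_dE.
exact: symalg_comp_gr.
Qed.

Lemma symalg_compB d f g : symalg_comp d (f - g) = symalg_comp d f - symalg_comp d g.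
Proof.
by rewrite /symalg_comp; case: d => [m|m]; rewrite ?subrr//; case: ifP => _; rewrite ?subrr ?pihomogB.
Qed.

Lemma symalg_comp0 d : symalg_comp d 0 = 0.
Proof. by rewrite -[X in symalg_comp d X](subrr 0) symalg_compB subrr. Qed.

Lemma symalg_compD d f g : symalg_comp d (f + g) = symalg_comp d f + symalg_comp d g.
Proof. by rewrite -{1}[g]opprK -[- g]sub0r !symalg_compB symalg_comp0 sub0r opprK. Qed.

Lemma symalg_comp_sum d I (r : seq I) (F : I -> symalg n k) :
  symalg_comp d (\sum_(i <- r) F i) = \sum_(i <- r) symalg_comp d (F i).
Proof. by elim/big_ind2: _ => [|u s v t <- <-|//]; rewrite ?symalg_comp0 ?symalg_compD. Qed.

Lemma symalg_grB d f g : symalg_gr d f -> symalg_gr d g -> symalg_gr d (f - g).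
Proof. by move=> /symalg_grE fd /symalg_grE gd; apply/symalg_grE; rewrite symalg_compB fd gd. Qed.

Lemma symalg_comp_ne d e f : symalg_gr d f -> d != e -> symalg_comp e f = 0.
Proof.
move=> [->|[i -> fi]]; first by rewrite symalg_comp0.
rewrite /symalg_comp; case: e => // m ne; case: ifP => // /negbT om.
apply: (pihomog_ne0 _ fi); apply: contraNneq ne => ->; apply/eqP.
by rewrite mul2n -[in RHS](odd_double_half m) (negPf om).
Qed.

Lemma symalg_grM d e f g : symalg_gr d f -> symalg_gr e g -> symalg_gr (d + e) (f * g).
Proof.
move=> [->|[i -> fi]]; first by rewrite mul0r; left.
move=> [->|[j -> gj]]; first by rewrite mulr0; left.
right; exists (i + j)%N; first by rewrite mulnDr.
exact: dhomogM.
Qed.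

Lemma symalg_comp_span (N : nat) f : (msize f <= N)%N ->
  f = \sum_(i < N) symalg_comp (2 * i)%N f.
Proof.
move=> fN; rewrite {1}(pihomog_partitionE (mf := mdeg) fN).
by apply: eq_bigr => i _; rewrite /symalg_comp mul2n odd_double doubleK.
Qed.

Lemma symalg_comp_divides d e (p f : symalg n k) : symalg_gr e p ->
  divides p f -> divides p (symalg_comp d f).
Proof.
move=> pe [q ->]; rewrite {1}(symalg_comp_span (leqnn (msize q))) mulr_sumr symalg_comp_sum.
elim/big_ind: _ => [|? ?|i _]; [exact: divides0|exact: dividesD|].
have h := symalg_grM pe (symalg_comp_gr (2 * i)%N q).
have [<-|ne] := eqVneq (e + (2 * i)%N) d; last by rewrite (symalg_comp_ne h ne); apply: divides0.
by rewrite ((symalg_grE _ _).1 h); exists (symalg_comp (2 * i)%N q).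
Qed.
End SymalgGrading.

(** * Tuples with entries in the symmetric algebra *)

Section Tuples.
Variables (R : realType) (V : vectType R) (Phi : root_system V).
Variables (P : positive_system Phi) (n : nat) (omega : n.-tuple 'Hom(V, R^o)).
Variable (k : fieldType).
Implicit Types (a b l : V) (A B C : alcove P) (X Y : set (alcove P)) (d e : int).
Local Notation Z := (structure_alg omega k).
Local Notation cr := (coroot_k Phi omega k).

(* [tuple_fun] as a total function, zero outside [X]. *)
Definition at_ X (z : Z X) A : symalg n k :=
  if pselect (X A) is left h then tuple_fun z (exist _ A (mem_set h)) else 0.

Lemma at_E X (z : Z X) (A : X) : tuple_fun z A = at_ z (val A).
Proof.
rewrite /at_; case: pselect => [h|]; first by congr (tuple_fun z _); apply: val_inj.
by case; apply: set_mem; apply: valP.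
Qed.

Lemma at_in X (z : Z X) A (h : X A) : at_ z A = tuple_fun z (exist _ A (mem_set h)).
Proof. by rewrite at_E. Qed.

Lemma at_out X (z : Z X) A : ~ X A -> at_ z A = 0.
Proof. by rewrite /at_; case: pselect. Qed.

Lemma tuple_ext X (z w : Z X) : (forall A, X A -> at_ z A = at_ w A) -> z = w.
Proof.
move=> h; apply: val_inj; apply: funext => A; rewrite /= !at_E h//.
by apply: set_mem; apply: valP.
Qed.

Lemma at_projection X Y (YX : Y `<=` X) (z : Z X) A : Y A -> at_ (projection YX z) A = at_ z A.
Proof. by move=> YA; rewrite (at_in _ YA) /= /projection at_E. Qed.

Lemma at0 X A : at_ (0 : Z X) A = 0.
Proof. by rewrite /at_; case: pselect. Qed.
Lemma at1 X A : X A -> at_ (1 : Z X) A = 1.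
Proof. by move=> XA; rewrite (at_in _ XA). Qed.
Lemma atD X (z w : Z X) A : at_ (z + w) A = at_ z A + at_ w A.
Proof. by rewrite /at_; case: pselect => //; rewrite addr0. Qed.
Lemma atB X (z w : Z X) A : at_ (z - w) A = at_ z A - at_ w A.
Proof. by rewrite /at_; case: pselect => //; rewrite subr0. Qed.
Lemma atM X (z w : Z X) A : at_ (z * w) A = at_ z A * at_ w A.
Proof. by rewrite /at_; case: pselect => //; rewrite mulr0. Qed.
Lemma at_sum X I (r : seq I) (F : I -> Z X) A :
  at_ (\sum_(i <- r) F i) A = \sum_(i <- r) at_ (F i) A.
Proof. by elim/big_ind2: _ => [|u s v t <- <-|//]; rewrite ?at0 ?atD. Qed.

Lemma at_setT (z : Zalg P omega k) A : at_ z A = coordinate z A.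
Proof. by rewrite (at_in _ (I : setT A)). Qed.

Lemma at_scale X (z : Zalg P omega k) (w : Z X) A :
  at_ (z *: w) A = coordinate z A * at_ w A.
Proof.
have [XA|nXA] := pselect (X A); last by rewrite !at_out// mulr0.
by rewrite -[z *: w]/(projection _ z * w) atM at_projection// at_setT.
Qed.

Lemma at_reflects X (z : Z X) A B a m : X A -> X B -> a \in pos P -> reflects a m A B ->
  divides (cr a) (at_ z A - at_ z B).
Proof.
move=> XA XB aP AB; rewrite (at_in _ XA) (at_in _ XB).
have [h _] := tuple_funP z.
exact: (h (exist _ A (mem_set XA)) (exist _ B (mem_set XB)) a m aP AB).
Qed.

Lemma at_translates X (z : Z X) A B l : X A -> X B -> root_lattice Phi l -> translates l A B ->
  at_ z A = at_ z B.
Proof.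
move=> XA XB lL AB; rewrite (at_in _ XA) (at_in _ XB).
have [_ h] := tuple_funP z.
exact: (h (exist _ A (mem_set XA)) (exist _ B (mem_set XB)) l lL AB).
Qed.

Lemma tuple_exists X (F : alcove P -> symalg n k) :
  (forall A B a m, X A -> X B -> a \in pos P -> reflects a m A B ->
     divides (cr a) (F A - F B)) ->
  (forall A B l, X A -> X B -> root_lattice Phi l -> translates l A B -> F A = F B) ->
  exists z : Z X, forall A, X A -> at_ z A = F A.
Proof.
move=> h1 h2.
have h : (fun A : X => F (val A)) \in tuple_pred omega (k := k) (X := X).
  have inX (A : X) : X (val A) by apply: set_mem; apply: valP.
  by apply/asboolP; split=> A B; [move=> a m|move=> l]; [apply: h1|apply: h2].
by exists (StructureAlg h) => A XA; rewrite (at_in _ XA).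
Qed.

Lemma structure_grE X d (z : Z X) :
  structure_alg_gr d z <-> forall A, symalg_gr d (at_ z A).
Proof.
split=> [h A|h A]; last by rewrite at_E.
have [XA|nXA] := pselect (X A); last by rewrite at_out//; apply: symalg_gr0.
by rewrite (at_in _ XA).
Qed.

Lemma structure_comp X d (z : Z X) : exists y : Z X, forall A, at_ y A = symalg_comp d (at_ z A).
Proof.
have [A B a m XA XB aP AB|A B l XA XB lL AB|y yE] := @tuple_exists X (fun A => symalg_comp d (at_ z A)).
- rewrite -symalg_compB; apply: (@symalg_comp_divides _ _ _ 2).
    by right; exists 1%N => //; apply: coroot_k_homog.
  exact: at_reflects XA XB aP AB.
- by rewrite (at_translates _ XA XB lL AB).
exists y => A; have [XA|nXA] := pselect (X A); first exact: yE.
by rewrite !at_out// symalg_comp0.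
Qed.

(* Finiteness through an enumerating map: [alcove] is not an [eqType]. *)
Definition enumerable X : Prop := exists (T : eqType) (r : seq T) (g : T -> alcove P),
  forall A, X A -> exists2 t, t \in r & A = g t.

(** Finiteness bounds the degrees of the entries of a tuple, so finitely many components sum to it;
    components exist in Z because the coroots are homogeneous. *)
Lemma structure_grading X : enumerable X -> is_grading (@Zalg_gr _ _ _ P n omega k)
  (M := Z X) (fun d => @structure_alg_gr _ _ _ P n omega k X d).
Proof.
move=> [T [r [g XE]]]; split.
- by move=> d; apply/structure_grE => A; rewrite at0; apply: symalg_gr0.
- move=> d x y /structure_grE hx /structure_grE hy; apply/structure_grE => A.
  by rewrite atB; apply: symalg_grB.
- move=> d e a x /structure_grE ha /structure_grE hx; apply/structure_grE => A.
  by rewrite at_scale -at_setT; apply: symalg_grM.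
- move=> x; pose N := \max_(t <- r) msize (at_ x (g t)).
  have /choice[c cE] : forall d, exists y : Z X, forall A, at_ y A = symalg_comp d (at_ x A).
    by move=> d; apply: structure_comp.
  exists [seq (2 * i)%N%:Z | i <- iota 0 N], c; split.
    by move=> d; apply/structure_grE => A; rewrite cE; apply: symalg_comp_gr.
  apply: tuple_ext => A /XE[t tr ->]; rewrite at_sum big_map.
  rewrite (@symalg_comp_span _ _ N (at_ x (g t))); last first.
    exact: (leq_bigmax_seq (F := fun t => msize (at_ x (g t)))) tr isT.
  by rewrite -(big_mkord predT (fun i => symalg_comp (2 * i)%N _)) /index_iota subn0;
     apply: eq_bigr => i _; rewrite cE.
- move=> s c us cd s0 d ds; apply: tuple_ext => A _; rewrite at0.
  have := congr1 (fun z : Z X => symalg_comp d (at_ z A)) s0.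
  rewrite at_sum at0 symalg_comp0 symalg_comp_sum (bigD1_seq d)//= big1 ?addr0.
    by rewrite (symalg_grE _ _).1//; apply/structure_grE: A.
  by move=> e ed; apply: (symalg_comp_ne (d := e)) => //; apply/structure_grE: A.
Qed.
End Tuples.

(** * Structure algebras as modules, and the special section sheaf *)

Section StructureModules.
Variables (R : realType) (V : vectType R) (Phi : root_system V).
Variables (P : positive_system Phi) (n : nat) (omega : n.-tuple 'Hom(V, R^o)).
Variable (k : fieldType).
Hypothesis omegaP : coweight_basis Phi omega.
Hypothesis char2 : 2%N \notin [pchar k].
Hypothesis gkmP : gkm P omega k.
Implicit Types (a b l : V) (A B C : alcove P) (X Y : set (alcove P)) (d e : int).
Local Notation Z := (structure_alg omega k).
Local Notation cr := (coroot_k Phi omega k).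
Local Notation ZA := (Zalg P omega k).

Lemma coordinateE (z w : ZA) A : coordinate (z * w) A = coordinate z A * coordinate w A.
Proof. by rewrite -!at_setT atM. Qed.

Lemma coordinate_den Q (s : den (coroot_mset P omega k Q)) : exists t : seq V,
  [/\ forall a, a \in t -> a \in pos P /\ Q a, val s = Zscalar P omega (\prod_(a <- t) cr a),
      \prod_(a <- t) cr a != 0 & forall A, coordinate (val s) A = \prod_(a <- t) cr a].
Proof.
have [t tP sE] := set_mem (valP s); exists t; split=> //; last by rewrite sE.
by apply: (coroot_k_prod_neq0 (P := P) omegaP char2) => a /tP[].
Qed.

Lemma coordinate_den_neq0 Q (s : den (coroot_mset P omega k Q)) A : coordinate (val s) A != 0.
Proof. by have [t [_ _ h ->]] := coordinate_den s. Qed.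

Lemma structure_torsion_free X : torsion_free (Z X).
Proof.
move=> f m f0 fm; apply: tuple_ext => A _; rewrite at0.
have f0' : f != 0 by apply/eqP.
apply: (mulfI f0').
by rewrite mulr0 -[f]/(coordinate (Zscalar P omega f) A) -at_scale fm at0.
Qed.

(* S is the intersection of its localizations S^a. *)
Lemma divides_by_localization (s : seq V) p : {subset s <= pos P} ->
  (forall a, a \in pos P -> exists2 t : seq V, (forall b, b \in t -> b \in pos P /\ b != a) &
     divides (\prod_(b <- s) cr b) (\prod_(b <- t) cr b * p)) ->
  divides (\prod_(b <- s) cr b) p.
Proof.
elim: s p => [|b s IH] p sP h; first by exists p; rewrite big_nil mul1r.
have bP : b \in pos P by apply: sP; rewrite mem_head.
have [q qE] : divides (cr b) p.
  have [t tP tE] := h b bP; apply: (coroot_k_prod_prime omegaP char2 gkmP bP tP).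
  by case: tE => r ->; rewrite big_cons -mulrA; exists (\prod_(j <- s) cr j * r).
have [r rE] : divides (\prod_(b <- s) cr b) q.
  apply: IH => [c cs|a aP]; first by apply: sP; rewrite inE cs orbT.
  have [t tP [r tE]] := h a aP; exists t => //; exists r.
  apply: (mulfI (coroot_k_neq0 omegaP char2 (pos_root bP))).
  by rewrite mulrCA -qE tE big_cons mulrA.
by exists r; rewrite big_cons qE rE mulrA.
Qed.

(** Entrywise this is [divides_by_localization]. The quotients again satisfy the congruence for a:
    multiplied by suitable coroots prime to a^v they form an element of [Z X], and those coroots
    cancel modulo a^v. *)
Lemma structure_Zmod_f X : Zmod_f (Z X).
Proof.
split; first exact: structure_torsion_free.
move=> y yP; have [m [s yE]] := frac_ex y.
have [l [lP sE l0 sA]] := coordinate_den s.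
have h a : a \in pos P -> exists2 t : seq V, (forall b, b \in t -> b \in pos P /\ b != a) &
    exists m' : Z X, forall A, \prod_(b <- t) cr b * at_ m A = \prod_(b <- l) cr b * at_ m' A.
  move=> aP; have [m' [s' [[t tP s'E]]]] := yP a aP; rewrite yE => /fracP[u].
  move=> e; exists t; first by move=> b /tP[].
  exists m' => A; have := congr1 (fun z => at_ z A) e.
  rewrite !at_scale !coordinateE s'E sA -!mulrA.
  by apply: mulfI; apply: coordinate_den_neq0.
have /choice[F FE] : forall A, exists q, at_ m A = \prod_(b <- l) cr b * q.
  move=> A; suff [q qE] : divides (\prod_(b <- l) cr b) (at_ m A) by exists q.
  apply: divides_by_localization; first by move=> b /lP[].
  by move=> a /h[t tP [m' m'E]]; exists t => //; exists (at_ m' A).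
have [A B a j XA XB aP AB|A B l' XA XB lL AB|m0 m0E] := @tuple_exists _ _ _ P _ omega k X F.
- have [t tP [m' m'E]] := h a aP.
  apply: (coroot_k_prod_prime omegaP char2 gkmP aP tP).
  suff tF C : \prod_(b <- t) cr b * F C = at_ m' C.
    by rewrite mulrBr !tF; apply: at_reflects AB.
  by apply: (mulfI l0); rewrite mulrCA -FE m'E.
- by apply: (mulfI l0); rewrite -!FE; apply: at_translates AB.
exists m0; rewrite yE; apply: frac_eqI; rewrite val_den1 scale1r.
by apply: tuple_ext => A XA; rewrite at_scale sA m0E// FE.
Qed.

Lemma locfrac0 (A : comPzRingType) (D : mult_set A) (M : lmodType A) (s : den D) :
  locfrac 0 s = 0 :> loc D M.
Proof. by apply: frac_eqI; rewrite !scaler0. Qed.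

Section AtWeight.
Variable l : V.
Hypothesis lL : weight_lattice Phi l.
Local Notation K := (special_section_sheaf P omega k l).
Local Notation red := (@pos_reduced _ _ _ _ _ _ _ omegaP gkmP).
Local Notation walc := (weyl_alcove P lL).

Lemma special_enumerable X : X `<=` special_section l -> enumerable X.
Proof.
move=> XK; have [ws [_ [_ wsE]]] := special_section_finite P lL.
by exists _, ws, walc => A /XK/wsE.
Qed.

Lemma special_translates_eq A B l' : special_section l A -> special_section l B ->
  root_lattice Phi l' -> translates l' A B -> A = B.
Proof.
move=> Al Bl l'L AB; have lL' := root_lattice_weight l'L.
have [x Ax] := alcove_pt A; have Bx := (translatesP B lL' Ax).1 AB.
suff l'0 : l' = 0 by rewrite l'0 addr0 in Bx; rewrite (alcove_eq Ax Bx).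
apply: (special_translate_eq0 lL l'L Bl).
apply/(special_sectionP (weightD lL lL') Bx) => a aR; rewrite opprD addrACA subrr addr0.
exact: (special_sectionP lL Ax).1 Al a aR.
Qed.

(** Reflections between special alcoves fix l, so they act on W as left multiplication by s_a, and
    the periodicity condition is void because distinct special alcoves are never translates under
    the root lattice. *)
Lemma special_tuple_exists X (F : alcove P -> symalg n k) : X `<=` special_section l ->
  (forall w a, weyl Phi w -> a \in pos P -> X (walc w) -> X (walc (srefl Phi a \o w)%VF) ->
     divides (cr a) (F (walc w) - F (walc (srefl Phi a \o w)%VF))) ->
  exists z : Z X, forall A, X A -> at_ z A = F A.
Proof.
move=> XK h; apply: tuple_exists => A B.
  move=> a m XA XB aP AB; have aR := pos_root aP.
  have mE := reflects_special lL aR (XK _ XA) (XK _ XB) AB.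
  have [w wW AE] := weyl_alcove_surj lL (XK _ XA).
  have BE : B = walc (srefl Phi a \o w)%VF.
    apply: alcove_set_inj; rewrite AB AE.
    by rewrite (weyl_alcove_refl P lL wW aR mE).
  by rewrite AE BE; apply: h => //; rewrite -?AE -?BE.
by move=> l' /XK Al /XK Bl l'L /(special_translates_eq Al Bl l'L) ->.
Qed.

Lemma at_res (U U' : opens P) (h : open_set U' `<=` open_set U) (t : sec K U) A :
  special_section l A -> open_set U' A ->
  at_ (res K h t : Z (special_section l `&` open_set U')) A
  = at_ (t : Z (special_section l `&` open_set U)) A.
Proof. by move=> Al UA; apply: at_projection. Qed.

(** Two alcoves related by a reflection are comparable, so a member of the cover containing the
    larger contains both; every congruence is thus visible in one member. *)
Lemma special_sheaf : graded_sheaf K.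
Proof.
split=> [U|]; first by apply: structure_grading; apply: special_enumerable => A [].
move=> I U W UW cover d s sd compat.
have compat' i j A : special_section l A -> open_set (U i) A -> open_set (U j) A ->
    at_ (s i) A = at_ (s j) A.
  move=> Al Ai Aj; have e := congr1 (fun z => at_ z A) (compat i j).
  by move: e; rewrite /= !at_projection.
have /choice[F FE] : forall A, exists q, forall i, special_section l A -> open_set (U i) A ->
    at_ (s i) A = q.
  move=> A; have [[i [Al Ai]]|h] := pselect (exists i, special_section l A /\ open_set (U i) A).
    by exists (at_ (s i) A) => j _ Aj; apply: compat'.
  by exists 0 => i Al Ai; exfalso; apply: h; exists i.
have [A B a j XA XB aP AB|A B l' XA XB lL' AB|t tE] :=
    @tuple_exists _ _ _ P _ omega k (special_section l `&` open_set W) F.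
- have hU i : open_set (U i) A -> open_set (U i) B -> divides (cr a) (F A - F B).
    move=> Ai Bi; rewrite -(FE A i XA.1 Ai) -(FE B i XB.1 Bi).
    by apply: at_reflects AB => //; split=> //; [case: XA|case: XB].
  have [le|le] := special_bruhat_total aP AB.
    by have [i _ Bi] := cover _ XB.2; apply: (hU i) => //; apply: open_lower le.
  by have [i _ Ai] := cover _ XA.2; apply: (hU i) => //; apply: open_lower le.
- by rewrite (special_translates_eq XA.1 XB.1 lL' AB).
exists t; split; last first.
  move=> t' [_ t'E]; apply: tuple_ext => A [Al WA]; rewrite tE//.
  have [i _ Ai] := cover _ WA; rewrite -(FE A i Al Ai) -(t'E i).
  by rewrite at_res.
split.
  apply/structure_grE => A; have [XA|nXA] := pselect ((special_section l `&` open_set W) A).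
    have [i _ Ai] := cover _ XA.2; rewrite tE// -(FE A i XA.1 Ai).
    by move: (sd i) => /structure_grE.
  by rewrite at_out//; apply: symalg_gr0.
move=> i; apply: tuple_ext => A [Al Ai]; rewrite /= at_projection//.
by rewrite tE; [apply/esym/FE|split=> //; apply: UW Ai].
Qed.

Lemma special_extend (U : opens P) (z : Z (special_section l `&` open_set U)) :
  exists z' : Z (special_section l), forall A, special_section l A -> open_set U A ->
    at_ z' A = at_ z A.
Proof.
pose J w := open_set U (walc w).
have [||z' [z'P z'E]] := @weyl_gkm_extend _ _ _ P _ omega k omegaP char2 gkmP J
  (fun w => at_ z (walc w)).
- by move=> w d wW dP wdP Jw; exact: (open_lower Jw (bruhat_weyl_alcove lL wW dP wdP)).
- move=> w d wW dP wdP Jw; have dR := pos_root dP; have wdR := pos_root wdP.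
  have uW := weyl_comp wW (weyl_refl dR).
  have [m mE] := weight_pair lL wdR.
  have e : (w \o srefl Phi d)%VF = (srefl Phi (w d) \o w)%VF.
    by apply/lfunP => x; rewrite !lfE weyl_conj.
  apply: (at_reflects (m := m) z _ _ wdP).
  + by split=> //; apply: weyl_alcove_special.
  + split; first exact: weyl_alcove_special.
    exact: (open_lower Jw (bruhat_weyl_alcove lL wW dP wdP)).
  + by rewrite e; apply: weyl_alcove_refl.
have /choice[F FE] : forall A, exists q, forall w, weyl Phi w -> A = walc w -> q = z' w.
  move=> A; have [[w [wW AE]]|h] := pselect (exists w, weyl Phi w /\ A = walc w).
    exists (z' w) => w' wW'; rewrite AE => e.
    by rewrite (weyl_alcove_inj red wW wW' e).
  by exists 0 => w wW AE; exfalso; apply: h; exists w.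
have [//|w a wW aP _ _|y yE] := @special_tuple_exists (special_section l) F.
  have aR := pos_root aP; have [b bR aE] := weyl_root_inv wW aR.
  have uW := weyl_comp (weyl_refl aR) wW.
  rewrite (FE _ w wW erefl) (FE _ _ uW erefl).
  have -> : (srefl Phi a \o w)%VF = (w \o srefl Phi b)%VF.
    by apply/lfunP => x; rewrite !lfE aE weyl_conj.
  by rewrite aE; apply: z'P.
exists y => A Al UA; rewrite yE//; have [w wW AE] := weyl_alcove_surj lL Al.
by rewrite (FE _ w wW AE) AE z'E// /J -AE.
Qed.

Lemma special_flabby : flabby K.
Proof.
move=> U W h y; have [z zE] := special_extend y.
exists (projection (@subIsetl _ _ _) z).
apply: tuple_ext => A [Al WA]; have UA := h _ WA.
by rewrite at_res// at_projection; [apply: zE|split].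
Qed.

(** If A is not special, antisymmetry keeps A out of the set below any special B <= A. So all such B
    lie in the boundary of {A}, where the sections in question vanish. *)
Lemma special_finitely_supported : finitely_supported K.
Proof.
have fin : finite_set (special_section (P := P) l).
  have [ws [_ [_ wsE]]] := special_section_finite P lL.
  apply: (@sub_finite_set _ _ [set walc w | w in [set` ws]]); last first.
    by apply: finite_image; apply: finite_seq.
  by move=> A /wsE[w ww ->]; exists w.
split.
  apply: sub_finite_set fin => A [x x0]; apply: contrapT => nAl; apply: x0.
  apply: val_inj; apply: tuple_ext => B [Bl BA]; rewrite at0.
  have [C CA leBC] := BA; rewrite CA in leBC.
  have bB : open_set (boundary [set A]) B.
    move=> C' leC'B; split.
      by exists A => //; apply: rt_trans leC'B leBC.
    move=> /= C'A; rewrite C'A in leC'B; apply: nAl.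
    by rewrite -(special_bruhat_anti red lL Bl leBC leC'B).
  have /eqP e := valP x.
  have := congr1 (fun z => at_ z B) e; rewrite at0 /= at_projection//.
exists (special_section l) => // A [x x0]; apply: contrapT => h; apply: x0.
apply: tuple_ext => B [Bl [C -> leBA]]; exfalso; apply: h; by exists B.
Qed.

(** Elements of [sec_at K X] have nonzero entries only on X. If the orbit x misses X, the numerator
    z of its idempotent vanishes on X, hence so do the entries. *)
Lemma special_support_condition : support_condition K.
Proof.
move=> X lcX x [[A0 xE] [y [z [s [y' [sP zE e]]]] y0]].
apply: contrapT => nX; apply: y0.
have [m [t yE]] := frac_ex y; have [m' [t' yE']] := frac_ex y'.
suff m0 : m = 0 by rewrite yE m0 locfrac0.
apply: val_inj; apply: tuple_ext => A [Al XA]; rewrite at0.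
have [KA|nKA] := pselect (X A); last first.
  have bA : open_set (boundary X) A by rewrite boundaryE.
  have /eqP em := valP m.
  by have := congr1 (fun z => at_ z A) em; rewrite at0 /= at_projection.
have zA : coordinate z A = 0.
  by rewrite zE; case: asboolP => // xA; exfalso; apply: nX; exists A.
move: e; rewrite yE yE' !fracZ => /fracP[u].
move/(congr1 (fun q => at_ (val q) A)).
have vZ (c : ZA) (q : sec_at K X) : at_ (val (c *: q)) A = coordinate c A * at_ (val q) A.
  by rewrite -at_scale.
rewrite !vZ zA mul0r mulr0 coordinateE.
have s0 : coordinate s A != 0.
  by case: sP => q qP ->; apply: (coroot_k_prod_neq0 (P := P) omegaP char2) => b /qP[].
move=> h; apply: (mulfI s0); rewrite mulr0; apply: (mulfI (coordinate_den_neq0 t' A)).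
by rewrite mulr0; apply: (mulfI (coordinate_den_neq0 u A)); rewrite mulr0 mulrA.
Qed.
End AtWeight.
End StructureModules.

(** * The local extension condition *)

Section LocalizationGrading.
Variables (A : comPzRingType) (D : mult_set A) (grA : int -> set A).
Hypothesis grAM : forall d e a b, grA d a -> grA e b -> grA (d + e) (a * b).
Hypothesis grD : forall s : den D, exists e, grA e (val s).
Variables (M : lmodType A) (gr : int -> set M).
Hypothesis grM : is_grading grA gr.
Implicit Types (s t u : den D) (m : M).

Lemma frac_sum I (r : seq I) (F : I -> M) s :
  \sum_(i <- r) locfrac (F i) s = locfrac (\sum_(i <- r) F i) s :> loc D M.
Proof.
elim: r => [|i r IH]; rewrite ?big_nil ?big_cons ?locfrac0// IH fracD.
by apply: frac_eqI; rewrite val_denM -!scalerDr !scalerA.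
Qed.

Lemma common_denominator (r : seq int) (c : int -> loc D M) :
  (forall d, loc_gr grA gr d (c d)) ->
  exists (t : den D) (e : int) (m : int -> M), grA e (val t) /\
    forall d, d \in r -> gr (d + e) (m d) /\ c d = locfrac (m d) t.
Proof.
move=> cP; elim: r => [|d r [t [e [m [te h]]]]].
  by have [e te] := grD den1; exists den1, e, (fun=> 0).
have [f [m0 [s [sf m0E cE]]]] := cP d.
exists (denM s t), (f + e), (fun d' => if d' == d then val t *: m0 else val s *: m d').
split; first exact: grAM.
move=> d'; rewrite inE; have [->{d'} _|ne /= /h[mE ->]] := eqVneq d' d.
  split; last by rewrite cE; apply: frac_expand.
  by rewrite addrA [in X in gr X]addrC; exact: (grZ grM te m0E).
split; first by rewrite addrCA; exact: (grZ grM sf mE).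
by apply: frac_eqI; rewrite val_denM scalerA mulrC.
Qed.

Lemma loc_grading : is_grading grA (M := loc D M) (loc_gr grA gr).
Proof.
split.
- move=> d; have [e h] := grD den1; exists e, 0, den1; split=> //; exact: (gr0 grM).
- move=> d _ _ [e [m [s [se me ->]]]] [f [m' [t [tf mf ->]]]].
  exists (e + f), (val t *: m - val s *: m'), (denM s t); split.
  + exact: grAM.
  + apply: (grB grM).
      by rewrite addrA [in X in gr X]addrC; exact: (grZ grM tf me).
    by rewrite addrCA; exact: (grZ grM se mf).
  + by rewrite -[- locfrac _ _]/(locN _) locNE fracD scalerN.
- move=> d e a _ ad [f [m [s [sf me ->]]]]; exists f, (a *: m), s; split=> //; last by rewrite fracZ.
  by rewrite -addrA; exact: (grZ grM ad me).
- move=> y; have [m [s ->]] := frac_ex y; have [e se] := grD s.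
  have [r [c [cP ->]]] := gr_span grM m.
  exists [seq d - e | d <- r], (fun d => locfrac (c (d + e)) s); split.
    by move=> d; exists e, (c (d + e)), s.
  rewrite big_map -frac_sum; apply: eq_bigr => d _; by rewrite subrK.
- move=> r c ur cP c0 d dr; have [t [e [m [te h]]]] := common_denominator r cP.
  have : locfrac (\sum_(d <- r) m d) t = locfrac 0 t :> loc D M.
    rewrite -frac_sum locfrac0 -[RHS]c0 big_seq [RHS]big_seq.
    by apply: eq_bigr => i /h[_ ->].
  move=> /fracP[u]; rewrite scaler0 => u0.
  have [f uf] := grD (denM u t).
  have : val (denM u t) *: m d = 0.
    (* After clearing denominators the term of index i has degree i + e, plus the degree f of u t; g
       records this shift, so that independence in M can be applied. *)
    pose g i := f + (i + e); pose gi i := i - f - e.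
    have gK i : gi (g i) = i by rewrite /gi /g; ring.
    pose c' i := if gi i \in r then val (denM u t) *: m (gi i) else 0.
    have := gr_direct grM (s := map g r) (c := c').
    move=> /(_ _ _ _ (g d)); rewrite /c' gK dr; apply.
    - by rewrite map_inj_uniq//; apply: can_inj gK.
    - move=> i; case: ifP => [ir|_]; last exact: (gr0 grM).
      have gE : f + (gi i + e) = i by rewrite /gi; ring.
      by have [mi _] := h _ ir; rewrite -[X in gr X]gE; exact: (grZ grM uf mi).
    - rewrite big_map -[RHS]u0 scaler_sumr big_seq [RHS]big_seq.
      by apply: eq_bigr => i ir; rewrite gK ir.
    - by rewrite map_f.
  have [_ ->] := h _ dr => ud.
  by rewrite -(locfrac0 M t); apply/fracP; exists u; rewrite scaler0 -val_denM.
Qed.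
End LocalizationGrading.

Section LocalizationMaps.
Variables (A : comPzRingType) (D : mult_set A).

Lemma loc_map_inj (M N : lmodType A) (f : {linear M -> N}) :
  injective f -> injective (loc_map D f).
Proof.
move=> finj y z; have [m [s ->]] := frac_ex y; have [m' [t ->]] := frac_ex z.
rewrite !loc_mapE => /fracP[u e]; apply/fracP; exists u.
by apply: finj; rewrite !linearZ.
Qed.

Variables (M : lmodType A) (t : den D).

Definition loc_div (y : loc D M) : loc D M :=
  loc_lift (fun m s => locfrac m (denM t s)) y.

Lemma loc_divE m s : loc_div (locfrac m s) = locfrac m (denM t s).
Proof.
apply: (loc_liftE (f := fun m s => locfrac m (denM t s))) => {}m {}s m' s' /fracP[u e].
apply/fracP; exists u; rewrite !val_denM !mulrA ![val u * val t]mulrC -!mulrA.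
by rewrite -scalerA e scalerA.
Qed.

Lemma loc_div_linear : linear loc_div.
Proof.
move=> a x y; have [m [s ->]] := frac_ex x; have [m' [s' ->]] := frac_ex y.
rewrite fracZ fracD !loc_divE fracZ fracD; apply: frac_eqI.
rewrite !val_denM !scalerDr !scalerA; congr (_ *: _ + _ *: _); ring.
Qed.
HB.instance Definition _ := GRing.isLinear.Build A (loc D M) (loc D M) _ loc_div loc_div_linear.
End LocalizationMaps.

Section LocalExtension.
Variables (R : realType) (V : vectType R) (Phi : root_system V).
Variables (P : positive_system Phi) (n : nat) (omega : n.-tuple 'Hom(V, R^o)).
Variable (k : fieldType).
Hypothesis omegaP : coweight_basis Phi omega.
Hypothesis char2 : 2%N \notin [pchar k].
Hypothesis gkmP : gkm P omega k.
Implicit Types (A B C : alcove P) (X Y : set (alcove P)) (U W : opens P) (d e : int).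
Local Notation Z := (structure_alg omega k).
Local Notation cr := (coroot_k Phi omega k).
Local Notation ZA := (Zalg P omega k).

Lemma Zalg_grM d e (z w : ZA) : Zalg_gr d z -> Zalg_gr e w -> Zalg_gr (d + e) (z * w).
Proof.
move=> /structure_grE hz /structure_grE hw; apply/structure_grE => A.
by rewrite atM; apply: symalg_grM.
Qed.

Lemma prod_coroot_gr (s : seq V) : symalg_gr (2 * size s)%N (\prod_(a <- s) cr a).
Proof.
elim: s => [|a s IH]; first by right; exists 0%N; rewrite ?big_nil ?dhomog1.
rewrite big_cons /= mulnS PoszD; apply: symalg_grM IH.
by right; exists 1%N => //; apply: coroot_k_homog.
Qed.

Lemma den_gr Q (s : den (coroot_mset P omega k Q)) : exists e, Zalg_gr e (val s).
Proof.
have [t [_ -> _ _]] := coordinate_den omegaP char2 s; exists (2 * size t)%N.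
by move=> A; apply: prod_coroot_gr.
Qed.

Section TuplePresheaf.
Variable Y : set (alcove P).

(** The special section presheaf with an arbitrary set Y; for Y a pair of special alcoves reflected
    in a, its localization is a summand for the local extension condition. *)
Definition tuple_sec U : lmodType ZA := Z (Y `&` open_set U).
Definition tuple_gr U d : set (tuple_sec U) := @structure_alg_gr _ _ _ _ _ _ _ _ d.
Definition tuple_res U W (h : open_set W `<=` open_set U) : {linear tuple_sec U -> tuple_sec W} :=
  projection (setIS (C := Y) h).

Lemma tuple_res_gr U W (h : open_set W `<=` open_set U) d x :
  tuple_gr d x -> tuple_gr d (tuple_res h x).
Proof. by move=> hx A; apply: hx. Qed.

Lemma at_tuple_res U W (h : open_set W `<=` open_set U) (x : tuple_sec U) A :
  Y A -> open_set W A -> at_ (tuple_res h x : Z (Y `&` open_set W)) A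
    = at_ (x : Z (Y `&` open_set U)) A.
Proof. by move=> YA WA; apply: at_projection. Qed.

Lemma tuple_res_id U (h : open_set U `<=` open_set U) x : tuple_res h x = x.
Proof. by apply: tuple_ext => A [YA UA]; rewrite at_tuple_res. Qed.

Lemma tuple_res_comp U W T (h : open_set W `<=` open_set U)
    (h' : open_set T `<=` open_set W) (h'' : open_set T `<=` open_set U) x :
  tuple_res h' (tuple_res h x) = tuple_res h'' x.
Proof.
by apply: tuple_ext => A [YA TA]; rewrite !at_tuple_res//; apply: h'.
Qed.

Definition tuple_presheaf := Presheaf tuple_res_gr tuple_res_id tuple_res_comp.

Variable a : V.
Local Notation N := (loc_presheaf a tuple_presheaf).

Lemma loc_tuple_res_inj U W (h : open_set W `<=` open_set U) :
  Y `&` open_set U `<=` open_set W -> injective (res N h).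
Proof.
move=> UW; apply: loc_map_inj => x y e; apply: tuple_ext => A [YA UA].
have WA : open_set W A by apply: UW.
have := congr1 (fun z : tuple_sec W => at_ (z : Z (Y `&` open_set W)) A) e.
by rewrite /= !at_tuple_res.
Qed.

Lemma loc_tuple_graded : enumerable Y -> graded N.
Proof.
move=> [T [r [g hY]]] U; apply: loc_grading; first exact: Zalg_grM.
  exact: den_gr.
by apply: structure_grading; exists T, r, g => A [/hY].
Qed.

(** One member of the cover sees all of Y inside W, so gluing just reads off the section there, and
    no common denominator for an infinite family has to be found. *)
Lemma loc_tuple_sheaf : enumerable Y ->
  (forall (I : Type) (U : I -> opens P) W, open_set W `<=` \bigcup_i open_set (U i) ->
     Y `&` open_set W = set0 \/ exists i, Y `&` open_set W `<=` open_set (U i)) ->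
  graded_sheaf N.
Proof.
move=> enumY coverY; split; first exact: loc_tuple_graded.
move=> I U W UW cov d s sd compat.
have [W0|[i Yi]] := coverY I U W cov.
  have all0 (W' : opens P) (h : open_set W' `<=` open_set W) (y : sec N W') : y = 0.
    have [m [t ->]] := frac_ex y; rewrite -(locfrac0 _ t); congr locfrac.
    apply: tuple_ext => A [YA WA]; exfalso.
    by have : (Y `&` open_set W) A; [split=> //; apply: h|rewrite W0].
  exists 0; split; last by move=> t _; apply/esym/(all0 W (fun _ => id)).
  split; first exact: (gr0 (loc_tuple_graded enumY W)).
  by move=> i; rewrite linear0; apply/esym/(all0 _ (UW i)).
have [e [m [t [te me sE]]]] := sd i.
have [A B b j [YA WA] [YB WB] bP AB|A B l' [YA WA] [YB WB] lL AB|m' m'E] :=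
  @tuple_exists _ _ _ P _ omega k (Y `&` open_set W)
    (at_ (m : Z (Y `&` open_set (U i)))).
- by apply: at_reflects bP AB; split=> //; apply: Yi.
- by apply: at_translates lL AB; split=> //; apply: Yi.
have ri : res N (UW i) (locfrac (m' : tuple_sec W) t) = s i.
  rewrite sE [LHS]loc_mapE; congr locfrac; apply: tuple_ext => A [YA UA].
  by rewrite at_tuple_res// m'E//; split=> //; apply: UW UA.
exists (locfrac (m' : tuple_sec W) t); split; last first.
  move=> t' [_ /(_ i) t'i]; apply: (loc_tuple_res_inj (h := UW i)) => //.
  by rewrite ri.
split.
  exists e, (m' : tuple_sec W), t; split=> //.
  apply/structure_grE => A; have [[YA WA]|nYA] := pselect ((Y `&` open_set W) A).
    by rewrite m'E//; move: A {YA WA}; apply/structure_grE.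
  by rewrite at_out//; apply: symalg_gr0.
move=> j; apply: (loc_tuple_res_inj (h := @subIsetr _ (open_set (U i)) (open_set (U j))
  : open_set (openI (U i) (U j)) `<=` open_set (U j))).
  by move=> A [YA Aj]; split=> //; apply: Yi; split=> //; apply: UW Aj.
have sub : open_set (openI (U i) (U j)) `<=` open_set W by move=> A [/UW].
by rewrite -compat -ri (res_comp _ _ sub) (res_comp _ _ sub).
Qed.

End TuplePresheaf.
End LocalExtension.

(** * Splitting the special section into pairs along a root *)

Section SpecialLocalExtension.
Variables (R : realType) (V : vectType R) (Phi : root_system V).
Variables (P : positive_system Phi) (n : nat) (omega : n.-tuple 'Hom(V, R^o)).
Variable (k : fieldType).
Hypothesis omegaP : coweight_basis Phi omega.
Hypothesis char2 : 2%N \notin [pchar k].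
Hypothesis gkmP : gkm P omega k.
Implicit Types (A B C : alcove P) (X Y : set (alcove P)) (U W : opens P) (d e : int).
Local Notation Z := (structure_alg omega k).
Local Notation cr := (coroot_k Phi omega k).
Local Notation ZA := (Zalg P omega k).
Local Notation pair := (cpair Phi).
Local Notation refl := (srefl Phi).
Local Notation weyl := (weyl Phi).
Local Notation red := (@pos_reduced _ _ _ _ _ _ _ omegaP gkmP).
Variable l : V.
Hypothesis lL : weight_lattice Phi l.
Local Notation K := (special_section_sheaf P omega k l).
Local Notation walc := (weyl_alcove P lL).
Variable a : V.
Hypothesis aP : a \in pos P.
Local Notation ms := (coroot_mset P omega k (predC1 a)).

Definition other_roots : seq V := rem a (undup (pos P)).
Definition other_coroots : symalg n k := \prod_(b <- other_roots) cr b.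

Lemma other_rootsP b : b \in other_roots -> b \in pos P /\ predC1 a b.
Proof. by rewrite mem_rem_uniq ?undup_uniq// inE mem_undup => /andP[]. Qed.

Lemma other_coroots_product : mset ms (Zscalar P omega other_coroots).
Proof. by exists other_roots => //; apply: other_rootsP. Qed.

Definition other_den : den ms := mkden other_coroots_product.

Definition string_stable Y : Prop := forall A B m, special_section l A -> special_section l B ->
  reflects a m A B -> Y A <-> Y B.

Definition extension_of Y A (p q : symalg n k) : Prop :=
  (Y A -> q = other_coroots * p) /\ (~ Y A -> q = 0).

(** Extension by zero after multiplication by [other_coroots]. For b other than a every entry is
    divisible by b^v; for a, a reflection either stays in Y or stays outside it. *)
Lemma string_extension Y U : Y `<=` special_section l -> string_stable Y ->
  exists f : {linear tuple_sec omega k Y U -> sec K U}, forall m A, special_section l A -> open_set U A ->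
    extension_of Y A (at_ (m : Z (Y `&` open_set U)) A)
      (at_ (f m : Z (special_section l `&` open_set U)) A).
Proof.
move=> YK Yst.
have /choice[f fE] : forall m : Z (Y `&` open_set U), exists m' : Z (special_section l `&` open_set U),
    forall A, special_section l A -> open_set U A -> extension_of Y A (at_ m A) (at_ m' A).
  move=> m.
  have /choice[F FE] : forall A, exists q, extension_of Y A (at_ m A) q.
    move=> A; have [YA|nYA] := pselect (Y A); first by exists (other_coroots * at_ m A).
    by exists 0.
  have [A B b j [Al UA] [Bl UB] bP AB|A B l' [Al _] [Bl _] l'L AB|m' m'E] :=
    @tuple_exists _ _ _ P _ omega k (special_section l `&` open_set U) F; last first.
  - by exists m' => A Al UA; rewrite m'E.
  - by rewrite (special_translates_eq lL Al Bl l'L AB).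
  have [F1 F0] := FE A; have [G1 G0] := FE B.
  have [ba|ba] := eqVneq b a.
    rewrite ba in AB; have st := Yst A B j Al Bl AB.
    have [YA|nYA] := pselect (Y A); last first.
      by rewrite F0// G0 ?subrr -?st//; apply: divides0.
    have YB := st.1 YA; rewrite F1// G1// -mulrBr ba; apply: divides_mull.
    by apply: at_reflects AB.
  have dv : divides (cr b) other_coroots.
    have bo : b \in other_roots by rewrite mem_rem_uniq ?undup_uniq// inE mem_undup ba.
    rewrite /other_coroots (perm_big _ (perm_to_rem bo)) big_cons.
    by exists (\prod_(c <- rem b other_roots) cr c).
  apply: dividesB.
    have [/F1->|/F0->] := pselect (Y A); [exact: divides_mulr|exact: divides0].
  have [/G1->|/G0->] := pselect (Y B); [exact: divides_mulr|exact: divides0].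
have flin : linear (f : tuple_sec omega k Y U -> sec K U).
  move=> c x y; apply: tuple_ext => A [Al UA].
  have [h1 h0] := fE (c *: (x : Z (Y `&` open_set U)) + y) A Al UA.
  have [x1 x0] := fE x A Al UA; have [y1 y0] := fE y A Al UA.
  rewrite atD at_scale; have [YA|nYA] := pselect (Y A).
    by rewrite h1// x1// y1// atD at_scale mulrDr mulrCA.
  by rewrite h0// x0// y0// mulr0 addr0.
by exists (HB.pack f (GRing.isLinear.Build ZA (tuple_sec omega k Y U) (sec K U) _ f flin)
  : {linear tuple_sec omega k Y U -> sec K U}).
Qed.

(** Dividing by [other_den] restores the degree and makes restriction to Y a left inverse. *)
Lemma string_hom Y : Y `<=` special_section l -> string_stable Y ->
  exists iota : presheaf_hom (loc_presheaf a (tuple_presheaf omega k Y)) (loc_presheaf a K),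
  forall U (m : tuple_sec omega k Y U) s, exists2 m' : sec K U,
    hom_fun iota U (locfrac m s) = locfrac m' (denM other_den s) &
    forall A, special_section l A -> open_set U A ->
      extension_of Y A (at_ (m : Z (Y `&` open_set U)) A)
        (at_ (m' : Z (special_section l `&` open_set U)) A).
Proof.
move=> YK Yst; pose f U := projT1 (cid (string_extension U YK Yst)).
have fE U m A : special_section l A -> open_set U A ->
    extension_of Y A (at_ (m : Z (Y `&` open_set U)) A)
      (at_ (f U m : Z (special_section l `&` open_set U)) A).
  by rewrite /f; case: cid => f' f'E; apply: f'E.
pose N := loc_presheaf a (tuple_presheaf omega k Y).
pose g U : {linear sec N U -> sec (loc_presheaf a K) U} := loc_div other_den \o loc_map ms (f U).
have gE U (m : tuple_sec omega k Y U) s : g U (locfrac m s) = locfrac (f U m) (denM other_den s).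
  by rewrite /g /= loc_mapE loc_divE.
have g_gr U d (x : sec N U) : gr d x -> gr d (g U x).
  move=> [e [m [s [se me ->]]]]; rewrite gE.
  exists (Posz (2 * size other_roots)%N + e), (f U m), (denM other_den s); split=> //.
    rewrite val_denM; apply: Zalg_grM => //.
    by move=> A; apply: prod_coroot_gr.
  apply/structure_grE => A.
  have [[Al UA]|nA] := pselect ((special_section l `&` open_set U) A); last first.
    by rewrite at_out//; apply: symalg_gr0.
  have [f1 f0] := fE U m A Al UA; have [YA|nYA] := pselect (Y A); last first.
    by rewrite f0//; apply: symalg_gr0.
  rewrite f1// addrCA; apply: symalg_grM; first exact: prod_coroot_gr.
  by move/structure_grE : me.
have g_res U W (h : open_set W `<=` open_set U) (x : sec N U) :
    g W (res N h x) = res (loc_presheaf a K) h (g U x).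
  have [m [s ->]] := frac_ex x.
  have rN : res N h (locfrac m s) =
      locfrac (tuple_res omega k Y h m : tuple_sec omega k Y W) s.
    exact: loc_mapE.
  rewrite rN !gE [RHS]loc_mapE.
  congr locfrac; apply: tuple_ext => A [Al WA]; rewrite at_res//.
  have UA := h _ WA; have [f1 f0] := fE U m A Al UA.
  have [f1' f0'] := fE W (tuple_res omega k Y h m) A Al WA.
  have [YA|nYA] := pselect (Y A); last by rewrite f0// f0'.
  by rewrite f1// f1'// at_tuple_res.
exists (Hom g_gr g_res) => U m s; exists (f U m); first exact: gE.
by move=> A; apply: fE.
Qed.

Variable c : int.
Hypothesis cE : pair a l = c%:~R.
Let aR : a \in roots Phi := pos_root aP.
Local Notation rho0 := (small_rho P).

Definition string_pair w : set (alcove P) :=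
  [set A | A = walc w \/ A = walc (refl a \o w)%VF].

Section Pair.
Variable w : 'End(V).
Hypothesis wW : weyl w.
Hypothesis wneg : pair a (w rho0) < 0.
Let uW : weyl (refl a \o w)%VF := weyl_comp (weyl_refl aR) wW.

Lemma string_pair_reflects : reflects a c (walc w) (walc (refl a \o w)%VF).
Proof. exact: weyl_alcove_refl. Qed.

Lemma string_pair_neg : alcove_set (walc w) `<=` neg_half Phi a c `&` pos_half Phi a (c - 1).
Proof.
have wx := weyl_alcove_pt P lL wW; have [_ ->] := alcoveE wx => y /= h.
have [+ _] := weyl_rho_bound P wW aR; rewrite ltr_norml => /andP[h1 _].
rewrite /neg_half /pos_half /= -[coroot _ _ _]/(pair a y) -(same_cell_lt _ h)// -h//.
by rewrite pairD cE rmorphB /=; move: wneg h1 => h0 h1; split; lra.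
Qed.

Lemma string_pair_up : up a (walc w) (walc (refl a \o w)%VF).
Proof. exists c; split; [exact: string_pair_neg|exact: string_pair_reflects]. Qed.

Lemma string_pair_bruhat : bruhat (walc w) (walc (refl a \o w)%VF).
Proof.
apply: rt_step; exists a, c; split=> //; last exact: string_pair_reflects.
by move=> x /string_pair_neg[].
Qed.

Lemma string_pair_special : string_pair w `<=` special_section l.
Proof. by move=> _ [->|->]; apply: weyl_alcove_special. Qed.

Lemma string_pair_stable : string_stable (string_pair w).
Proof.
suff h A B m : special_section l A -> special_section l B -> reflects a m A B ->
    string_pair w A -> string_pair w B.
  move=> A B m Al Bl AB; split; first exact: h AB.
  apply: (h B A m Bl Al).
  have [x Ax] := alcove_pt A; have Bx := (reflectsP m B aR Ax).1 AB.
  by apply/(reflectsP _ _ aR Bx); rewrite areflectionK.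
move=> Al Bl AB YA; have := reflects_special lL aR Al Bl AB.
rewrite cE => /eqP; rewrite eqr_int => /eqP mE; rewrite -mE in AB.
case: YA => AE; rewrite AE in AB; [right|left]; apply: alcove_set_inj.
  by rewrite AB string_pair_reflects.
rewrite AB; have := weyl_alcove_refl P lL uW aR cE.
have -> : (refl a \o (refl a \o w))%VF = w by apply/lfunP => x; rewrite !lfE reflK.
by move=> ->.
Qed.

Lemma string_pair_enumerable : enumerable (string_pair w).
Proof. by apply: (special_enumerable lL); apply: string_pair_special. Qed.

(** The pair is a chain, so a member of the cover containing its upper alcove contains both. *)
Lemma string_pair_cover (I : Type) (U : I -> opens P) W :
  open_set W `<=` \bigcup_i open_set (U i) ->
  string_pair w `&` open_set W = set0 \/
  exists i, string_pair w `&` open_set W `<=` open_set (U i).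
Proof.
move=> cov; have [WB|nWB] := pselect (open_set W (walc (refl a \o w)%VF)).
  have [i _ Ui] := cov _ WB; right; exists i => A [[->|->] _] //.
  exact: (open_lower Ui string_pair_bruhat).
have [WA|nWA] := pselect (open_set W (walc w)).
  by have [i _ Ui] := cov _ WA; right; exists i => A [[->|->]].
by left; apply/seteqP; split=> // A [[->|->]].
Qed.

Lemma string_pair_sheaf : graded_sheaf (loc_presheaf a (tuple_presheaf omega k (string_pair w))).
Proof.
by apply: (loc_tuple_sheaf omegaP char2); [apply: string_pair_enumerable|apply: string_pair_cover].
Qed.

Lemma string_pair_supp : bruhat_supp (loc_presheaf a (tuple_presheaf omega k (string_pair w)))
  `<=` alpha_string a (walc w).
Proof.
move=> C [x x0]; have [[->|->]|nYC] := pselect (string_pair w C).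
- by exists 0%N; left.
- by exists 1%N; left; exists (walc (refl a \o w)%VF) => //; apply: string_pair_up.
exfalso; apply: x0; apply: val_inj.
have /eqP e := valP x.
apply: (loc_tuple_res_inj (h := @boundary_sub _ _ _ P [set C])).
  move=> A [YA [_ -> leAC]] C' leC'A; split; first by exists C => //; apply: rt_trans leAC.
  move=> /= CE; rewrite CE in leC'A; apply: nYC.
  by rewrite -(special_bruhat_anti red lL (string_pair_special YA) leAC leC'A).
by rewrite e linear0.
Qed.
End Pair.

Lemma special_local_extension_at : exists (r : nat) (N : 'I_r -> presheaf P omega k)
    (iota : forall i, presheaf_hom (N i) (loc_presheaf a K)),
    (forall i, graded_sheaf (N i) /\ exists A, bruhat_supp (N i) `<=` alpha_string a A) /\
    is_direct_sum iota.
Proof.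
have [ws [uws wsE]] := weyl_finite Phi.
(* Exactly one of w and s_a w has [rho0] sent to the negative side of a; listing these lower alcoves
   lists each pair once. *)
pose s := [seq w : 'End(V) <- ws | pair a (w rho0) < 0].
have us : uniq s by rewrite filter_uniq.
pose wi (i : 'I_(size s)) := s`_i.
have wiP i : weyl (wi i) /\ pair a (wi i rho0) < 0.
  have : wi i \in s by rewrite mem_nth.
  by rewrite mem_filter => /andP[? /wsE].
pose Y i := string_pair (wi i).
pose YK i := string_pair_special (wiP i).1.
pose N i := loc_presheaf a (tuple_presheaf omega k (Y i)).
pose iota i := projT1 (cid (string_hom (YK i) (string_pair_stable (wiP i).1))).
have iotaE i U (m : tuple_sec omega k (Y i) U) t : exists2 m' : sec K U,
    hom_fun (iota i) U (locfrac m t) = locfrac m' (denM other_den t) &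
    forall A, special_section l A -> open_set U A ->
      extension_of (Y i) A (at_ (m : Z (Y i `&` open_set U)) A)
        (at_ (m' : Z (special_section l `&` open_set U)) A).
  by rewrite /iota; case: cid => f fE; apply: fE.
have neg_refl (w : 'End(V)) : pair a ((refl a \o w)%VF rho0) = - pair a (w rho0).
  by rewrite lfE reflE pairB pairZ pairK//; ring.
have reflKw (w : 'End(V)) : (refl a \o (refl a \o w))%VF = w by apply/lfunP => x; rewrite !lfE reflK.
have reflW (w : 'End(V)) : weyl w -> weyl (refl a \o w)%VF by apply: weyl_comp (weyl_refl aR).
have disj i j A : Y i A -> Y j A -> i = j.
  have [wiW wineg] := wiP i; have [wjW wjneg] := wiP j.
  have wij : wi i = wi j -> i = j.
    by move=> /eqP; rewrite nth_uniq// => /eqP/val_inj.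
  move=> [->|->] [|] /(weyl_alcove_inj red) e.
  - exact/wij/e.
  - have wE := e wiW (reflW _ wjW).
    by move: wineg; rewrite wE neg_refl oppr_lt0 ltNge ltW.
  - have wE := e (reflW _ wiW) wjW.
    by move: wjneg; rewrite -wE neg_refl oppr_lt0 ltNge ltW.
  - have wE := e (reflW _ wiW) (reflW _ wjW).
    by apply: wij; rewrite -[wi i]reflKw wE reflKw.
have cover A : special_section l A -> exists i, Y i A.
  move=> /(weyl_alcove_surj lL)[w wW ->].
  have idx v : weyl v -> pair a (v rho0) < 0 -> exists i, wi i = v.
    move=> vW vneg; have vs : v \in s by rewrite mem_filter vneg; apply/wsE.
    have lt_i : (index v s < size s)%N by rewrite index_mem.
    by exists (Ordinal lt_i); rewrite /wi nth_index.
  have [_] := weyl_rho_bound P wW aR; rewrite neq_lt => /orP[h|h].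
    by have [i iE] := idx w wW h; exists i; left; rewrite iE.
  have [|i iE] := idx _ (reflW _ wW); first by rewrite neg_refl oppr_lt0.
  by exists i; right; rewrite iE reflKw.
exists (size s), N, iota; split.
  move=> i; split; first exact: (string_pair_sheaf (wiP i).1 (wiP i).2).
  by exists (walc (wi i)); apply: (string_pair_supp (wiP i).1 (wiP i).2).
move=> U y.
have YU i : Y i `&` open_set U `<=` special_section l `&` open_set U.
  by move=> A [/YK Al UA].
pose pr i : {linear sec K U -> tuple_sec omega k (Y i) U} := projection (YU i).
pose pl i : {linear sec (loc_presheaf a K) U -> sec (N i) U} := loc_map ms (pr i).
have prA i (m : sec K U) A : Y i A -> open_set U A ->
    at_ (pr i m : Z (Y i `&` open_set U)) A = at_ (m : Z (special_section l `&` open_set U)) A.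
  by move=> YA UA; apply: at_projection.
have prK i (x : sec (N i) U) : pl i (hom_fun (iota i) U x) = x.
  have [m [t ->]] := frac_ex x; have [m' -> m'E] := iotaE i U m t.
  rewrite [LHS]loc_mapE.
  have -> : pr i m' = val other_den *: m.
    apply: tuple_ext => A [YA UA]; rewrite prA// at_scale.
    by have [e _] := m'E A (YK _ _ YA) UA; rewrite e.
  by apply: frac_eqI; rewrite val_denM scalerA mulrC.
have pr0 i j (x : sec (N i) U) : i != j -> pl j (hom_fun (iota i) U x) = 0.
  move=> ij; have [m [t ->]] := frac_ex x; have [m' -> m'E] := iotaE i U m t.
  rewrite [LHS]loc_mapE -(locfrac0 _ (denM other_den t)); congr locfrac.
  apply: tuple_ext => A [YA UA]; rewrite prA// at0.
  have [_ e] := m'E A (YK _ _ YA) UA; apply: e.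
  by move=> YiA; rewrite (disj _ _ _ YiA YA) eqxx in ij.
exists (fun i => pl i y); split; last first.
  move=> x ->; apply: functional_extensionality_dep => j.
  rewrite linear_sum (bigD1 j)//= prK big1 ?addr0// => i ij; exact: pr0.
have [m [t yE]] := frac_ex y.
have /choice[e eE] : forall i, exists m' : sec K U,
    hom_fun (iota i) U (pl i y) = locfrac m' (denM other_den t) /\
    forall A, special_section l A -> open_set U A ->
      extension_of (Y i) A (at_ (pr i m : Z (Y i `&` open_set U)) A)
        (at_ (m' : Z (special_section l `&` open_set U)) A).
  move=> i; have [m' m1 m2] := iotaE i U (pr i m) t; exists m'; split=> //.
  by rewrite yE [X in hom_fun _ _ X]loc_mapE.
rewrite (eq_bigr _ (fun i _ => (eE i).1)) frac_sum yE.
have -> : \sum_i e i = val other_den *: m.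
  apply: tuple_ext => A [Al UA]; rewrite at_sum at_scale.
  have [i YA] := cover A Al; rewrite (bigD1 i)//= big1 => [|j ji].
    by have [_ /(_ A Al UA)[h _]] := eE i; rewrite h// prA// addr0.
  have [_ /(_ A Al UA)[_ h]] := eE j; apply: h.
  by move=> YjA; rewrite (disj _ _ _ YjA YA) eqxx in ji.
by apply: frac_eqI; rewrite val_denM scalerA mulrC.
Qed.
End SpecialLocalExtension.

(** * Lifting sections along epimorphisms *)

Section GradedSheaves.
Variables (R : realType) (V : vectType R) (Phi : root_system V).
Variables (P : positive_system Phi) (n : nat) (omega : n.-tuple 'Hom(V, R^o)).
Variable (k : fieldType).
Implicit Types (A B C : alcove P) (U W : opens P) (d e : int).
Local Notation ZA := (Zalg P omega k).
Local Notation presheaf := (presheaf P omega k).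
Local Notation Zgr := (@Zalg_gr _ _ _ P n omega k).

Section Gradings.
Variables (M : lmodType ZA) (gr : int -> set M).
Hypothesis grM : is_grading Zgr gr.

Lemma gr_add d x y : gr d x -> gr d y -> gr d (x + y).
Proof.
move=> hx hy; rewrite -[y]opprK; apply: (grB grM hx).
by rewrite -sub0r; apply: (grB grM (gr0 grM d) hy).
Qed.

Lemma gr_mulrn d x m : gr d x -> gr d (x *+ m).
Proof.
move=> hx; elim: m => [|m IH]; first by rewrite mulr0n; apply: (gr0 grM).
by rewrite mulrS; apply: gr_add.
Qed.

Lemma gr_decomposition x : exists (r : seq int) (c : int -> M),
  [/\ uniq r, forall d, gr d (c d) & x = \sum_(d <- r) c d].
Proof.
have [r [c [cP ->]]] := gr_span grM x.
exists (undup r), (fun d => c d *+ count_mem d r); split; first exact: undup_uniq.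
  by move=> d; apply: gr_mulrn.
by rewrite -big_undup_iterop_count.
Qed.

Lemma gr_decomposition_at d x : exists (r : seq int) (c : int -> M),
  [/\ uniq r, d \in r, forall e, gr e (c e) & x = \sum_(e <- r) c e].
Proof.
have [r [c [ur cP ->]]] := gr_decomposition x.
have [dr|dr] := boolP (d \in r); first by exists r, c.
exists (d :: r), (fun e => if e == d then 0 else c e).
split; rewrite /= ?dr ?mem_head//.
  by move=> e; case: eqP => // _; apply: (gr0 grM).
rewrite big_cons eqxx add0r big_seq [RHS]big_seq; apply: eq_bigr => e er.
by case: eqP => // ed; rewrite -ed er in dr.
Qed.
End Gradings.

(** The component of x in degree d is the preimage: its image must be the degree d component of f x,
    by independence in N. *)
Lemma gr_image (M N : lmodType ZA) (grM : int -> set M) (grN : int -> set N)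
    (f : {linear M -> N}) : is_grading Zgr grM -> is_grading Zgr grN ->
  (forall d x, grM d x -> grN d (f x)) ->
  forall d x, grN d (f x) -> exists2 x', grM d x' & f x' = f x.
Proof.
move=> hM hN fgr d x fx; have [r [c [ur dr cP xE]]] := gr_decomposition_at hM d x.
exists (c d) => //; apply/eqP; rewrite -subr_eq0; apply/eqP.
have := gr_direct hN (s := r) (c := fun e => f (c e) - (if e == d then f x else 0)).
move=> /(_ ur _ _ d dr); rewrite eqxx; apply.
  move=> e; apply: (grB hN); first exact: fgr.
  by case: eqP => [->//|_]; apply: (gr0 hN).
rewrite sumrB -linear_sum -xE -big_mkcond /=.
by rewrite -big_filter (_ : [seq e <- r | e == d] = [:: d]) ?big_seq1 ?subrr// filter_pred1_uniq.
Qed.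

(** Uniqueness of gluing is available in each degree only. Independence of degrees on each member of
    the cover makes all components of t restrict to zero. *)
Lemma sheaf_separated (M : presheaf) (I : Type) (U : I -> opens P) W
    (UW : forall i, open_set (U i) `<=` open_set W) : graded_sheaf M ->
  open_set W `<=` \bigcup_i open_set (U i) ->
  forall t : sec M W, (forall i, res M (UW i) t = 0) -> t = 0.
Proof.
move=> [Mgr Msh] cov t t0; have [r [c [ur cP tE]]] := gr_decomposition (Mgr W) t.
rewrite tE big_seq big1// => d dr.
have c0 i : res M (UW i) (c d) = 0.
  apply: (gr_direct (Mgr (U i)) (s := r) (c := fun e => res M (UW i) (c e))) => //.
    by move=> e; apply: res_gr.
  by rewrite -linear_sum -tE t0.
have [||u [_ uniq_u]] := Msh I U W UW cov d (fun=> 0).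
- by move=> i; apply: (gr0 (Mgr _)).
- by move=> i j; rewrite !linear0.
rewrite -(uniq_u (c d)); first by rewrite -(uniq_u 0)//; split=> [|i]; [apply: (gr0 (Mgr _))|rewrite linear0].
by split.
Qed.

Lemma sheaf_eq (M : presheaf) (I : Type) (U : I -> opens P) W
    (UW : forall i, open_set (U i) `<=` open_set W) : graded_sheaf M ->
  open_set W `<=` \bigcup_i open_set (U i) ->
  forall t u : sec M W, (forall i, res M (UW i) t = res M (UW i) u) -> t = u.
Proof.
move=> Msh cov t u tu; apply/eqP; rewrite -subr_eq0; apply/eqP.
by apply: (sheaf_separated Msh cov) => i; rewrite linearB tu subrr.
Qed.

Lemma flabby_gr (M : presheaf) U W (h : open_set W `<=` open_set U) d (y : sec M W) :
  graded_sheaf M -> flabby M -> gr d y -> exists2 x, gr d x & res M h x = y.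
Proof.
move=> [Mgr _] fl yd; have [x xE] := fl U W h y; rewrite -xE in yd *.
by apply: (gr_image (Mgr U) (Mgr W)) yd => e z; apply: res_gr.
Qed.

Lemma lower_self A : open_set (lower [set A]) A.
Proof. by exists A => //; apply: rt_refl. Qed.

Lemma lower_sub A U : open_set U A -> open_set (lower [set A]) `<=` open_set U.
Proof. by move=> UA B [_ -> BA]; apply: open_lower BA. Qed.

Section Exact.
Variables (L M N : presheaf) (f : presheaf_hom L M) (g : presheaf_hom M N).
Hypothesis Lsh : graded_sheaf L.
Hypothesis Lfl : flabby L.
Hypothesis Msh : graded_sheaf M.
Hypothesis Nsh : graded_sheaf N.
Hypothesis fg : short_exact f g.

Lemma exact_inj U : injective (hom_fun f U).
Proof.
have [finj _ _] := fg; move=> x y e; apply/eqP; rewrite -subr_eq0; apply/eqP.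
by apply: finj; rewrite linearB e subrr.
Qed.

Lemma exact_comp U x : hom_fun g U (hom_fun f U x) = 0.
Proof.
have [_ ex _] := fg; apply/ex => A UA; exists U, (@subset_refl _ _); split=> //.
by exists x; rewrite res_id.
Qed.

(** Exactness gives preimages locally. They may be taken homogeneous of degree d, and they agree on
    overlaps because f is injective, so they glue. *)
Lemma exact_ker U d (x : sec M U) : gr d x -> hom_fun g U x = 0 ->
  exists2 y, gr d y & hom_fun f U y = x.
Proof.
have [_ ex _] := fg; move=> xd /ex loc.
have /choice[c cP] : forall i : {A | open_set U A},
    exists p : {W : opens P & sec L W}, exists h : open_set (projT1 p) `<=` open_set U,
    [/\ open_set (projT1 p) (sval i), gr d (projT2 p) & hom_fun f _ (projT2 p) = res M h x].
  move=> [A UA]; have [W [h [WA [y yE]]]] := loc A UA.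
  have [|y' yd yE'] := gr_image (Lsh.1 W) (Msh.1 W) (@hom_gr _ _ _ _ _ _ _ _ _ f W) (d := d) (x := y).
    by rewrite yE; apply: res_gr.
  by exists (existT _ W y'), h; split; rewrite //= yE' yE.
pose Wi i := projT1 (c i); pose yi i : sec L (Wi i) := projT2 (c i).
have WU i : open_set (Wi i) `<=` open_set U by have [] := cP i.
have WA i : open_set (Wi i) (sval i) by have [h []] := cP i.
have yd i : gr d (yi i) by have [h []] := cP i.
have yE i : hom_fun f _ (yi i) = res M (WU i) x.
  by have [h [_ _ ->]] := cP i; congr (res M _ x); apply: Prop_irrelevance.
have cov : open_set U `<=` \bigcup_i open_set (Wi i).
  by move=> A UA; exists (exist _ A UA) => //; apply: (WA (exist _ A UA)).
have [|y [[yd' yW] _]] := Lsh.2 _ Wi U WU cov d yi yd.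
  move=> i j; apply: exact_inj; rewrite !hom_res !yE.
  have hij : open_set (openI (Wi i) (Wi j)) `<=` open_set U by move=> A [/WU].
  by rewrite !(res_comp _ _ hij).
exists y => //; apply: (sheaf_eq (UW := WU) Msh cov) => i.
by rewrite -hom_res yW yE.
Qed.

Variables (J U0 : opens P).
Hypothesis JU0 : open_set J `<=` open_set U0.
Variables (d : int) (y : sec N U0).
Hypothesis yd : gr d y.
Hypothesis yJ : res N JU0 y = 0.

Record partial_lift := PartialLift {
  pl_open : opens P;
  pl_sub : open_set pl_open `<=` open_set U0;
  pl_J : open_set J `<=` open_set pl_open;
  pl_sec : sec M pl_open;
  pl_gr : gr d pl_sec;
  pl_lift : hom_fun g pl_open pl_sec = res N pl_sub y;
  pl_zero : res M pl_J pl_sec = 0 }.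

Definition pl_le (p q : partial_lift) : bool :=
  `[< exists h : open_set (pl_open p) `<=` open_set (pl_open q), res M h (pl_sec q) = pl_sec p >].

(** A lift x exists on the smallest open neighbourhood of A. On the overlap with [pl_open p] the two
    lifts differ by a section of L, which flabbiness extends over that neighbourhood; correcting x
    by it allows gluing. *)
Lemma pl_extend (p : partial_lift) A : open_set U0 A ->
  exists2 q, pl_le p q & open_set (pl_open q) A.
Proof.
move=> UA; have [_ _ surj] := fg; have LA : open_set (lower [set A]) `<=` open_set U0 by exact: lower_sub.
set W := lower [set A] in LA *.
have [x xd xE] : exists2 x, gr d x & hom_fun g W x = res N LA y.
  have [W' [h [W'A [x xE]]]] := surj _ y A UA.
  have WW' : open_set W `<=` open_set W' by exact: lower_sub.
  have e : hom_fun g W (res M WW' x) = res N LA y by rewrite hom_res xE (res_comp _ _ LA).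
  have := gr_image (Msh.1 W) (Nsh.1 W) (@hom_gr _ _ _ _ _ _ _ _ _ g W) (d := d) (x := res M WW' x).
  by rewrite e; apply; apply: res_gr.
pose U := pl_open p; pose O := openI U W.
have OU : open_set O `<=` open_set U by move=> B [].
have OW : open_set O `<=` open_set W by move=> B [].
have OU0 : open_set O `<=` open_set U0 by move=> B [/pl_sub].
pose z := res M OU (pl_sec p) - res M OW x.
have [||w wd wE] := @exact_ker O d z.
- by apply: (grB (Msh.1 O)); apply: res_gr => //; apply: pl_gr.
- by rewrite linearB /= !hom_res pl_lift xE !(res_comp _ _ OU0) subrr.
have [w' wd' wE'] := flabby_gr OW Lsh Lfl wd.
pose x' := x + hom_fun f W w'.
have xd' : gr d x' by apply: (gr_add (Msh.1 W)) => //; apply: hom_gr.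
have xO : res M OW x' = res M OU (pl_sec p).
  by rewrite linearD /= -hom_res wE' wE addrC subrK.
have xg : hom_fun g W x' = res N LA y by rewrite linearD /= exact_comp addr0.
have TP B C : (open_set U `|` open_set W) B -> bruhat C B -> (open_set U `|` open_set W) C.
  by move=> [UB|WB] CB; [left|right]; apply: open_lower CB.
pose T := Opens TP.
pose Vb (b : bool) := if b then U else W.
have VT b : open_set (Vb b) `<=` open_set T by case: b => B; [left|right].
have covT : open_set T `<=` \bigcup_b open_set (Vb b).
  by move=> B [UB|WB]; [exists true|exists false].
pose sb b : sec M (Vb b) := if b as b' return sec M (Vb b') then pl_sec p else x'.
have sd b : gr d (sb b) by case: b => //; apply: pl_gr.
have [|t [[td tE] _]] := Msh.2 _ Vb T VT covT d sb sd.
  have eqO (O' : opens P) (h1 : open_set O' `<=` open_set U) (h2 : open_set O' `<=` open_set W) :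
      res M h1 (pl_sec p) = res M h2 x'.
    have hO : open_set O' `<=` open_set O by move=> B OB; split; [apply: h1|apply: h2].
    by rewrite -(res_comp OU hO) -(res_comp OW hO) xO.
  case=> [] []; rewrite /=; [|exact: eqO|exact/esym/eqO|];
    by congr (res M _ _); apply: Prop_irrelevance.
have TU0 : open_set T `<=` open_set U0 by move=> B [/pl_sub|/LA].
have JT : open_set J `<=` open_set T by move=> B JB; left; apply: (@pl_J p).
have tU : res M (VT true) t = pl_sec p by exact: tE true.
have tg : hom_fun g T t = res N TU0 y.
  apply: (sheaf_eq (UW := VT) Nsh covT) => b; rewrite -hom_res tE.
  have h : open_set (Vb b) `<=` open_set U0 by move=> B /VT/TU0.
  rewrite (res_comp _ _ h); case: b h => h; rewrite /= ?pl_lift ?xg;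
    by congr (res N _ y); apply: Prop_irrelevance.
have tJ : res M JT t = 0 by rewrite -(pl_zero p) -tU (res_comp _ _ JT).
exists (PartialLift td tg tJ).
  by apply/asboolP; exists (VT true).
by right; apply: lower_self.
Qed.

Lemma pl_chain (F : set partial_lift) p0 : F p0 -> total_on F pl_le ->
  exists q, forall p, F p -> pl_le p q.
Proof.
move=> Fp0 tot.
have TP B C : (\bigcup_(p in F) open_set (pl_open p)) B -> bruhat C B ->
    (\bigcup_(p in F) open_set (pl_open p)) C.
  by move=> [p Fp pB] CB; exists p => //; apply: open_lower CB.
pose T := Opens TP.
pose Vb (i : {p | F p}) := pl_open (sval i).
have VT i : open_set (Vb i) `<=` open_set T by case: i => p Fp B /= pB; exists p.
have covT : open_set T `<=` \bigcup_b open_set (Vb b).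
  by move=> B [p Fp pB]; exists (exist _ p Fp).
have [||t [[td tE] _]] := Msh.2 _ Vb T VT covT d (fun i => pl_sec (sval i)).
- by move=> i; apply: pl_gr.
- move=> [p Fp] [q Fq] /=.
  have [/asboolP[h e]|/asboolP[h e]] := tot p q Fp Fq; rewrite -e.
    exact: res_comp.
  exact/esym/res_comp.
have TU0 : open_set T `<=` open_set U0 by move=> B [p _ /pl_sub].
have JT : open_set J `<=` open_set T by move=> B JB; exists p0 => //; apply: (@pl_J p0).
have tg : hom_fun g T t = res N TU0 y.
  apply: (sheaf_eq (UW := VT) Nsh covT) => i; rewrite -hom_res tE pl_lift.
  by rewrite (res_comp _ _ (@pl_sub (sval i))).
have tJ : res M JT t = 0.
  by rewrite -(pl_zero p0) -(tE (exist _ p0 Fp0)) (res_comp _ _ JT).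
exists (PartialLift td tg tJ) => p Fp; apply/asboolP.
by exists (VT (exist _ p Fp)); apply: (tE (exist _ p Fp)).
Qed.

Lemma exact_lift : exists x : sec M U0,
  [/\ gr d x, hom_fun g U0 x = y & res M JU0 x = 0].
Proof.
have l0 : hom_fun g J 0 = res N JU0 y by rewrite linear0 yJ.
have z0 : res M (@subset_refl _ (open_set J)) 0 = 0 by rewrite linear0.
pose p0 := PartialLift (gr0 (Msh.1 J) d) l0 z0.
have [|||p pmax] := ZL_preorder p0 (R := pl_le).
- by move=> p; apply/asboolP; exists (@subset_refl _ _); rewrite res_id.
- move=> p q r /asboolP[h e] /asboolP[h' e']; apply/asboolP.
  exists (subset_trans h h'); rewrite -e -e'; symmetry; exact: res_comp.
- move=> F tot; have [[p Fp]|nF] := pselect (exists p, F p); first exact: pl_chain Fp tot.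
  by exists p0 => p Fp; exfalso; apply: nF; exists p.
have full : open_set U0 `<=` open_set (pl_open p).
  move=> A UA; have [q pq qA] := pl_extend p UA.
  by have /asboolP[h _] := pmax q pq; apply: h.
exists (res M full (pl_sec p)); split; first exact: res_gr (pl_gr p).
  by rewrite hom_res pl_lift (res_comp _ _ (@subset_refl _ _)) res_id.
by rewrite (res_comp _ _ (@pl_J p)) pl_zero.
Qed.
End Exact.
End GradedSheaves.

(** * Projectivity *)

Section Projectivity.
Variables (R : realType) (V : vectType R) (Phi : root_system V).
Variables (P : positive_system Phi) (n : nat) (omega : n.-tuple 'Hom(V, R^o)).
Variable (k : fieldType).
Hypothesis omegaP : coweight_basis Phi omega.
Hypothesis char2 : 2%N \notin [pchar k].
Hypothesis gkmP : gkm P omega k.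
Implicit Types (A B C : alcove P) (X Y : set (alcove P)) (U W : opens P) (d e : int).
Local Notation Z := (structure_alg omega k).
Local Notation cr := (coroot_k Phi omega k).
Local Notation ZA := (Zalg P omega k).
Local Notation refl := (srefl Phi).
Local Notation red := (@pos_reduced _ _ _ _ _ _ _ omegaP gkmP).
Variable l : V.
Hypothesis lL : weight_lattice Phi l.
Local Notation K := (special_section_sheaf P omega k l).
Local Notation walc := (weyl_alcove P lL).

Lemma orbit_map_pt A B x : alcove_set A x ->
  orbit_map A B <-> exists2 l', root_lattice Phi l' & alcove_set B (x + l').
Proof.
move=> Ax; split=> -[l' l'L h]; exists l' => //.
  exact: (translatesP B (root_lattice_weight l'L) Ax).1 h.
exact: (translatesP B (root_lattice_weight l'L) Ax).2 h.
Qed.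

Lemma orbit_map_sym A B : orbit_map A B -> orbit_map B A.
Proof.
have [x Ax] := alcove_pt A => /(orbit_map_pt _ Ax)[l' l'L Bx].
by apply/(orbit_map_pt _ Bx); exists (- l'); [apply: root_latticeN|rewrite addrK].
Qed.

Lemma orbit_map_trans A B C : orbit_map A B -> orbit_map B C -> orbit_map A C.
Proof.
have [x Ax] := alcove_pt A => /(orbit_map_pt _ Ax)[l' l'L Bx] /(orbit_map_pt _ Bx)[l2 l2L Cx].
by apply/(orbit_map_pt _ Ax); exists (l' + l2); [apply: root_latticeD|rewrite addrA].
Qed.

Lemma orbit_map_refl A : orbit_map A A.
Proof.
have [x Ax] := alcove_pt A; apply/(orbit_map_pt _ Ax).
by exists 0; [apply: root_lattice0|rewrite addr0].
Qed.

Lemma orbit_map_eq A B : orbit_map A = orbit_map B <-> orbit_map A B.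
Proof.
split=> [->|AB]; first exact: orbit_map_refl.
by apply/seteqP; split=> C; apply: orbit_map_trans => //; apply: orbit_map_sym.
Qed.

Lemma orbit_special_inj A B : special_section l A -> special_section l B -> orbit_map A B -> A = B.
Proof. by move=> Al Bl [l' l'L AB]; apply: (special_translates_eq lL Al Bl l'L AB). Qed.

Lemma coordinate_orbit (z : ZA) A B : orbit_map A B -> coordinate z A = coordinate z B.
Proof. by move=> [l' l'L AB]; rewrite -!at_setT; apply: at_translates AB. Qed.

Definition special_orbit B : Prop := exists2 A, special_section l A & orbit_map A B.

(** Modulo the root lattice, a reflection of a translate of A is the reflection of A in the parallel
    hyperplane through l. *)
Lemma orbit_reflects A B B' b m : b \in pos P -> special_section l A -> orbit_map A B ->
  reflects b m B B' -> exists A' m', [/\ special_section l A', reflects b m' A A' & orbit_map A' B'].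
Proof.
move=> bP Al; have bR := pos_root bP; have [x Ax] := alcove_pt A.
move=> /(orbit_map_pt _ Ax)[g gL Bx] /(reflectsP m B' bR Bx) B'x.
have [c cE] := weight_pair lL bR; have [i iE] := weight_pair (root_lattice_weight gL) bR.
have [rx _] := alcoveE Ax.
have [A' A'x] := cell_alcove P (regular_areflection c bR rx).
exists A', c; split.
- have := special_areflection lL bR Ax Al A'x.
  by rewrite (areflection_weight c cE) subrr scale0r addr0.
- by apply/(reflectsP _ _ bR Ax).
- apply/(orbit_map_pt _ A'x); exists (g + (m - c - i)%:~R *: b).
    by apply: root_latticeD => //; apply: root_latticeMz; apply: root_lattice_root.
  suff -> : areflection Phi b c x + (g + (m - c - i)%:~R *: b) = areflection Phi b m (x + g) by [].
  rewrite !areflectionE linearD /= [refl b g]reflE iE !rmorphB /= !scalerBl.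
  move: (refl b x) (c%:~R *: b) (m%:~R *: b) (i%:~R *: b) => r u v w.
  by rewrite -!addrA; congr (r + _); rewrite [LHS]addrCA; congr (g + _); rewrite [LHS]addrCA addNKr addrC.
Qed.

(* Extending by zero off the orbits that meet the special section avoids
   proving that there are no such orbits. *)
Lemma periodic_extension (z : Z (special_section l)) : exists ze : ZA,
  (forall A, special_section l A -> coordinate ze A = at_ z A) /\
  (forall B, ~ special_orbit B -> coordinate ze B = 0).
Proof.
have /choice[F FE] : forall B, exists q : symalg n k,
    (forall A, special_section l A -> orbit_map A B -> q = at_ z A) /\ (~ special_orbit B -> q = 0).
  move=> B; have [[A Al AB]|h] := pselect (special_orbit B); last first.
    by exists 0; split=> // A Al AB; exfalso; apply: h; exists A.
  exists (at_ z A); split; last by move=> h; exfalso; apply: h; exists A.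
  move=> A' Al' AB'; congr (at_ z _); apply: orbit_special_inj => //.
  exact: orbit_map_trans AB (orbit_map_sym AB').
have [B B' b m _ _ bP BB'|B B' l' _ _ l'L BB'|ze zeE] := @tuple_exists _ _ _ P _ omega k setT F.
- have bR := pos_root bP; have [F1 F0] := FE B; have [G1 G0] := FE B'.
  have B'B : reflects b m B' B.
    have [x Bx] := alcove_pt B; have B'x := (reflectsP m B' bR Bx).1 BB'.
    by apply/(reflectsP _ _ bR B'x); rewrite areflectionK.
  have [[A Al AB]|nB] := pselect (special_orbit B).
    have [A' [m' [Al' AA' AB']]] := orbit_reflects bP Al AB BB'.
    by rewrite (F1 A)// (G1 A')//; exact: (at_reflects z Al Al' bP AA').
  rewrite F0// G0 ?subrr; first exact: divides0.
  move=> [A Al AB]; apply: nB.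
  by have [A' [m' [Al' _ AB']]] := orbit_reflects bP Al AB B'B; exists A'.
- have oBB' : orbit_map B B' by exists l'.
  have [F1 F0] := FE B; have [G1 G0] := FE B'.
  have [[A Al AB]|nB] := pselect (special_orbit B).
    by rewrite (F1 A)// (G1 A)//; apply: orbit_map_trans AB oBB'.
  rewrite F0// G0// => -[A Al AB]; apply: nB; exists A => //.
  exact: orbit_map_trans AB (orbit_map_sym oBB').
exists ze; split=> [A Al|B nB]; rewrite -at_setT zeE//.
  by have [F1 _] := FE A; apply: F1 => //; apply: orbit_map_refl.
by have [_ F0] := FE B; apply: F0.
Qed.

(** The entries of [ze] at special alcoves outside U are left free; [vanishing_action] shows that
    they do not affect the action on m. *)
Definition represents U (ze : ZA) (z : sec K U) : Prop :=
  (forall A, special_section l A -> open_set U A ->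
     coordinate ze A = at_ (z : Z (special_section l `&` open_set U)) A) /\
  (forall B, ~ special_orbit B -> coordinate ze B = 0).

Lemma represents_exists U (z : sec K U) : exists ze, represents ze z.
Proof.
have [y yE] := special_extend omegaP char2 gkmP lL z.
by have [ze [ze1 ze0]] := periodic_extension y; exists ze; split=> // A Al UA; rewrite ze1// yE.
Qed.

Lemma represents_homogeneous U d (z : sec K U) : gr d z ->
  exists2 ze, represents ze z & Zalg_gr d ze.
Proof.
move=> /structure_grE zd; have [y yE] := special_extend omegaP char2 gkmP lL z.
have [y' y'E] := structure_comp d y.
have [ze [ze1 ze0]] := periodic_extension y'; exists ze; first split=> // A Al UA.
  by rewrite ze1// y'E yE// (symalg_grE _ _).1.
apply/structure_grE => B; rewrite at_setT.
have [[A Al AB]|nB] := pselect (special_orbit B); last first.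
  by rewrite ze0//; apply: symalg_gr0.
by rewrite -(coordinate_orbit _ AB) ze1// y'E; apply: symalg_comp_gr.
Qed.

(* The largest open set missing the special section.  A homomorphism from the
   special section sheaf to an object M of C amounts to a global section of M of
   degree 0 that vanishes there, namely the image of 1. *)
Lemma away_lower A B : (~ exists2 C, special_section l C & bruhat C A) -> bruhat B A ->
  ~ exists2 C, special_section l C & bruhat C B.
Proof. by move=> h BA [C Cl CB]; apply: h; exists C => //; apply: rt_trans CB BA. Qed.
Definition away : opens P := Opens away_lower.

Definition full : opens P := Opens (open_set := setT) (fun _ _ _ _ => I).

Lemma full_sub U : open_set U `<=` open_set full. Proof. by []. Qed.

(* pi (U \ away) is contained in pi (U n K_l): an alcove above the special section
   is also above its own translate in the special section. *)
Lemma special_orbit_open U A B : open_set U B -> ~ open_set away B ->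
  special_section l A -> orbit_map A B -> open_set U A.
Proof.
move=> UB /contrapT[C Cl CB] Al AB.
have [C' [g [Cl' gL C'B leC'B]]] := special_bruhat_orbit red lL Cl CB.
have -> : A = C'.
  apply: orbit_special_inj => //; apply: orbit_map_trans AB (orbit_map_sym _).
  by exists g.
exact: open_lower leC'B.
Qed.

Section Vanishing.
Variable M : presheaf P omega k.
Hypothesis MC : in_C M.
Variable m : sec M full.
Hypothesis m0 : res M (@full_sub away) m = 0.

(** For X = U \ [away] the boundary of X lies in [away], so m restricts to an element of
    [sec_at M X], to which the support condition applies. Idempotents of orbits, scaled into Z by s,
    decompose ze, and torsion-freeness removes s at the end. *)
Lemma vanishing_action U (ze : ZA) :
  (forall A, special_section l A -> open_set U A -> coordinate ze A = 0) ->
  (forall B, ~ special_orbit B -> coordinate ze B = 0) ->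
  ze *: res M (@full_sub U) m = 0.
Proof.
move=> zeU ze0; have [Msh Mf _ Msupp _] := MC.
pose X := open_set U `\` open_set away.
have lcX : locally_closed X by exists U, away.
have lowU : open_set (lower X) `<=` open_set U.
  by move=> B [A [UA _] BA]; apply: open_lower BA.
pose y := res M (@full_sub (lower X)) m.
have bdJ : open_set (boundary X) `<=` open_set away.
  by move=> B; rewrite boundaryE// => -[/lowU UB nX]; apply: contrapT => nJ; apply: nX.
have yker : y \in ker_pred (res M (@boundary_sub _ _ _ P X)).
  rewrite unfold_in /ker_pred (res_comp _ _ (@full_sub (boundary X))).
  by rewrite -(res_comp (@full_sub away) bdJ) m0 linear0.
pose ka : sec_at M X := Kernel yker.
have tf : torsion_free (sec_at M X).
  move=> f x f0 fx; apply: val_inj; have [tfM _] := Mf (lower X).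
  by apply: (tfM f) => //; have := congr1 val fx.
pose s : symalg n k := \prod_(b <- undup (pos P)) cr b.
have s0 : s <> 0.
  by apply/eqP; apply: (coroot_k_prod_neq0 (P := P) omegaP char2) => b; rewrite mem_undup.
have sP : coroot_products predT (Zscalar P omega s).
  by exists (undup (pos P)) => // b; rewrite mem_undup.
have crs b : b \in pos P -> divides (cr b) s.
  move=> bP; rewrite /s (perm_big _ (perm_to_rem (_ : b \in undup (pos P)))) ?mem_undup//.
  by rewrite big_cons; exists (\prod_(c <- rem b (undup (pos P))) cr c).
(* Here e A is s times the idempotent of the orbit of A; it lies in Z because every positive coroot
   divides s. *)
have /choice[e eE] : forall A, exists e : ZA, forall B,
    coordinate e B = if `[< orbit_map B = orbit_map A >] then s else 0.
  move=> A; pose F B := if `[< orbit_map B = orbit_map A >] then s else 0.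
  have [B B' b j _ _ bP _|B B' l' _ _ l'L BB'|e eF] := @tuple_exists _ _ _ P _ omega k setT F.
  - apply: dividesB; rewrite /F; case: ifP => _; do ?exact: divides0; exact: crs.
  - rewrite /F; congr (if `[< _ >] then _ else _).
    by have -> : orbit_map B = orbit_map B' by apply/orbit_map_eq; exists l'.
  by exists e => B; rewrite -at_setT eF.
(* If A is in U, ze vanishes on its orbit. Otherwise the orbit is outside pi(X) by
   [special_orbit_open], and e A kills [ka] by the support condition. *)
have eka A : special_section l A -> (e A * ze) *: ka = 0.
  move=> Al; have [UA|nUA] := pselect (open_set U A).
    suff -> : e A * ze = 0 by rewrite scale0r.
    apply: tuple_ext => B _; rewrite at0 atM !at_setT eE.
    case: asboolP => [|_]; last by rewrite mul0r.
    by move=> /orbit_map_eq BA; rewrite (coordinate_orbit _ BA) zeU// mulr0.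
  have nsupp : ~ supp_Z (sec_at M X) (orbit_map A).
    move=> /(Msupp X lcX)[B [UB nJB] /orbit_map_eq BA]; apply: nUA.
    exact: (special_orbit_open UB nJB Al (orbit_map_sym BA)).
  pose sd : den (coroot_mset P omega k predT) := @mkden _ (coroot_mset P omega k predT) _ sP.
  have y10 : locfrac (e A *: ka) sd = 0 :> loc_all (sec_at M X).
    apply: contrapT => ne; apply: nsupp; split; first by exists A.
    exists (locfrac (e A *: ka) sd) => //.
    exists (e A), (Zscalar P omega s), (locfrac ka den1); split=> //.
    by rewrite !fracZ; apply: frac_eqI; rewrite val_den1 scale1r.
  move: y10; rewrite -(locfrac0 _ sd) => /fracP[u]; rewrite scaler0 -scalerA.
  have [t [_ uE t0 _]] := coordinate_den omegaP char2 u.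
  rewrite uE => /(tf _ _ (elimN eqP t0)) /(tf _ _ s0) eK.
  by rewrite mulrC -scalerA eK scaler0.
have zeka : ze *: ka = 0.
  apply: (tf _ _ s0); rewrite scalerA.
  have [ws' [uws' wsE']] := weyl_finite Phi.
  (* Distinct special alcoves have distinct orbits, so the e A add up to s on the special orbits,
     and ze is zero elsewhere. *)
  suff -> : Zscalar P omega s * ze = \sum_(w <- ws') e (walc w) * ze.
    rewrite scaler_suml big_seq big1// => w /wsE' wW.
    by apply: eka; apply: weyl_alcove_special.
  apply: tuple_ext => B _; rewrite atM at_sum !at_setT.
  have [[A Al AB]|nB] := pselect (special_orbit B); last first.
    rewrite ze0// mulr0 big1// => w _.
    by rewrite atM !at_setT ze0// mulr0.
  have [w wW AE] := weyl_alcove_surj lL Al.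
  have ww : w \in ws' by apply/wsE'.
  rewrite (bigD1_seq w)//= big_seq_cond big1 => [|v /andP[/wsE' vW vw]].
    rewrite addr0 atM !at_setT eE -AE; case: asboolP => // h.
    by exfalso; apply: h; apply/orbit_map_eq; apply: orbit_map_sym.
  rewrite atM !at_setT eE; case: asboolP => [|_]; last by rewrite mul0r.
  move=> /orbit_map_eq Bv; exfalso; move/eqP: vw; apply.
  apply: (weyl_alcove_inj red (lL := lL) vW wW); rewrite -AE; apply/esym.
  apply: orbit_special_inj => //; first exact: weyl_alcove_special.
  exact: orbit_map_trans AB Bv.
have zey : ze *: y = 0 by have := congr1 val zeka.
(* The result so far concerns the lower set of X; the rest of U lies in [away], where m is zero. *)
pose Vb (b : bool) := if b then lower X else openI U away.
have VU b : open_set (Vb b) `<=` open_set U by case: b => [|B []].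
have cov : open_set U `<=` \bigcup_b open_set (Vb b).
  move=> B UB; have [JB|nJB] := pselect (open_set away B); first by exists false.
  by exists true => //; exists B => //; apply: rt_refl.
apply: (sheaf_separated (UW := VU) Msh cov) => b.
rewrite linearZ /= (res_comp _ _ (@full_sub (Vb b))).
case: b; first exact: zey.
have UJ : open_set (openI U away) `<=` open_set away by move=> B [].
rewrite -(res_comp (@full_sub away) UJ).
by rewrite m0 linear0 scaler0.
Qed.
End Vanishing.

Lemma special_in_C : in_C K.
Proof.
split.
- exact: special_sheaf.
- by move=> U; apply: structure_Zmod_f omegaP char2 gkmP _.
- by split; [apply: special_flabby|apply: special_finitely_supported].
- exact: special_support_condition.
- move=> a aP; have [c cE] := weight_pair lL (pos_root aP).
  exact: (special_local_extension_at omegaP char2 gkmP lL aP cE).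
Qed.

(** Two representatives of z differ by an element to which [vanishing_action] applies. Linearity,
    degree and compatibility with restriction then follow by choosing a convenient representative
    each time. *)
Lemma special_hom (M : presheaf P omega k) (m : sec M full) : in_C M -> gr 0 m ->
  res M (@full_sub away) m = 0 ->
  exists h : presheaf_hom K M, forall U ze (z : sec K U), represents ze z ->
    hom_fun h U z = ze *: res M (@full_sub U) m.
Proof.
move=> MC m_gr m0; have [[Mgr _] _ _ _ _] := MC.
have wd U (z : sec K U) ze ze' : represents ze z -> represents ze' z ->
    ze *: res M (@full_sub U) m = ze' *: res M (@full_sub U) m.
  move=> [h1 h0] [h1' h0']; apply/eqP; rewrite -subr_eq0 -scalerBl; apply/eqP.
  apply: vanishing_action => // [A Al UA|B nB]; rewrite -at_setT atB !at_setT.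
    by rewrite h1// h1'// subrr.
  by rewrite h0// h0'// subrr.
pose lf U (z : sec K U) := projT1 (cid (represents_exists z)).
have lfP U (z : sec K U) : represents (lf U z) z by rewrite /lf; case: cid.
pose f U (z : sec K U) : sec M U := lf U z *: res M (@full_sub U) m.
have fE U (z : sec K U) ze : represents ze z -> f U z = ze *: res M (@full_sub U) m.
  by move=> zez; apply: wd zez.
have flin U : linear (f U).
  move=> c x y; rewrite /f scalerA -scalerDl; apply: fE.
  have [x1 x0] := lfP U x; have [y1 y0] := lfP U y.
  split=> [A Al UA|B nB]; rewrite -at_setT atD atM !at_setT.
    by rewrite x1// y1// [in RHS]atD at_scale.
  by rewrite x0// y0// mulr0 addr0.
pose fl U : {linear sec K U -> sec M U} := HB.pack (f U)
  (GRing.isLinear.Build ZA (sec K U) (sec M U) _ (f U) (flin U)).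
have f_gr U d (x : sec K U) : gr d x -> gr d (fl U x).
  move=> xd; have [ze zex zed] := represents_homogeneous xd.
  rewrite [fl U x](fE U x ze zex) -[d]addr0.
  by apply: (grZ (Mgr U)) => //; apply: res_gr.
have f_res U W (h : open_set W `<=` open_set U) (x : sec K U) :
    fl W (res K h x) = res M h (fl U x).
  have [x1 x0] := lfP U x.
  rewrite [RHS]linearZ /= (res_comp _ _ (@full_sub W)); apply: fE.
  split=> [A Al WA|//]; rewrite x1//; last exact: h.
  by rewrite at_res.
by exists (Hom f_gr f_res) => U ze z zez; apply: fE.
Qed.

Theorem special_projective : projective_in_C K.
Proof.
split; first exact: special_in_C.
move=> L M N f g LC MC NC fg h.
have [Lsh _ [Lfl _] _ _] := LC; have [Msh _ _ _ _] := MC; have [Nsh _ _ _ _] := NC.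
pose one U : sec K U := (1 : Z (special_section l `&` open_set U)).
have one_gr : gr 0 (one full).
  apply/structure_grE => A.
  have [XA|nXA] := pselect ((special_section l `&` open_set full) A); last first.
    by rewrite at_out//; apply: symalg_gr0.
  by rewrite at1//; right; exists 0%N => //; apply: dhomog1.
have one_res U : res K (@full_sub U) (one full) = one U.
  by apply: tuple_ext => A [Al UA]; rewrite at_res// !at1.
pose y := hom_fun h full (one full).
(* No special alcove lies in [away], so the unit section is already zero there. *)
have y_away : res N (@full_sub away) y = 0.
  rewrite -hom_res one_res (_ : one away = 0) ?linear0//.
  apply: tuple_ext => A [Al nA]; exfalso; apply: nA; exists A => //; exact: rt_refl.
have [m [m_gr mE m0]] := exact_lift Lsh Lfl Msh Nsh fg (hom_gr h one_gr) y_away.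
have [h' h'E] := special_hom MC m_gr m0; exists h' => U x.
have [ze zex] := represents_exists x.
rewrite (h'E U ze x zex) linearZ /= hom_res mE -hom_res one_res -linearZ; congr (hom_fun h U _).
apply: tuple_ext => A [Al UA]; rewrite at_scale at1// mulr1.
by have [-> ] := zex.
Qed.
End Projectivity.

Theorem proposition7p3 (R : realType) (V : vectType R) (Phi : root_system V)
    (P : positive_system Phi) (n : nat) (omega : n.-tuple 'Hom(V, R^o))
    (k : fieldType) (lambda : V) :
  irreducible_root_system Phi ->
  coweight_basis Phi omega ->
  2%N \notin [pchar k] ->
  gkm P omega k ->
  weight_lattice Phi lambda ->
  projective_in_C (special_section_sheaf P omega k lambda).
Proof.
by move=> _ omegaP char2 gkmP lL; apply: (special_projective omegaP char2 gkmP lL).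
Qed.
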